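(* Let $T\in\mathcal{BC}(X)$, $m\in\mathbb N_0$, and let $U\subset\mathbb H$ be a bounded slice Cauchy domain with $\sigma_S(T)\subset U$. Then for every $J\in\mathbb S$, $$\mathcal Q_m(T,\bar T)=-\frac1{4\pi(m+1)(m+2)}\int_{\partial(U\cap\mathbb C_J)}F_L(s,T)\,ds_J\,s^{m+2}=-\frac1{4\pi(m+1)(m+2)}\int_{\partial(U\cap\mathbb C_J)}s^{m+2}\,ds_J\,F_R(s,T),$$ where $\mathcal Q_m(T,\bar T)=\sum_{j=0}^m\frac{2(m-j+1)}{(m+1)(m+2)}T^{m-j}\bar T^j$.
   Context: $\mathbb H$ denotes the quaternions with units $e_1,e_2,e_3$; $\mathbb S$ is the sphere of unit purely imaginary quaternions, $\mathbb C_J=\{u+Jv\}$. $X=X_{\mathbb R}\otimes\mathbb H$ is a two-sided quaternionic Banach module over a real Banach space $X_{\mathbb R}$; $\mathcal{BC}(X)$ is the set of $T=T_0+\sum_{i=1}^3T_ie_i$ with pairwise commuting $T_i\in\mathcal B(X_{\mathbb R})$; $\bar T=T_0-\sum T_ie_i$; $\mathcal Q_{c,s}(T)=s^2\mathcal I-s(T+\bar T)+T\bar T$; $\sigma_S(T)$ is the set of $s$ where $\mathcal Q_{c,s}(T)$ has no bounded inverse. The $F$-resolvent operators are $F_L(s,T)=-4(s\mathcal I-\bar T)\mathcal Q_{c,s}(T)^{-2}$ and $F_R(s,T)=-4\mathcal Q_{c,s}(T)^{-2}(s\mathcal I-\bar T)$ for $s\notin\sigma_S(T)$. A slice Cauchy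 domain is an axially symmetric open set $U$ (with $u+Iv$ it contains all $u+Jv$, $J\in\mathbb S$) such that for each $J$ the boundary of $U\cap\mathbb C_J$ is a finite union of nonintersecting piecewise $C^1$ Jordan curves. Integrals are over positively oriented boundaries with $ds_J=ds(-J)$. *)

(* Defs.v *)
From Stdlib Require Import Reals List ClassicalEpsilon.
From Coquelicot Require Import Coquelicot.
Open Scope R_scope.

Record quat := Q { q0 : R; q1 : R; q2 : R; q3 : R }.

Definition qreal (u : R) : quat := Q u 0 0 0.
Definition qadd (p q : quat) : quat :=
  Q (q0 p + q0 q) (q1 p + q1 q) (q2 p + q2 q) (q3 p + q3 q).
Definition qopp (p : quat) : quat := Q (- q0 p) (- q1 p) (- q2 p) (- q3 p).
(* Hamilton product: e1 e2 = e3, e2 e3 = e1, e3 e1 = e2, ei^2 = -1 *)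
Definition qmul (p q : quat) : quat :=
  Q (q0 p * q0 q - q1 p * q1 q - q2 p * q2 q - q3 p * q3 q)
    (q0 p * q1 q + q1 p * q0 q + q2 p * q3 q - q3 p * q2 q)
    (q0 p * q2 q - q1 p * q3 q + q2 p * q0 q + q3 p * q1 q)
    (q0 p * q3 q + q1 p * q2 q - q2 p * q1 q + q3 p * q0 q).
Fixpoint qpow (s : quat) (n : nat) : quat :=
  match n with O => qreal 1 | S k => qmul s (qpow s k) end.
Definition qnorm2 (p : quat) : R := q0 p ^ 2 + q1 p ^ 2 + q2 p ^ 2 + q3 p ^ 2.

Definition in_sphere (J : quat) : Prop := q0 J = 0 /\ q1 J ^ 2 + q2 J ^ 2 + q3 J ^ 2 = 1.

Definition cJ (J : quat) (p : R * R) : quat := qadd (qreal (fst p)) (qmul J (qreal (snd p))).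

Definition qopen (U : quat -> Prop) : Prop :=
  forall q, U q -> exists e, 0 < e /\ forall p, qnorm2 (qadd p (qopp q)) < e * e -> U p.
Definition qbounded (U : quat -> Prop) : Prop :=
  exists M, forall q, U q -> qnorm2 q <= M.
Definition axially_symmetric (U : quat -> Prop) : Prop :=
  forall u v I J, in_sphere I -> in_sphere J -> U (cJ I (u, v)) -> U (cJ J (u, v)).

(* ---------- Plane topology (C_J identified isometrically with R^2) ---------- *)
Definition dist2 (p a : R * R) : R := (fst p - fst a) ^ 2 + (snd p - snd a) ^ 2.
Definition pclosure (A : R * R -> Prop) (p : R * R) : Prop :=
  forall e, 0 < e -> exists a, A a /\ dist2 p a < e * e.
Definition pboundary (A : R * R -> Prop) (p : R * R) : Prop :=
  forall e, 0 < e -> (exists a, A a /\ dist2 p a < e * e) /\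
                     (exists a, ~ A a /\ dist2 p a < e * e).
Definition slice (U : quat -> Prop) (J : quat) : R * R -> Prop := fun p => U (cJ J p).

Definition C1_curve (h : R -> R * R) : Prop :=
  (forall t, ex_derive (fun s => fst (h s)) t /\ ex_derive (fun s => snd (h s)) t) /\
  (forall t, continuous (Derive (fun s => fst (h s))) t /\
             continuous (Derive (fun s => snd (h s))) t).

Definition piecewise_C1 (g : R -> R * R) : Prop :=
  exists (n : nat) (p : nat -> R), p O = 0 /\ p n = 1 /\
    (forall i, (i < n)%nat -> p i < p (S i)) /\
    (forall i, (i < n)%nat -> exists h, C1_curve h /\
        forall t, p i <= t <= p (S i) -> g t = h t).

Definition jordan_pwC1 (g : R -> R * R) : Prop :=
  piecewise_C1 g /\ g 0 = g 1 /\
  (forall t1 t2, 0 <= t1 < 1 -> 0 <= t2 < 1 -> g t1 = g t2 -> t1 = t2).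

Definition dummy_curve : R -> R * R := fun _ => (0, 0).

Definition boundary_param (U : quat -> Prop) (J : quat) (G : list (R -> R * R)) : Prop :=
  (forall g, In g G -> jordan_pwC1 g) /\
  (forall i j, (i < length G)%nat -> (j < length G)%nat -> i <> j ->
     forall t1 t2, 0 <= t1 <= 1 -> 0 <= t2 <= 1 ->
       nth i G dummy_curve t1 <> nth j G dummy_curve t2) /\
  (forall p, pboundary (slice U J) p <->
     exists g, In g G /\ exists t, 0 <= t <= 1 /\ g t = p).

Definition winding (g : R -> R * R) (a : R * R) : R :=
  / (2 * PI) * RInt (fun t =>
     ((fst (g t) - fst a) * Derive (fun s => snd (g s)) t
      - (snd (g t) - snd a) * Derive (fun s => fst (g s)) t)
     / ((fst (g t) - fst a) ^ 2 + (snd (g t) - snd a) ^ 2)) 0 1.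

Definition total_winding (G : list (R -> R * R)) (a : R * R) : R :=
  fold_right (fun g acc => winding g a + acc) 0 G.

Definition pos_oriented_boundary (U : quat -> Prop) (J : quat) (G : list (R -> R * R)) : Prop :=
  boundary_param U J G /\
  (forall a, slice U J a -> total_winding G a = 1) /\
  (forall a, ~ pclosure (slice U J) a -> total_winding G a = 0).

Definition slice_cauchy_domain (U : quat -> Prop) : Prop :=
  qopen U /\ axially_symmetric U /\
  forall J, in_sphere J -> exists G, boundary_param U J G.

(* ---------- The quaternionic module X = X_R ⊗ H ---------- *)
Section Module.
Variable V : CompleteNormedModule R_AbsRing.

Record HX := mkHX { x0 : V; x1 : V; x2 : V; x3 : V }.

Definition hxplus (x y : HX) : HX :=
  mkHX (plus (x0 x) (x0 y)) (plus (x1 x) (x1 y)) (plus (x2 x) (x2 y)) (plus (x3 x) (x3 y)).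
Definition hxscal (r : R) (x : HX) : HX :=
  mkHX (scal r (x0 x)) (scal r (x1 x)) (scal r (x2 x)) (scal r (x3 x)).
Definition hxzero : HX := mkHX zero zero zero zero.
Definition hxminus (x y : HX) : HX := hxplus x (hxscal (-1) y).
Definition hxnorm (x : HX) : R := norm (x0 x) + norm (x1 x) + norm (x2 x) + norm (x3 x).

(* action of A0 + A1 e1 + A2 e2 + A3 e3 (Ai real operators) on x = Σ xj ej *)
Definition opact (A0 A1 A2 A3 : V -> V) (x : HX) : HX :=
  mkHX (minus (minus (minus (A0 (x0 x)) (A1 (x1 x))) (A2 (x2 x))) (A3 (x3 x)))
       (minus (plus (plus (A0 (x1 x)) (A1 (x0 x))) (A2 (x3 x))) (A3 (x2 x)))
       (plus (plus (minus (A0 (x2 x)) (A1 (x3 x))) (A2 (x0 x))) (A3 (x1 x)))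
       (plus (minus (plus (A0 (x3 x)) (A1 (x2 x))) (A2 (x1 x))) (A3 (x0 x))).

Definition qscal (q : quat) (x : HX) : HX :=
  opact (scal (q0 q)) (scal (q1 q)) (scal (q2 q)) (scal (q3 q)) x.

Definition hx_bounded_linear (A : HX -> HX) : Prop :=
  (forall x y, A (hxplus x y) = hxplus (A x) (A y)) /\
  (forall r x, A (hxscal r x) = hxscal r (A x)) /\
  (exists C, forall x, hxnorm (A x) <= C * hxnorm x).

Definition has_bounded_inverse (A : HX -> HX) (B : HX -> HX) : Prop :=
  hx_bounded_linear B /\ (forall x, A (B x) = x) /\ (forall x, B (A x) = x).

(* T = T0 + Σ Ti ei in BC(X) *)
Record BCop := mkBC {
  Tc0 : V -> V; Tc1 : V -> V; Tc2 : V -> V; Tc3 : V -> V;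
  Tc0_lin : is_linear Tc0; Tc1_lin : is_linear Tc1;
  Tc2_lin : is_linear Tc2; Tc3_lin : is_linear Tc3;
  Tc_comm : forall (A B : V -> V),
     In A (Tc0 :: Tc1 :: Tc2 :: Tc3 :: nil) -> In B (Tc0 :: Tc1 :: Tc2 :: Tc3 :: nil) ->
     forall v, A (B v) = B (A v) }.

Definition Top (T : BCop) : HX -> HX := opact (Tc0 T) (Tc1 T) (Tc2 T) (Tc3 T).
Definition Tbar (T : BCop) : HX -> HX :=
  opact (Tc0 T) (fun v => opp (Tc1 T v)) (fun v => opp (Tc2 T v)) (fun v => opp (Tc3 T v)).

Definition Qcs (T : BCop) (s : quat) (x : HX) : HX :=
  hxplus (hxminus (qscal (qmul s s) x) (qscal s (hxplus (Top T x) (Tbar T x))))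
         (Top T (Tbar T x)).

Definition S_spectrum (T : BCop) (s : quat) : Prop :=
  ~ exists B, has_bounded_inverse (Qcs T s) B.

(* Q_{c,s}(T)^{-1} (the unique bounded inverse, for s outside the S-spectrum) *)
Definition Qinv (T : BCop) (s : quat) : HX -> HX :=
  epsilon (inhabits (fun x => x)) (fun B => has_bounded_inverse (Qcs T s) B).

Definition FL (T : BCop) (s : quat) (x : HX) : HX :=
  hxscal (-4) (hxminus (qscal s (Qinv T s (Qinv T s x))) (Tbar T (Qinv T s (Qinv T s x)))).
Definition FR (T : BCop) (s : quat) (x : HX) : HX :=
  hxscal (-4) (Qinv T s (Qinv T s (hxminus (qscal s x) (Tbar T x)))).

Fixpoint hxsum (n : nat) (f : nat -> HX) : HX :=
  match n with O => hxzero | S k => hxplus (hxsum k f) (f k) end.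

Definition Qm (T : BCop) (m : nat) (x : HX) : HX :=
  hxsum (S m) (fun j =>
    hxscal (2 * INR (m - j + 1) / (INR (m + 1) * INR (m + 2)))
      (Nat.iter (m - j) (Top T) (Nat.iter j (Tbar T) x))).

Definition hxint (f : R -> HX) (a b : R) : HX :=
  mkHX (RInt (fun t => x0 (f t)) a b) (RInt (fun t => x1 (f t)) a b)
       (RInt (fun t => x2 (f t)) a b) (RInt (fun t => x3 (f t)) a b).

Definition dsJ (J : quat) (g : R -> R * R) (t : R) : quat :=
  qmul (cJ J (Derive (fun s => fst (g s)) t, Derive (fun s => snd (g s)) t)) (qopp J).

Definition int_L (T : BCop) (m : nat) (J : quat) (G : list (R -> R * R)) (x : HX) : HX :=
  fold_right (fun g acc => hxplus (hxint (fun t =>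
      FL T (cJ J (g t)) (qscal (qmul (dsJ J g t) (qpow (cJ J (g t)) (m + 2))) x)) 0 1) acc)
    hxzero G.

Definition int_R (T : BCop) (m : nat) (J : quat) (G : list (R -> R * R)) (x : HX) : HX :=
  fold_right (fun g acc => hxplus (hxint (fun t =>
      qscal (qmul (qpow (cJ J (g t)) (m + 2)) (dsJ J g t)) (FR T (cJ J (g t)) x)) 0 1) acc)
    hxzero G.

End Module.
Arguments Top {V}. Arguments Tbar {V}. Arguments Qm {V}. Arguments int_L {V}.
Arguments int_R {V}. Arguments S_spectrum {V}. Arguments hxscal {V}.

(* Main.v *)
Require Import Defs.
From Stdlib Require Import Reals List Lra Lia ClassicalEpsilon.
From Coquelicot Require Import Coquelicot.
Open Scope R_scope.

(** For [s] in the slice [C_J] the operator [Q_{c,s}(T) = s^2 - s (T + Tbar) + T Tbar] is a monic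
    quadratic pencil in [s] whose coefficients act componentwise on [X], so they commute with the
    left multiplication by [J], which makes [X] a complex Banach space.

    Everything rests on the following fact: if [A] is a bounded complex-linear operator whose
    resolvent [R(s)] exists outside an open set [U], and the closed curves [G] avoid [U] and wind
    once around each of its points, then [int_G R(s) y ds = 2 pi i y]. The proof follows Dixon. With
    [k = 2 pi i y - int_G R(s) y ds], put [phi(z) = int_G R(s) y / (s - z) ds] for [z] in [U] and
    [phi(z) = R(z) k] elsewhere; then [(z - A) phi(z) = k] for every [z]. Hence [phi] is entire and
    vanishes at infinity, so [phi(0) = 0] by the mean value property, and [k = - A phi(0) = 0].

    Applied to the companion matrix [A] of the pencil, and then to a block matrix
    [[A, B], [0, A]] on [X^4], this yields [int Q^-1 x ds = 0], [int s Q^-1 x ds = 2 pi i x] and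
    [int Q^-2 x ds = int s Q^-2 x ds = 0]. The remaining moments [int s^k Q^-2 x ds] obey a linear
    recurrence, whose solution [2 pi i q_k] satisfies
    [q_{m+3} - Tbar q_{m+2} = sum_{j <= m} (m - j + 1) T^{m-j} Tbar^j x]. *)

(** * Linear identities in modules *)

(** [T] and [Tbar] need not commute with left multiplication by [J]: they are only real-linear for
    the complex structure of the slice, so the factors s - T and s - Tbar of the pencil cannot be
    treated separately there. T + Tbar and T Tbar can. Hence the contour integrals see only the
    pencil, while [T] and [Tbar] return in the algebraic solution of the recurrence and as
    real-linear maps applied before or after integration.

    About the curves only winding numbers are known. Dixon's function therefore replaces the usual
    deformation to a large circle with a Neumann series; the integrals computed directly are those
    of z^n, 1/(z - a)^2 and 1/(z - a). No separate gluing of the two formulas for phi is needed: the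
    boundary lies outside U, where the resolvent exists, and near such a point the equation (z - A)
    phi = k alone controls phi.

    The block matrix is there because its resolvent has the corner R B R, a product of two
    resolvents, which gives Q^-2 without differentiating in a parameter.

    Constants: 2 pi i from the moments times -i from [dsJ] is 2 pi; with -4 from the F-resolvent and
    the prefactor -1/(4 pi (m+1)(m+2)) this leaves 2/((m+1)(m+2)). *)

Section LinearExpr.

Variables (K : Ring) (G : AbelianGroup) (act : K -> G -> G).
Hypothesis act_plus_l : forall a b x, act (plus a b) x = plus (act a x) (act b x).
Hypothesis act_plus_r : forall a x y, act a (plus x y) = plus (act a x) (act a y).
Hypothesis act_mult : forall a b x, act (mult a b) x = act a (act b x).
Hypothesis act_one : forall x, act one x = x.

(** Syntax for proof by reflection: [ring] decides identities of scalars, so an identity of vectors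
    is reduced to one scalar identity per atom. The action stays abstract because it is instantiated
    both with the real [scal] and with the complex scaling [cs] defined below. *)
Inductive lexpr :=
  | LVar (n : nat) | LZero | LPlus (a b : lexpr) | LOpp (a : lexpr) | LAct (k : K) (a : lexpr).

Fixpoint leval (env : list G) (e : lexpr) : G :=
  match e with
  | LVar n => nth n env zero
  | LZero => zero
  | LPlus a b => plus (leval env a) (leval env b)
  | LOpp a => opp (leval env a)
  | LAct k a => act k (leval env a)
  end.

Fixpoint lcoef (e : lexpr) (n : nat) : K :=
  match e with
  | LVar m => if Nat.eqb m n then one else zero
  | LZero => zero
  | LPlus a b => plus (lcoef a n) (lcoef b n)
  | LOpp a => opp (lcoef a n)
  | LAct k a => mult k (lcoef a n)
  end.

(** The counter [i] is the position of the head of [env] in the full list of atoms; it lets the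
    induction run on [env] with [c] fixed. *)
Fixpoint lcomb (c : nat -> K) (i : nat) (env : list G) : G :=
  match env with
  | nil => zero
  | x :: env' => plus (act (c i) x) (lcomb c (S i) env')
  end.

Lemma act_zero_l x : act zero x = zero.
Proof.
  apply (plus_reg_l (act zero x)). rewrite <- act_plus_l, !plus_zero_r. reflexivity.
Qed.

Lemma act_zero_r a : act a zero = zero.
Proof.
  apply (plus_reg_l (act a zero)). rewrite <- act_plus_r, !plus_zero_r. reflexivity.
Qed.

Lemma plus_swap4 (a b c d : G) : plus (plus a b) (plus c d) = plus (plus a c) (plus b d).
Proof.
  rewrite <- !plus_assoc. f_equal. rewrite !plus_assoc. f_equal. apply plus_comm.
Qed.

Lemma lcomb_ext c d i env :
  (forall j, (i <= j < i + length env)%nat -> c j = d j) -> lcomb c i env = lcomb d i env.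
Proof.
  revert i; induction env as [|x env IH]; intros i H; simpl; [reflexivity|].
  rewrite (H i) by (simpl; lia). f_equal. apply IH. intros j Hj. apply H. simpl. lia.
Qed.

Lemma lcomb_zero c i env : (forall j, c j = zero) -> lcomb c i env = zero.
Proof.
  intros H; revert i; induction env as [|x env IH]; intros i; simpl; [reflexivity|].
  now rewrite H, act_zero_l, IH, plus_zero_r.
Qed.

Lemma lcomb_var m i env :
  lcomb (fun n => if Nat.eqb (i + m) n then one else zero) i env = nth m env zero.
Proof.
  revert m i; induction env as [|x env IH]; intros m i; simpl; [now destruct m|].
  destruct m as [|m].
  - rewrite Nat.add_0_r, Nat.eqb_refl, act_one.
    rewrite (lcomb_ext _ (fun _ => zero)).
    + rewrite lcomb_zero by reflexivity. apply plus_zero_r.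
    + intros j Hj. replace (Nat.eqb i j) with false; [reflexivity|].
      symmetry; apply Nat.eqb_neq; lia.
  - replace (Nat.eqb (i + S m) i) with false by (symmetry; apply Nat.eqb_neq; lia).
    rewrite act_zero_l, plus_zero_l, <- (IH m (S i)).
    apply lcomb_ext. intros j _. now rewrite Nat.add_succ_r.
Qed.

Lemma lcomb_plus c d i env :
  lcomb (fun n => plus (c n) (d n)) i env = plus (lcomb c i env) (lcomb d i env).
Proof.
  revert i; induction env as [|x env IH]; intros i; simpl; [now rewrite plus_zero_r|].
  now rewrite IH, act_plus_l, plus_swap4.
Qed.

Lemma lcomb_opp c i env : lcomb (fun n => opp (c n)) i env = opp (lcomb c i env).
Proof.
  apply (plus_reg_l (lcomb c i env)). rewrite plus_opp_r, <- lcomb_plus.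
  apply lcomb_zero. intros j. apply (@plus_opp_r K).
Qed.

Lemma lcomb_mult k c i env : lcomb (fun n => mult k (c n)) i env = act k (lcomb c i env).
Proof.
  revert i; induction env as [|x env IH]; intros i; simpl; [now rewrite act_zero_r|].
  now rewrite IH, act_mult, act_plus_r.
Qed.

Lemma leval_lcomb env e : leval env e = lcomb (lcoef e) 0 env.
Proof.
  induction e as [n| |a IHa b IHb|a IHa|k a IHa]; simpl.
  - symmetry. apply (lcomb_var n 0).
  - symmetry. now apply lcomb_zero.
  - rewrite lcomb_plus. congruence.
  - rewrite lcomb_opp. congruence.
  - rewrite lcomb_mult. congruence.
Qed.

Fixpoint same_coefs (e1 e2 : lexpr) (n : nat) : Prop :=
  match n with
  | O => True
  | S k => lcoef e1 k = lcoef e2 k /\ same_coefs e1 e2 k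
  end.

Lemma leval_eq env e1 e2 : same_coefs e1 e2 (length env) -> leval env e1 = leval env e2.
Proof.
  intros H. rewrite !leval_lcomb. apply lcomb_ext. intros j [_ Hj]. simpl in Hj.
  revert H Hj. generalize (length env). intros n; induction n as [|n IH]; simpl; [lia|].
  intros [H1 H2] Hj. destruct (Nat.eq_dec j n) as [->|]; [exact H1|]. apply IH; [exact H2|lia].
Qed.

End LinearExpr.

Arguments LVar {K}. Arguments LZero {K}. Arguments LPlus {K}. Arguments LOpp {K}.
Arguments LAct {K}.

Ltac atom_mem x l :=
  match l with
  | nil => constr:(false)
  | cons x _ => constr:(true)
  | cons _ ?l' => atom_mem x l'
  end.

Ltac atom_index x l :=
  match l with
  | cons x _ => constr:(O)
  | cons _ ?l' => let n := atom_index x l' in constr:(S n)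
  end.

(* The scaling map is recognised up to the coercion path of its module structure. *)
Ltac as_act act t :=
  lazymatch t with
  | act ?k ?a => constr:((k, a))
  | @scal _ _ ?k ?a =>
    lazymatch act with @scal _ _ => constr:((k, a)) | _ => constr:(tt) end
  | _ => constr:(tt)
  end.

Ltac lin_atoms act t l :=
  lazymatch t with
  | plus ?a ?b => let l1 := lin_atoms act a l in lin_atoms act b l1
  | minus ?a ?b => let l1 := lin_atoms act a l in lin_atoms act b l1
  | opp ?a => lin_atoms act a l
  | zero => l
  | _ => let p := as_act act t in
         lazymatch p with
         | (_, ?a) => lin_atoms act a l
         | _ => let m := atom_mem t l in
                lazymatch m with true => l | false => constr:(cons t l) end
         end
  end.

Ltac lin_reify K act t l :=
  lazymatch t with
  | plus ?a ?b => let x := lin_reify K act a l in let y := lin_reify K act b l in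
                  constr:(@LPlus K x y)
  | minus ?a ?b => let x := lin_reify K act a l in let y := lin_reify K act b l in
                  constr:(@LPlus K x (@LOpp K y))
  | opp ?a => let x := lin_reify K act a l in constr:(@LOpp K x)
  | zero => constr:(@LZero K)
  | _ => let p := as_act act t in
         lazymatch p with
         | (?k, ?a) => let x := lin_reify K act a l in constr:(@LAct K k x)
         | _ => let n := atom_index t l in constr:(@LVar K n)
         end
  end.

(* Reduces an identity between linear combinations, over a commutative ring acting through
   [act], to the identities between the coefficients of the atoms. *)
Ltac lin_coefs K G act H1 H2 H3 H4 :=
  lazymatch goal with
  | |- ?a = ?b =>
    let l0 := lin_atoms act a (@nil (AbelianGroup.sort G)) in
    let l := lin_atoms act b l0 in
    let x := lin_reify K act a l in
    let y := lin_reify K act b l in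
    change (leval K G act l x = leval K G act l y);
    apply (leval_eq K G act H1 H2 H3 H4);
    cbv [same_coefs length lcoef Nat.eqb]; repeat split
  end.

Lemma scal_plus_l (K : Ring) (V : ModuleSpace K) (a b : K) (x : V) :
  scal (plus a b) x = plus (scal a x) (scal b x).
Proof. apply scal_distr_r. Qed.

Lemma scal_mult_l (K : Ring) (V : ModuleSpace K) (a b : K) (x : V) :
  scal (mult a b) x = scal a (scal b x).
Proof. symmetry; apply scal_assoc. Qed.

Ltac module_coefs :=
  lazymatch goal with
  | |- context [@scal ?K ?V _ _] =>
    lin_coefs K (ModuleSpace.AbelianGroup K V) (@scal K V)
      (scal_plus_l K V) (@scal_distr_l K V) (scal_mult_l K V) (@scal_one K V)
  end.

Ltac module_R := module_coefs; cbn; ring.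

(** * Products of complete normed modules *)

Section ProdComplete.

Variables U V : CompleteNormedModule R_AbsRing.

Definition prod_lim (F : (U * V -> Prop) -> Prop) : U * V :=
  (lim (fun P => F (fun x => P (fst x))), lim (fun P => F (fun x => P (snd x)))).

Lemma prod_complete_ax1 (F : (U * V -> Prop) -> Prop) :
  ProperFilter F -> cauchy F -> forall eps : posreal, F (ball (prod_lim F) eps).
Proof.
  intros FF HF eps.
  assert (H1 : F (fun x => ball (lim (fun P => F (fun x => P (fst x)))) eps (fst x))).
  { apply (complete_cauchy (T := U) (fun P => F (fun x => P (fst x)))).
    - apply (filtermap_proper_filter _ _ fst F FF).
    - intros e. destruct (HF e) as [x Hx]. exists (fst x).
      revert Hx. apply filter_imp. intros y Hy. apply Hy. }
  assert (H2 : F (fun x => ball (lim (fun P => F (fun x => P (snd x)))) eps (snd x))).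
  { apply (complete_cauchy (T := V) (fun P => F (fun x => P (snd x)))).
    - apply (filtermap_proper_filter _ _ snd F FF).
    - intros e. destruct (HF e) as [x Hx]. exists (snd x).
      revert Hx. apply filter_imp. intros y Hy. apply Hy. }
  generalize (filter_and _ _ H1 H2). apply filter_imp. intros y Hy. exact Hy.
Qed.

Lemma prod_complete_ax2 (F1 F2 : (U * V -> Prop) -> Prop) :
  filter_le F1 F2 -> filter_le F2 F1 -> close (prod_lim F1) (prod_lim F2).
Proof.
  intros H12 H21 eps. split.
  - apply (close_lim (T := U) (fun P => F1 (fun x => P (fst x))) (fun P => F2 (fun x => P (fst x)))).
    + intros P. apply H12.
    + intros P. apply H21.
  - apply (close_lim (T := V) (fun P => F1 (fun x => P (snd x))) (fun P => F2 (fun x => P (snd x)))).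
    + intros P. apply H12.
    + intros P. apply H21.
Qed.

Definition prod_complete_mixin : CompleteSpace.mixin_of (prod_UniformSpace U V) :=
  CompleteSpace.Mixin _ prod_lim prod_complete_ax1 prod_complete_ax2.

(** The companion matrix, the block matrix and the quaternionic module all live on products, and
    completeness is what makes continuous functions with values there integrable. *)
Canonical prod_CompleteNormedModule : CompleteNormedModule R_AbsRing :=
  CompleteNormedModule.Pack R_AbsRing (U * V)
    (CompleteNormedModule.Class R_AbsRing (U * V)
      (NormedModule.class R_AbsRing (prod_NormedModule R_AbsRing U V)) prod_complete_mixin)
    (U * V).

End ProdComplete.

(** * Integrals and bounded operators *)

Section LinearIntegral.

Variables U V : NormedModule R_AbsRing.

Lemma Riemann_sum_linear (l : U -> V) (f : R -> U) ptd :
  is_linear l -> Riemann_sum (fun t => l (f t)) ptd = l (Riemann_sum f ptd).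
Proof.
  intros Hl. revert ptd. apply SF_cons_ind.
  - intros x. change (zero = l zero). symmetry. now apply linear_zero.
  - intros h s IH. rewrite !Riemann_sum_cons, IH, (linear_plus l Hl), (linear_scal l Hl). reflexivity.
Qed.

Lemma is_RInt_linear (l : U -> V) (f : R -> U) a b I :
  is_linear l -> is_RInt f a b I -> is_RInt (fun t => l (f t)) a b (l I).
Proof.
  intros Hl H. unfold is_RInt in *.
  apply filterlim_ext with (fun ptd => l (scal (sign (b - a)) (Riemann_sum f ptd))).
  - intros ptd. rewrite Riemann_sum_linear by exact Hl. apply (linear_scal l Hl).
  - apply filterlim_comp with (1 := H). apply (linear_cont l I Hl).
Qed.

End LinearIntegral.

(** * Complex structures on real Banach spaces *)

(** A complex structure is kept beside the real Banach space: norm, derivative and integral remain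
    the real ones. The norm is not assumed homogeneous for complex scalars; [cs_bound] below
    supplies the constant that replaces homogeneity. *)
Record cplx (Y : CompleteNormedModule R_AbsRing) := Cplx {
  cJ_op :> Y -> Y;
  cJ_lin : is_linear cJ_op;
  cJ_sq : forall y, cJ_op (cJ_op y) = opp y }.

Arguments cJ_op {Y}. Arguments cJ_lin {Y}. Arguments cJ_sq {Y}.

Section ComplexScaling.

Variable Y : CompleteNormedModule R_AbsRing.
Variable J : cplx Y.

Definition cs (c : C) (y : Y) : Y := plus (scal (fst c) y) (scal (snd c) (J y)).

Lemma cs_plus_l (a b : C) (x : Y) : cs (Cplus a b) x = plus (cs a x) (cs b x).
Proof. unfold cs. simpl. module_R. Qed.

Lemma cs_plus_r (a : C) (x y : Y) : cs a (plus x y) = plus (cs a x) (cs a y).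
Proof. unfold cs. rewrite (linear_plus J (cJ_lin J)). module_R. Qed.

Lemma cs_mult (a b : C) (x : Y) : cs (Cmult a b) x = cs a (cs b x).
Proof.
  unfold cs. rewrite (linear_plus J (cJ_lin J)), !(linear_scal J (cJ_lin J)), (cJ_sq J). simpl.
  module_R.
Qed.

Lemma cs_one (x : Y) : cs (RtoC 1) x = x.
Proof. unfold cs. simpl. module_R. Qed.

End ComplexScaling.
Arguments cs {Y}.

Ltac module_C_coefs :=
  lazymatch goal with
  | |- context [@cs ?Y ?J _ _] =>
    lin_coefs C_Ring (CompleteNormedModule.AbelianGroup R_AbsRing Y) (@cs Y J)
      (cs_plus_l Y J) (cs_plus_r Y J) (cs_mult Y J) (cs_one Y J)
  end;
  change (@plus (Ring.AbelianMonoid C_Ring)) with Cplus; change (@mult C_Ring) with Cmult;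
  change (@opp (Ring.AbelianGroup C_Ring)) with Copp;
  change (@zero (Ring.AbelianMonoid C_Ring)) with (RtoC 0); change (@one C_Ring) with (RtoC 1);
  lazymatch goal with |- @eq _ ?a ?b => change (@eq C a b) end.
Ltac module_C := module_C_coefs; ring.

Section ComplexScalingNorm.

Variable Y : CompleteNormedModule R_AbsRing.
Variable J : cplx Y.

Lemma scal_cs r (y : Y) : scal r y = cs J (RtoC r) y.
Proof. unfold cs. simpl. module_R. Qed.

Lemma norm_zero_eq : norm (zero : Y) = 0.
Proof. exact (norm_zero (V := Y)). Qed.

Lemma norm_plus_le (x y : Y) : norm (plus x y) <= norm x + norm y.
Proof. exact (norm_triangle x y). Qed.

Lemma norm_scal_le r (y : Y) : norm (scal r y) <= Rabs r * norm y.
Proof. exact (norm_scal r y). Qed.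

Lemma norm_minus_le (x y : Y) : norm (minus x y) <= norm x + norm y.
Proof. rewrite <- (norm_opp y). exact (norm_triangle x (opp y)). Qed.

Lemma cs_bound : exists k, 0 < k /\ forall c y, norm (cs J c y) <= k * (Cmod c * norm y).
Proof.
  destruct (linear_norm J (cJ_lin J)) as [M [HM H]].
  exists (1 + M). split; [lra|]. intros c y. unfold cs.
  apply Rle_trans with (1 := norm_plus_le (scal (fst c) y) (scal (snd c) (J y))).
  assert (Hc := Rmax_Cmod c).
  assert (H1 := Rmax_l (Rabs (fst c)) (Rabs (snd c))).
  assert (H2 := Rmax_r (Rabs (fst c)) (Rabs (snd c))).
  assert (H3 := norm_scal_le (fst c) y). assert (H4 := norm_scal_le (snd c) (J y)).
  assert (H5 := norm_ge_0 y). assert (H6 := norm_ge_0 (J y)). specialize (H y).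
  assert (Rabs (fst c) * norm y <= Cmod c * norm y) by (apply Rmult_le_compat_r; lra).
  assert (Rabs (snd c) * norm (J y) <= Cmod c * (M * norm y)).
  { apply Rmult_le_compat; try lra; apply Rabs_pos. }
  apply Rle_trans with (1 := Rplus_le_compat _ _ _ _ H3 H4). lra.
Qed.

Lemma cs_linear c : is_linear (cs J c).
Proof.
  split.
  - apply cs_plus_r.
  - intros r y. transitivity (cs J c (cs J (RtoC r) y)).
    + f_equal. apply scal_cs.
    + transitivity (cs J (RtoC r) (cs J c y)); [module_C|symmetry; apply scal_cs].
  - destruct cs_bound as [k [Hk H]]. exists (k * (Cmod c + 1)).
    assert (0 <= Cmod c) by apply Cmod_ge_0.
    split; [apply Rmult_lt_0_compat; lra|].
    intros y. apply Rle_trans with (1 := H c y). rewrite Rmult_assoc.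
    apply Rmult_le_compat_l; [lra|]. apply Rmult_le_compat_r; [apply norm_ge_0|lra].
Qed.

End ComplexScalingNorm.
Arguments norm_zero_eq {Y}. Arguments norm_plus_le {Y}. Arguments norm_scal_le {Y}. Arguments norm_minus_le {Y}.
Arguments cs_bound {Y}. Arguments cs_linear {Y}. Arguments scal_cs {Y}.

Definition clinear {Y Z} (JY : cplx Y) (JZ : cplx Z) (l : Y -> Z) :=
  is_linear l /\ forall y, l (JY y) = JZ (l y).

Lemma clinear_cs {Y Z} (JY : cplx Y) (JZ : cplx Z) l :
  clinear JY JZ l -> forall c y, l (cs JY c y) = cs JZ c (l y).
Proof.
  intros [Hl HJ] c y. unfold cs.
  now rewrite (linear_plus l Hl), !(linear_scal l Hl), HJ.
Qed.

Lemma cJ_cs {Y} (J : cplx Y) y : J y = cs J Ci y.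
Proof. unfold cs; simpl; module_R. Qed.

Lemma clinear_cscal {Y} (J : cplx Y) c : clinear J J (cs J c).
Proof. split; [apply cs_linear|]. intros x. rewrite !(cJ_cs J). module_C. Qed.

(** * Piecewise C1 curves *)

Definition dcurve (g : R -> R * R) (t : R) : C :=
  (Derive (fun s => fst (g s)) t, Derive (fun s => snd (g s)) t).

(** [P] is a relation between the ends of a parameter interval, so that both integrability and an
    integral of prescribed value can be proved on one C1 piece and then chained by the Chasles
    relation. *)
Lemma piecewise_C1_ind (g : R -> R * R) (P : R -> R -> Prop) :
  piecewise_C1 g ->
  (forall a b h, 0 <= a -> a < b -> b <= 1 -> C1_curve h ->
     (forall t, a <= t <= b -> g t = h t) -> P a b) ->
  (forall a b c, P a b -> P b c -> P a c) ->
  P 0 1.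
Proof.
  intros (n & p & H0 & Hn & Hp & Hh) HP Htr.
  assert (Hmon : forall d i, (i + d <= n)%nat -> p i <= p (i + d)%nat).
  { induction d as [|d IH]; intros i Hi.
    - rewrite Nat.add_0_r. lra.
    - rewrite Nat.add_succ_r. specialize (IH i ltac:(lia)). specialize (Hp (i + d)%nat ltac:(lia)).
      lra. }
  assert (Hstep : forall i, (i < n)%nat -> P (p i) (p (S i))).
  { intros i Hi. destruct (Hh i Hi) as (h & Hh1 & Hgh).
    apply (HP _ _ h); auto.
    - rewrite <- H0. apply (Hmon i 0%nat). lia.
    - rewrite <- Hn. replace n with (S i + (n - S i))%nat by lia. apply Hmon. lia. }
  assert (Hall : forall i, (i < n)%nat -> P 0 (p (S i))).
  { induction i as [|i IH]; intros Hi.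
    - rewrite <- H0 at 1. now apply Hstep.
    - apply Htr with (p (S i)); [apply IH; lia|now apply Hstep]. }
  destruct n as [|n]; [lra|]. rewrite <- Hn. apply Hall. lia.
Qed.

(** The bounds on [t] are strict because at an end of the piece the derivative of [g] also sees the
    neighbouring piece; the integral ignores these points. *)
Lemma dcurve_ext g h a b t :
  (forall s, a <= s <= b -> g s = h s) -> a < t < b -> dcurve g t = dcurve h t.
Proof.
  intros H Ht. unfold dcurve.
  assert (Hl : locally t (fun s => g s = h s)).
  { apply (locally_interval _ t a b); try (simpl; lra). intros y Hy1 Hy2.
    simpl in *. apply H; lra. }
  f_equal; apply Derive_ext_loc; revert Hl; apply filter_imp; intros s ->; reflexivity.
Qed.

(** * Complex-valued paths *)

(** Scalar functions are differentiated only along real paths, coordinate by coordinate. This is all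
    that the fundamental theorem of calculus along a curve asks for. *)
Definition path_derive (f : R -> C) (t : R) (d : C) :=
  is_derive (fun s => fst (f s)) t (fst d) /\ is_derive (fun s => snd (f s)) t (snd d).

Lemma path_derive_const c t : path_derive (fun _ => c) t (RtoC 0).
Proof. split; apply (is_derive_const (K := R_AbsRing) (V := R_NormedModule)). Qed.

Lemma path_derive_plus f g t df dg :
  path_derive f t df -> path_derive g t dg -> path_derive (fun s => Cplus (f s) (g s)) t (Cplus df dg).
Proof.
  intros [Hf1 Hf2] [Hg1 Hg2]. split; simpl.
  - apply (is_derive_plus (fun s => fst (f s)) (fun s => fst (g s))); auto.
  - apply (is_derive_plus (fun s => snd (f s)) (fun s => snd (g s))); auto.
Qed.

Lemma is_derive_eq (f : R -> R) t d d' : is_derive f t d -> d = d' -> is_derive f t d'.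
Proof. now intros H <-. Qed.

Lemma is_derive_mulR (f g : R -> R) t df dg :
  is_derive f t df -> is_derive g t dg -> is_derive (fun s => f s * g s) t (df * g t + f t * dg).
Proof. intros Hf Hg. apply (is_derive_mult f g); auto. intros; apply Rmult_comm. Qed.

Lemma is_derive_addR (f g : R -> R) t df dg :
  is_derive f t df -> is_derive g t dg -> is_derive (fun s => f s + g s) t (df + dg).
Proof. intros Hf Hg. apply (is_derive_plus f g); auto. Qed.

Lemma is_derive_subR (f g : R -> R) t df dg :
  is_derive f t df -> is_derive g t dg -> is_derive (fun s => f s - g s) t (df - dg).
Proof. intros Hf Hg. apply (is_derive_minus f g); auto. Qed.

Lemma path_derive_mult f g t df dg :
  path_derive f t df -> path_derive g t dg ->
  path_derive (fun s => Cmult (f s) (g s)) t (Cplus (Cmult df (g t)) (Cmult (f t) dg)).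
Proof.
  intros [Hf1 Hf2] [Hg1 Hg2]. split; simpl.
  - eapply is_derive_eq; [apply is_derive_subR; apply is_derive_mulR; eassumption|]. simpl. ring.
  - eapply is_derive_eq; [apply is_derive_addR; apply is_derive_mulR; eassumption|]. simpl. ring.
Qed.

Lemma C_sqr_norm_neq0 (z : C) : z <> RtoC 0 -> fst z ^ 2 + snd z ^ 2 <> 0.
Proof.
  intros H H0. apply H. destruct z as [x y]; simpl in *.
  assert (x = 0) by nra. assert (y = 0) by nra. subst. reflexivity.
Qed.

Lemma path_derive_inv f t df :
  path_derive f t df -> f t <> RtoC 0 ->
  path_derive (fun s => Cinv (f s)) t (Copp (Cmult df (Cmult (Cinv (f t)) (Cinv (f t))))).
Proof.
  intros [Hf1 Hf2] Hn. apply C_sqr_norm_neq0 in Hn.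
  destruct df as [d1 d2]; simpl in Hf1, Hf2.
  (* The two coordinates become opaque real functions, so that the derivative of the explicit
     quotient can be computed mechanically. *)
  remember (fun s => fst (f s)) as f1 eqn:E1. remember (fun s => snd (f s)) as f2 eqn:E2.
  assert (F1 : forall s, fst (f s) = f1 s) by (intros; now rewrite E1).
  assert (F2 : forall s, snd (f s) = f2 s) by (intros; now rewrite E2).
  rewrite F1, F2 in Hn.
  split; simpl.
  - apply is_derive_ext with (fun s => f1 s / (f1 s ^ 2 + f2 s ^ 2)).
    { intros s. now rewrite F1, F2. }
    auto_derive; [repeat split; try (eexists; eassumption); simpl in Hn; lra|].
    rewrite (is_derive_unique (fun s : R => f1 s) _ _ Hf1), (is_derive_unique (fun s : R => f2 s) _ _ Hf2), F1, F2.
    field. simpl in Hn; lra.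
  - apply is_derive_ext with (fun s => - f2 s / (f1 s ^ 2 + f2 s ^ 2)).
    { intros s. now rewrite F1, F2. }
    auto_derive; [repeat split; try (eexists; eassumption); simpl in Hn; lra|].
    rewrite (is_derive_unique (fun s : R => f1 s) _ _ Hf1), (is_derive_unique (fun s : R => f2 s) _ _ Hf2), F1, F2.
    field. simpl in Hn; lra.
Qed.

Lemma path_derive_eq f t d d' : path_derive f t d -> d = d' -> path_derive f t d'.
Proof. now intros H <-. Qed.

Lemma path_derive_pow f t df n :
  path_derive f t df ->
  path_derive (fun s => Cpow (f s) (S n)) t (Cmult df (Cmult (RtoC (INR (S n))) (Cpow (f t) n))).
Proof.
  intros H. induction n as [|n IH].
  - apply path_derive_eq with (Cplus (Cmult df (Cpow (f t) 0)) (Cmult (f t) (RtoC 0))).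
    + apply (path_derive_mult f (fun _ => RtoC 1)); [exact H|apply path_derive_const].
    + simpl. ring.
  - apply (path_derive_eq _ _ _ _ (path_derive_mult f _ t _ _ H IH)).
    rewrite (S_INR (S n)), RtoC_plus. simpl Cpow. ring.
Qed.

(** * Integrals of scalar functions along closed curves *)

Section ScalarIntegrals.

Variable S : C -> Prop.
Variable c : C -> C.
Hypothesis c_diff : forall f t d, path_derive f t d -> S (f t) -> exists d', path_derive (fun s => c (f s)) t d'.

Lemma C1_curve_path_derive h t : C1_curve h -> path_derive h t (dcurve h t).
Proof. intros [H _]. destruct (H t). split; apply Derive_correct; assumption. Qed.

Lemma re_form_continuous h t :
  C1_curve h -> S (h t) -> continuous (fun s => fst (Cmult (dcurve h s) (c (h s)))) t.
Proof.
  intros Hh Ht. destruct (c_diff _ _ _ (C1_curve_path_derive h t Hh) Ht) as [d' [H1 H2]].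
  destruct Hh as [_ Hh]. destruct (Hh t) as [H3 H4]. simpl.
  apply (continuous_minus (V := R_NormedModule)
    (fun s => Derive (fun s0 => fst (h s0)) s * fst (c (h s)))
    (fun s => Derive (fun s0 => snd (h s0)) s * snd (c (h s)))).
  - apply (continuous_mult (K := R_AbsRing)); [exact H3|].
    apply (ex_derive_continuous (V := R_NormedModule) (fun s => fst (c (h s)))). eexists; exact H1.
  - apply (continuous_mult (K := R_AbsRing)); [exact H4|].
    apply (ex_derive_continuous (V := R_NormedModule) (fun s => snd (c (h s)))). eexists; exact H2.
Qed.

Lemma ex_RInt_re_form g :
  piecewise_C1 g -> (forall t, 0 <= t <= 1 -> S (g t)) ->
  ex_RInt (fun t => fst (Cmult (dcurve g t) (c (g t)))) 0 1.
Proof.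
  intros Hg HS. apply (piecewise_C1_ind g); [exact Hg| |].
  - intros a b h Ha Hab Hb Hh Hgh.
    apply ex_RInt_ext with (fun t => fst (Cmult (dcurve h t) (c (h t)))).
    + intros t. rewrite Rmin_left, Rmax_right by lra. intros Ht.
      rewrite (dcurve_ext g h a b t Hgh Ht), Hgh by lra. reflexivity.
    + apply (ex_RInt_continuous (V := R_CompleteNormedModule)). intros t.
      rewrite Rmin_left, Rmax_right by lra. intros Ht.
      apply re_form_continuous; [exact Hh|]. rewrite <- Hgh by lra. apply HS. lra.
  - intros x y z. apply ex_RInt_Chasles.
Qed.

(** On each piece the integral is an increment of the potential, and the increments telescope to f
    (g 1) - f (g 0). Only the real part is treated, with a real potential, because ln|z - a| is a
    global potential for the real part of dz/(z - a), whereas its imaginary part has none. *)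
Lemma closed_exact_re f g :
  (forall p t d, path_derive p t d -> S (p t) ->
     is_derive (fun s => f (p s)) t (fst (Cmult d (c (p t))))) ->
  piecewise_C1 g -> g 0 = g 1 -> (forall t, 0 <= t <= 1 -> S (g t)) ->
  is_RInt (fun t => fst (Cmult (dcurve g t) (c (g t)))) 0 1 (0 : R).
Proof.
  intros Hf Hg H01 HS.
  replace 0 with (f (g 1) - f (g 0)) at 2 by (rewrite H01; ring).
  apply (piecewise_C1_ind g (fun a b => is_RInt (fun t => fst (Cmult (dcurve g t) (c (g t)))) a b
    (f (g b) - f (g a)))); [exact Hg| |].
  - intros a b h Ha Hab Hb Hh Hgh.
    apply is_RInt_ext with (fun t => fst (Cmult (dcurve h t) (c (h t)))).
    + intros t. rewrite Rmin_left, Rmax_right by lra. intros Ht.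
      rewrite (dcurve_ext g h a b t Hgh Ht), Hgh by lra. reflexivity.
    + rewrite !Hgh by lra.
      apply (is_RInt_derive (V := R_CompleteNormedModule) (fun s => f (h s))).
      * intros t. rewrite Rmin_left, Rmax_right by lra. intros Ht.
        apply Hf; [now apply C1_curve_path_derive|]. rewrite <- Hgh by lra. apply HS. lra.
      * intros t. rewrite Rmin_left, Rmax_right by lra. intros Ht.
        apply re_form_continuous; [exact Hh|]. rewrite <- Hgh by lra. apply HS. lra.
  - intros x y z H1 H2. replace (f (g z) - f (g x)) with (f (g y) - f (g x) + (f (g z) - f (g y))) by ring.
    apply (is_RInt_Chasles (V := R_NormedModule)) with y; assumption.
Qed.

End ScalarIntegrals.

Definition is_scalar_int (g : R -> R * R) (c : C -> C) (v : C) :=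
  is_RInt (fun t => fst (Cmult (dcurve g t) (c (g t)))) 0 1 (fst v) /\
  is_RInt (fun t => snd (Cmult (dcurve g t) (c (g t)))) 0 1 (snd v).

Lemma snd_as_fst (w z : C) : snd (Cmult w z) = fst (Cmult w (Cmult (0, -1) z)).
Proof. destruct w, z; simpl; ring. Qed.

Lemma closed_exact (S : C -> Prop) (c P : C -> C) g :
  (forall f t d, path_derive f t d -> S (f t) -> exists d', path_derive (fun s => c (f s)) t d') ->
  (forall f t d, path_derive f t d -> S (f t) -> path_derive (fun s => P (f s)) t (Cmult d (c (f t)))) ->
  piecewise_C1 g -> g 0 = g 1 -> (forall t, 0 <= t <= 1 -> S (g t)) ->
  is_scalar_int g c (RtoC 0).
Proof.
  intros Hc HP Hg H01 HS. split.
  - apply (closed_exact_re S c Hc (fun z => fst (P z))); auto.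
    intros p t d Hp Hs. apply (HP p t d Hp Hs).
  - apply is_RInt_ext with (fun t => fst (Cmult (dcurve g t) (Cmult (0, -1) (c (g t))))).
    { intros t _. symmetry. apply snd_as_fst. }
    apply (closed_exact_re S (fun z => Cmult (0, -1) (c z))) with (f := fun z => snd (P z)); auto.
    + intros f t d Hf Hs. destruct (Hc f t d Hf Hs) as [d' Hd'].
      eexists. apply path_derive_mult; [apply path_derive_const|exact Hd'].
    + intros p t d Hp Hs. rewrite <- snd_as_fst. apply (HP p t d Hp Hs).
Qed.

Lemma scalar_int_pow g n : piecewise_C1 g -> g 0 = g 1 -> is_scalar_int g (fun z => Cpow z n) (RtoC 0).
Proof.
  intros Hg H01.
  apply (closed_exact (fun _ => True) _ (fun z => Cmult (RtoC (/ INR (S n))) (Cpow z (S n)))); auto.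
  - intros f t d Hf _. destruct n as [|n].
    + exists (RtoC 0). exact (path_derive_const (RtoC 1) t).
    + eexists. exact (path_derive_pow f t d n Hf).
  - intros f t d Hf _.
    apply (path_derive_eq _ _ _ _ (path_derive_mult _ _ t _ _ (path_derive_const (RtoC (/ INR (S n))) t) (path_derive_pow f t d n Hf))).
    assert (INR (S n) <> 0) by (apply not_0_INR; lia).
    rewrite RtoC_inv by assumption. field.
    intros E. apply H. now apply RtoC_inj.
Qed.

Lemma path_derive_shift f t d a : path_derive f t d -> path_derive (fun s => Cminus (f s) a) t d.
Proof.
  intros H. apply (path_derive_eq _ _ _ _ (path_derive_plus f (fun _ => Copp a) t _ _ H (path_derive_const _ t))). ring.
Qed.

Lemma Cminus_neq0 (z a : C) : z <> a -> Cminus z a <> RtoC 0.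
Proof. intros H E. apply H. replace z with (Cplus (Cminus z a) a) by ring. rewrite E. ring. Qed.

Lemma scalar_int_inv_sqr g a :
  piecewise_C1 g -> g 0 = g 1 -> (forall t, 0 <= t <= 1 -> g t <> a) ->
  is_scalar_int g (fun z => Cmult (Cinv (Cminus z a)) (Cinv (Cminus z a))) (RtoC 0).
Proof.
  intros Hg H01 Ha.
  apply (closed_exact (fun z => z <> a) _ (fun z => Copp (Cinv (Cminus z a)))); auto.
  - intros f t d Hf Hz. eexists.
    apply path_derive_mult; apply path_derive_inv; try (apply path_derive_shift; exact Hf); now apply Cminus_neq0.
  - intros f t d Hf Hz.
    assert (H := path_derive_inv _ t _ (path_derive_shift f t d a Hf) (Cminus_neq0 _ _ Hz)).
    destruct H as [H1 H2]. split; simpl.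
    + assert (K := is_derive_opp (V := R_NormedModule) _ _ _ H1). revert K. 
      match goal with |- is_derive _ _ ?u -> is_derive _ _ ?v => assert (u = v) as -> end; [|trivial].
      unfold opp; simpl. ring.
    + assert (K := is_derive_opp (V := R_NormedModule) _ _ _ H2). revert K. 
      match goal with |- is_derive _ _ ?u -> is_derive _ _ ?v => assert (u = v) as -> end; [|trivial].
      unfold opp; simpl. ring.
Qed.

(** The real part of dz/(z - a) is d ln|z - a|, which is exact; the imaginary part is, by
    definition, the integrand of [winding]. *)
Lemma scalar_int_inv g a :
  piecewise_C1 g -> g 0 = g 1 -> (forall t, 0 <= t <= 1 -> g t <> a) ->
  is_scalar_int g (fun z => Cinv (Cminus z a)) (0, 2 * PI * winding g a).
Proof.
  intros Hg H01 Ha.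
  assert (Hd : forall f t d, path_derive f t d -> f t <> a ->
    exists d', path_derive (fun s => Cinv (Cminus (f s) a)) t d').
  { intros f t d Hf Hz. eexists.
    exact (path_derive_inv _ t _ (path_derive_shift f t d a Hf) (Cminus_neq0 _ _ Hz)). }
  split.
  - apply (closed_exact_re (fun z => z <> a) (fun z => Cinv (Cminus z a)) Hd
      (fun z => / 2 * ln ((fst z - fst a) ^ 2 + (snd z - snd a) ^ 2))); auto.
    intros p t d [H1 H2] Hz.
    assert (Hn := C_sqr_norm_neq0 _ (Cminus_neq0 _ _ Hz)).
    change ((fst (p t) - fst a) ^ 2 + (snd (p t) - snd a) ^ 2 <> 0) in Hn.
    assert (0 < (fst (p t) - fst a) ^ 2 + (snd (p t) - snd a) ^ 2).
    { assert (H3 := pow2_ge_0 (fst (p t) - fst a)). assert (H4 := pow2_ge_0 (snd (p t) - snd a)).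
      lra. }
    remember (fun s => fst (p s)) as f1 eqn:E1. remember (fun s => snd (p s)) as f2 eqn:E2.
    assert (F1 : forall s, fst (p s) = f1 s) by (intros; now rewrite E1).
    assert (F2 : forall s, snd (p s) = f2 s) by (intros; now rewrite E2).
    assert (H1' : is_derive f1 t (fst d)) by (rewrite E1; exact H1).
    assert (H2' : is_derive f2 t (snd d)) by (rewrite E2; exact H2).
    rewrite F1, F2 in H. simpl. rewrite F1, F2.
    apply is_derive_ext with (fun s => / 2 * ln ((f1 s - fst a) ^ 2 + (f2 s - snd a) ^ 2)).
    { intros s. now rewrite F1, F2. }
    auto_derive; [repeat split; try (eexists; eassumption); simpl in H; lra|].
    rewrite (is_derive_unique (fun s : R => f1 s) _ _ H1'), (is_derive_unique (fun s : R => f2 s) _ _ H2'). field.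
    simpl in H; lra.
  - assert (Hex : ex_RInt (fun t => snd (Cmult (dcurve g t) (Cinv (Cminus (g t) a)))) 0 1).
    { apply ex_RInt_ext with
        (fun t => fst (Cmult (dcurve g t) (Cmult (0, -1) (Cinv (Cminus (g t) a))))).
      { intros t _. symmetry. apply snd_as_fst. }
      apply (ex_RInt_re_form (fun z => z <> a) (fun z => Cmult (0, -1) (Cinv (Cminus z a)))); auto.
      intros f t d Hf Hz. destruct (Hd f t d Hf Hz) as [d' Hd'].
      eexists. apply path_derive_mult; [apply path_derive_const|exact Hd']. }
    apply (RInt_correct (V := R_CompleteNormedModule)) in Hex.
    match goal with |- is_RInt _ _ _ ?v => replace v with
      (RInt (fun t => snd (Cmult (dcurve g t) (Cinv (Cminus (g t) a)))) 0 1) end; [exact Hex|].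
    unfold winding. simpl. rewrite <- Rmult_assoc, Rinv_r, Rmult_1_l by (assert (H := PI_RGT_0); lra).
    apply RInt_ext. intros t. rewrite Rmin_left, Rmax_right by lra. intros Ht.
    assert (Hn := C_sqr_norm_neq0 _ (Cminus_neq0 _ _ (Ha t ltac:(lra)))). simpl in Hn.
    unfold dcurve. simpl. field. simpl in *. lra.
Qed.

(** * Vector-valued contour integrals *)

Lemma Cmod_le_abs (z : C) : Cmod z <= Rabs (fst z) + Rabs (snd z).
Proof.
  destruct z as [x y]; simpl.
  assert (H := Cmod_triangle (RtoC x) (Cmult Ci (RtoC y))).
  rewrite Cmod_mult, Cmod_Ci, !Cmod_R, Rmult_1_l in H.
  replace (Cplus (RtoC x) (Cmult Ci (RtoC y))) with (x, y) in H; [exact H|].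
  unfold Cplus, Cmult; simpl; f_equal; ring.
Qed.

(** The retraction of the line onto [a, b]. Composing a C1 piece with it turns continuity relative
    to the curve into continuity on the whole line, ends included. *)
Definition clamp (a b t : R) := Rmax a (Rmin b t).

Lemma clamp_in a b t : a <= b -> a <= clamp a b t <= b.
Proof.
  intros H. unfold clamp. split; [apply Rmax_l|]. apply Rmax_lub; [exact H|apply Rmin_l].
Qed.

Lemma clamp_id a b t : a <= t <= b -> clamp a b t = t.
Proof. intros H. unfold clamp. rewrite Rmin_right by lra. apply Rmax_right. lra. Qed.

Lemma clamp_lip a b s t : Rabs (clamp a b s - clamp a b t) <= Rabs (s - t).
Proof.
  unfold clamp, Rmax, Rmin. repeat destruct Rle_dec; split_Rabs; lra.
Qed.

Section VectorIntegrals.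

Variable Y : CompleteNormedModule R_AbsRing.
Variable J : cplx Y.

Definition is_curve_int (g : R -> R * R) (F : C -> Y) (v : Y) :=
  is_RInt (fun t => cs J (dcurve g t) (F (g t))) 0 1 v.

(** A relation instead of a value, so that integrability along every curve is part of each
    statement. *)
Fixpoint is_cycle_int (G : list (R -> R * R)) (F : C -> Y) (v : Y) : Prop :=
  match G with
  | nil => v = zero
  | g :: G' => exists a b, is_curve_int g F a /\ is_cycle_int G' F b /\ v = plus a b
  end.

Definition on_curves (G : list (R -> R * R)) (z : C) :=
  exists g, In g G /\ exists t, 0 <= t <= 1 /\ g t = z.

(** Continuity relative to [K]: the resolvent is controlled only outside U, and the curves
    themselves have no interior in the plane. *)
Definition cont_on (K : C -> Prop) (F : C -> Y) :=
  forall z, K z -> forall e, 0 < e -> exists d, 0 < d /\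
    forall w, K w -> Cmod (Cminus w z) < d -> norm (minus (F w) (F z)) < e.

Definition scont_on (K : C -> Prop) (c : C -> C) :=
  forall z, K z -> forall e, 0 < e -> exists d, 0 < d /\
    forall w, K w -> Cmod (Cminus w z) < d -> Cmod (Cminus (c w) (c z)) < e.

Lemma is_cycle_int_unique G F v w : is_cycle_int G F v -> is_cycle_int G F w -> v = w.
Proof.
  revert v w; induction G as [|g G IH]; simpl; intros v w; [now intros -> ->|].
  intros (a & b & Ha & Hb & ->) (a' & b' & Ha' & Hb' & ->).
  rewrite <- (is_RInt_unique _ _ _ _ Ha), <- (is_RInt_unique _ _ _ _ Ha').
  f_equal. now apply IH.
Qed.

Lemma is_cycle_int_ext G F F' v :
  (forall z, on_curves G z -> F z = F' z) -> is_cycle_int G F v -> is_cycle_int G F' v.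
Proof.
  revert v; induction G as [|g G IH]; simpl; intros v H; [trivial|].
  intros (a & b & Ha & Hb & ->). exists a, b. repeat split.
  - unfold is_curve_int. revert Ha. apply is_RInt_ext. intros t.
    rewrite Rmin_left, Rmax_right by lra. intros Ht. f_equal. apply H.
    exists g. split; [now left|]. exists t. split; [lra|reflexivity].
  - apply IH; [|exact Hb]. intros z (g' & Hg' & Hz). apply H. exists g'. split; [now right|exact Hz].
Qed.

Lemma is_cycle_int_plus G F F' v v' :
  is_cycle_int G F v -> is_cycle_int G F' v' -> is_cycle_int G (fun z => plus (F z) (F' z)) (plus v v').
Proof.
  revert v v'; induction G as [|g G IH]; simpl; intros v v'.
  - intros -> ->. apply plus_zero_r.
  - intros (a & b & Ha & Hb & ->) (a' & b' & Ha' & Hb' & ->).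
    exists (plus a a'), (plus b b'). repeat split.
    + unfold is_curve_int.
      apply is_RInt_ext with
        (fun t => plus (cs J (dcurve g t) (F (g t))) (cs J (dcurve g t) (F' (g t)))).
      { intros t _. symmetry. apply cs_plus_r. }
      exact (is_RInt_plus _ _ _ _ _ _ Ha Ha').
    + now apply IH.
    + exact (plus_swap4 (CompleteNormedModule.AbelianGroup _ Y) a b a' b').
Qed.

Lemma cont_on_comp K F (p : R -> C) t :
  cont_on K F -> (forall s, K (p s)) ->
  continuous (fun s => fst (p s)) t -> continuous (fun s => snd (p s)) t ->
  continuous (fun s => F (p s)) t.
Proof.
  intros HF HK H1 H2. apply filterlim_locally. intros eps.
  destruct (HF _ (HK t) eps (cond_pos eps)) as (d & Hd & H).
  assert (Hd2 : 0 < d / 2) by lra.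
  assert (L1 := proj1 (filterlim_locally _ _) H1 (mkposreal _ Hd2)).
  assert (L2 := proj1 (filterlim_locally _ _) H2 (mkposreal _ Hd2)).
  generalize (filter_and _ _ L1 L2). apply filter_imp. intros s [B1 B2].
  apply (norm_compat1 (V := Y)). apply H; [apply HK|].
  apply Rle_lt_trans with (1 := Cmod_le_abs _).
  change (Rabs (fst (p s) - fst (p t)) < d / 2) in B1.
  change (Rabs (snd (p s) - snd (p t)) < d / 2) in B2.
  change (Rabs (fst (p s) - fst (p t)) + Rabs (snd (p s) - snd (p t)) < d). lra.
Qed.

Lemma cont_on_continuous K F (h : R -> R * R) a b t :
  cont_on K F -> a <= b -> C1_curve h -> (forall s, a <= s <= b -> K (h s)) ->
  continuous (fun s => F (h (clamp a b s))) t.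
Proof.
  intros HF Hab [Hh _] HK.
  assert (Hc : continuous (clamp a b) t).
  { apply filterlim_locally. intros eps. exists eps. intros s Hs.
    apply Rle_lt_trans with (1 := clamp_lip a b s t). exact Hs. }
  destruct (Hh (clamp a b t)) as [H1 H2].
  apply (cont_on_comp K F (fun s => h (clamp a b s))); [exact HF| | |].
  - intros s. apply HK, clamp_in, Hab.
  - apply (continuous_comp (clamp a b) (fun s => fst (h s))); [exact Hc|].
    now apply (ex_derive_continuous (V := R_NormedModule) (fun s => fst (h s))).
  - apply (continuous_comp (clamp a b) (fun s => snd (h s))); [exact Hc|].
    now apply (ex_derive_continuous (V := R_NormedModule) (fun s => snd (h s))).
Qed.

Lemma continuous_cs (c : R -> C) (f : R -> Y) t :
  continuous (fun s => fst (c s)) t -> continuous (fun s => snd (c s)) t -> continuous f t ->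
  continuous (fun s => cs J (c s) (f s)) t.
Proof.
  intros H1 H2 Hf. unfold cs.
  apply (continuous_plus (V := Y) (fun s => scal (fst (c s)) (f s))
    (fun s => scal (snd (c s)) (J (f s)))).
  - exact (continuous_scal (fun s => fst (c s)) f t H1 Hf).
  - apply (continuous_scal (fun s => snd (c s)) (fun s => J (f s)) t H2).
    apply continuous_comp; [exact Hf|]. apply (linear_cont (J : Y -> Y)). apply cJ_lin.
Qed.

(** The integral of the norm is recorded as well; in the estimates it plays the part of length times
    maximum. *)
Lemma ex_curve_int K F g :
  cont_on K F -> piecewise_C1 g -> (forall t, 0 <= t <= 1 -> K (g t)) ->
  ex_RInt (fun t => cs J (dcurve g t) (F (g t))) 0 1 /\
  ex_RInt (fun t => norm (cs J (dcurve g t) (F (g t)))) 0 1.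
Proof.
  intros HF Hg HK. apply (piecewise_C1_ind g); [exact Hg| |].
  - intros a b h Ha Hab Hb Hh Hgh.
    assert (E : forall t, a < t < b ->
      cs J (dcurve h t) (F (h (clamp a b t))) = cs J (dcurve g t) (F (g t))).
    { intros t Ht. rewrite (dcurve_ext g h a b t Hgh Ht), clamp_id, Hgh by lra. reflexivity. }
    assert (Hc : forall t, continuous (fun t => cs J (dcurve h t) (F (h (clamp a b t)))) t).
    { intros t. apply continuous_cs.
      - exact (proj1 (proj2 Hh t)).
      - exact (proj2 (proj2 Hh t)).
      - apply (cont_on_continuous K); [exact HF|lra|exact Hh|].
        intros s Hs. rewrite <- Hgh by exact Hs. apply HK. lra. }
    split.
    + apply ex_RInt_ext with (fun t => cs J (dcurve h t) (F (h (clamp a b t)))).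
      { intros t. rewrite Rmin_left, Rmax_right by lra. apply E. }
      apply (ex_RInt_continuous (V := Y)). intros; apply Hc.
    + apply ex_RInt_ext with (fun t => norm (cs J (dcurve h t) (F (h (clamp a b t))))).
      { intros t. rewrite Rmin_left, Rmax_right by lra. intros Ht. now rewrite E. }
      apply (ex_RInt_continuous (V := R_CompleteNormedModule)). intros z _.
      apply (continuous_comp _ (norm (V := Y))); [apply Hc|]. apply filterlim_norm.
  - intros x y z [H1 H2] [H3 H4]. split; eapply ex_RInt_Chasles; eassumption.
Qed.

Lemma ex_cycle_int K F G :
  cont_on K F -> (forall g, In g G -> piecewise_C1 g) -> (forall z, on_curves G z -> K z) ->
  exists v, is_cycle_int G F v.
Proof.
  intros HF; induction G as [|g G IH]; intros HG HK; simpl; [now exists zero|].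
  destruct IH as [b Hb].
  { intros; apply HG; now right. }
  { intros z (g' & Hg' & Hz). apply HK. exists g'. split; [now right|exact Hz]. }
  destruct (ex_curve_int K F g HF) as [[a Ha] _].
  { apply HG; now left. }
  { intros t Ht. apply HK. exists g. split; [now left|]. now exists t. }
  exists (plus a b), a, b. auto.
Qed.

(** [M] is fixed before the weight [c], so a single constant serves the Cauchy kernels of all nearby
    points z and w. *)
Lemma cycle_int_bound K F G :
  cont_on K F -> (forall g, In g G -> piecewise_C1 g) -> (forall z, on_curves G z -> K z) ->
  exists M, 0 <= M /\ forall c B v, (forall z, on_curves G z -> Cmod (c z) <= B) -> 0 <= B ->
    is_cycle_int G (fun z => cs J (c z) (F z)) v -> norm v <= M * B.
Proof.
  intros HF. destruct (cs_bound J) as (k & Hk & Hcs).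
  induction G as [|g G IH]; intros HG HK; simpl.
  { exists 0. split; [lra|]. intros c B v _ _ ->. rewrite norm_zero_eq. lra. }
  destruct IH as (M & HM & IH).
  { intros; apply HG; now right. }
  { intros z (g' & Hg' & Hz). apply HK. exists g'. split; [now right|exact Hz]. }
  destruct (ex_curve_int K F g HF) as [_ [N HN]].
  { apply HG; now left. }
  { intros t Ht. apply HK. exists g. split; [now left|]. now exists t. }
  assert (HN0 : 0 <= N).
  { apply (is_RInt_ge_0 (fun t => norm (cs J (dcurve g t) (F (g t)))) 0 1 N);
      [lra|exact HN|]. intros; apply norm_ge_0. }
  exists (k * N + M). split; [nra|].
  intros c B v Hc HB (a & b & Ha & Hb & ->).
  assert (norm b <= M * B).
  { apply (IH c); auto. intros z (g' & Hg' & Hz). apply Hc. exists g'. split; [now right|exact Hz]. }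
  assert (norm a <= k * B * N).
  { apply (norm_RInt_le (V := Y) (fun t => cs J (dcurve g t) (cs J (c (g t)) (F (g t))))
      (fun t => k * B * norm (cs J (dcurve g t) (F (g t)))) 0 1); [lra| |exact Ha|].
    - intros t Ht.
      replace (cs J (dcurve g t) (cs J (c (g t)) (F (g t)))) with
        (cs J (c (g t)) (cs J (dcurve g t) (F (g t)))) by module_C.
      apply Rle_trans with (1 := Hcs _ _). rewrite Rmult_assoc. apply Rmult_le_compat_l; [lra|].
      apply Rmult_le_compat_r; [apply norm_ge_0|]. apply Hc.
      exists g. split; [now left|]. now exists t.
    - exact (is_RInt_scal (V := R_NormedModule) _ 0 1 (k * B) N HN). }
  apply Rle_trans with (1 := norm_plus_le a b). lra.
Qed.

Lemma is_curve_int_scalar g c v y : is_scalar_int g c v -> is_curve_int g (fun z => cs J (c z) y) (cs J v y).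
Proof.
  intros [H1 H2]. unfold is_curve_int.
  apply is_RInt_ext with (fun t => plus (scal (fst (Cmult (dcurve g t) (c (g t)))) y)
    (scal (snd (Cmult (dcurve g t) (c (g t)))) (J y))).
  { intros t _. change (cs J (Cmult (dcurve g t) (c (g t))) y =
      cs J (dcurve g t) (cs J (c (g t)) y)). apply cs_mult. }
  apply (is_RInt_plus (V := Y)).
  - apply (is_RInt_linear R_NormedModule Y (fun r => scal r y)); [|exact H1].
    apply (is_linear_scal_l (V := Y)).
  - apply (is_RInt_linear R_NormedModule Y (fun r => scal r (J y))); [|exact H2].
    apply (is_linear_scal_l (V := Y)).
Qed.

Lemma is_cycle_int_scalar_zero G c y :
  (forall g, In g G -> is_scalar_int g c (RtoC 0)) -> is_cycle_int G (fun z => cs J (c z) y) zero.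
Proof.
  induction G as [|g G IH]; intros H; simpl; [reflexivity|].
  exists (cs J (RtoC 0) y), zero. repeat split.
  - apply is_curve_int_scalar. apply H. now left.
  - apply IH. intros; apply H; now right.
  - module_C.
Qed.

Lemma is_cycle_int_winding G a y :
  (forall g, In g G -> piecewise_C1 g /\ g 0 = g 1) -> ~ on_curves G a ->
  is_cycle_int G (fun z => cs J (Cinv (Cminus z a)) y) (cs J (0, 2 * PI * total_winding G a) y).
Proof.
  induction G as [|g G IH]; intros H Ha; simpl.
  - rewrite Rmult_0_r. change (0, 0) with (RtoC 0). module_C.
  - exists (cs J (0, 2 * PI * winding g a) y), (cs J (0, 2 * PI * total_winding G a) y).
    repeat split.
    + apply is_curve_int_scalar. destruct (H g (or_introl eq_refl)) as [H1 H2].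
      apply scalar_int_inv; [exact H1|exact H2|]. intros t Ht E. apply Ha.
      exists g. split; [now left|]. now exists t.
    + apply IH; [intros; apply H; now right|]. intros (g' & Hg' & Hz). apply Ha.
      exists g'. split; [now right|exact Hz].
    + rewrite <- cs_plus_l. f_equal. unfold Cplus; simpl. f_equal; ring.
Qed.

Lemma cont_on_cs K c F : scont_on K c -> cont_on K F -> cont_on K (fun z => cs J (c z) (F z)).
Proof.
  intros Hc HF z Hz e He. destruct (cs_bound J) as (k & Hk & Hcs).
  set (N := norm (F z)). assert (HN : 0 <= N) by apply norm_ge_0.
  assert (HM := Cmod_ge_0 (c z)).
  (* The difference splits as c(w)(F(w) - F(z)) + (c(w) - c(z))F(z), each term getting e/2.
     Tolerance 1 for [c] gives |c(w)| <= |c(z)| + 1, and N + 1 keeps the denominator positive. *)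
  assert (He1 : 0 < e / (2 * k * (N + 1))).
  { apply Rdiv_lt_0_compat; [lra|]. apply Rmult_lt_0_compat; lra. }
  assert (He2 : 0 < e / (2 * k * (Cmod (c z) + 1))).
  { apply Rdiv_lt_0_compat; [lra|]. apply Rmult_lt_0_compat; lra. }
  destruct (Hc z Hz _ He1) as (d1 & Hd1 & H1).
  destruct (Hc z Hz 1 Rlt_0_1) as (d2 & Hd2 & H2).
  destruct (HF z Hz _ He2) as (d3 & Hd3 & H3).
  exists (Rmin d1 (Rmin d2 d3)). split; [repeat apply Rmin_case; assumption|].
  intros w Hw Hd.
  assert (L1 := Rmin_l d1 (Rmin d2 d3)). assert (L2 := Rmin_r d1 (Rmin d2 d3)).
  assert (L3 := Rmin_l d2 d3). assert (L4 := Rmin_r d2 d3).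
  specialize (H1 w Hw ltac:(lra)). specialize (H2 w Hw ltac:(lra)). specialize (H3 w Hw ltac:(lra)).
  replace (minus (cs J (c w) (F w)) (cs J (c z) (F z))) with
    (plus (cs J (c w) (minus (F w) (F z))) (cs J (Cminus (c w) (c z)) (F z))) by module_C.
  assert (Hcw : Cmod (c w) <= Cmod (c z) + 1).
  { replace (c w) with (Cplus (c z) (Cminus (c w) (c z))) by ring.
    apply Rle_trans with (1 := Cmod_triangle _ _). lra. }
  apply Rle_lt_trans with (1 := norm_plus_le _ _).
  assert (B1 := Hcs (c w) (minus (F w) (F z))).
  assert (B2 := Hcs (Cminus (c w) (c z)) (F z)).
  assert (Q1 : Cmod (c w) * norm (minus (F w) (F z)) <=
    (Cmod (c z) + 1) * norm (minus (F w) (F z))).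
  { apply Rmult_le_compat_r; [apply norm_ge_0|exact Hcw]. }
  assert (Q2 : k * ((Cmod (c z) + 1) * norm (minus (F w) (F z))) < e / 2).
  { replace (e / 2) with (k * ((Cmod (c z) + 1) * (e / (2 * k * (Cmod (c z) + 1))))) by (field; lra).
    apply Rmult_lt_compat_l; [lra|]. apply Rmult_lt_compat_l; [lra|exact H3]. }
  assert (Q3 : k * (Cmod (Cminus (c w) (c z)) * N) < e / 2).
  { apply Rle_lt_trans with (k * (Cmod (Cminus (c w) (c z)) * (N + 1))).
    - apply Rmult_le_compat_l; [lra|]. apply Rmult_le_compat_l; [apply Cmod_ge_0|lra].
    - replace (e / 2) with (k * (e / (2 * k * (N + 1)) * (N + 1))) by (field; lra).
      apply Rmult_lt_compat_l; [lra|]. apply Rmult_lt_compat_r; [lra|exact H1]. }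
  assert (k * (Cmod (c w) * norm (minus (F w) (F z))) <=
    k * ((Cmod (c z) + 1) * norm (minus (F w) (F z)))) by (apply Rmult_le_compat_l; lra).
  fold N in B2. lra.
Qed.

End VectorIntegrals.

Lemma scont_on_inv (K : C -> Prop) a e :
  0 < e -> (forall z, K z -> e <= Cmod (Cminus z a)) -> scont_on K (fun z => Cinv (Cminus z a)).
Proof.
  intros He HK z Hz eps Heps. exists (eps * (e * e)). split.
  { repeat apply Rmult_lt_0_compat; assumption. }
  intros w Hw Hd. assert (H1 := HK z Hz). assert (H2 := HK w Hw).
  assert (N1 : Cminus z a <> RtoC 0) by (intros E; rewrite E, Cmod_0 in H1; lra).
  assert (N2 : Cminus w a <> RtoC 0) by (intros E; rewrite E, Cmod_0 in H2; lra).
  replace (Cminus (Cinv (Cminus w a)) (Cinv (Cminus z a))) with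
    (Cdiv (Copp (Cminus w z)) (Cmult (Cminus w a) (Cminus z a))) by (field; auto).
  rewrite Cmod_div, Cmod_opp, Cmod_mult by (apply Cmult_neq_0; assumption).
  assert (HP : 0 < Cmod (Cminus w a) * Cmod (Cminus z a)) by (apply Rmult_lt_0_compat; lra).
  apply Rmult_lt_reg_r with (1 := HP).
  unfold Rdiv. rewrite Rmult_assoc, Rinv_l, Rmult_1_r by lra.
  apply Rlt_le_trans with (1 := Hd). apply Rmult_le_compat_l; [lra|]. apply Rmult_le_compat; lra.
Qed.

Arguments is_curve_int {Y}. Arguments is_cycle_int {Y}. Arguments cont_on {Y}.

Lemma is_cycle_int_map {Y Z} (JY : cplx Y) (JZ : cplx Z) l G F v :
  clinear JY JZ l -> is_cycle_int JY G F v -> is_cycle_int JZ G (fun z => l (F z)) (l v).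
Proof.
  intros Hl. revert v; induction G as [|g G IH]; simpl; intros v.
  - intros ->. apply (linear_zero l). apply Hl.
  - intros (a & b & Ha & Hb & ->). exists (l a), (l b). repeat split.
    + unfold is_curve_int. apply is_RInt_ext with (fun t => l (cs JY (dcurve g t) (F (g t)))).
      { intros t _. apply (clinear_cs JY JZ l Hl). }
      apply (is_RInt_linear Y Z l); [apply Hl|exact Ha].
    + now apply IH.
    + apply (linear_plus l). apply Hl.
Qed.

(** * Liouville's theorem *)

Lemma is_derive_R_bound (x : R -> R) t dx e :
  is_derive x t dx -> 0 < e ->
  locally t (fun s => Rabs (x s - x t - (s - t) * dx) <= e * Rabs (s - t)).
Proof.
  intros [_ H] He. exact (H t (fun P HP => HP) (mkposreal e He)).
Qed.

Lemma is_derive_of_bound (Y : CompleteNormedModule R_AbsRing) (f : R -> Y) t l :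
  (forall e, 0 < e ->
     locally t (fun s => norm (minus (minus (f s) (f t)) (scal (s - t) l)) <= e * Rabs (s - t))) ->
  is_derive f t l.
Proof.
  intros H. split; [apply (is_linear_scal_l (V := Y))|].
  intros x Hx e.
  rewrite <- (is_filter_lim_locally_unique (K := R_AbsRing) (V := R_NormedModule) t x Hx).
  exact (H e (cond_pos e)).
Qed.

Section Liouville.

Variable Y : CompleteNormedModule R_AbsRing.
Variable J : cplx Y.
Variables phi psi : C -> Y.

Definition taylor_rem (z w : C) : Y :=
  minus (minus (phi w) (phi z)) (cs J (Cminus w z) (psi z)).

(** Working form of holomorphy with derivative [psi], uniform in both [z] and [w]. The same [d] is
    the radius and the inverse of the Taylor constant, so that one positive function of the centre
    is enough for the compactness argument. *)
Hypothesis quad_local : forall z0, exists d, 0 < d /\ forall z w,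
  Cmod (Cminus z z0) < d -> Cmod (Cminus w z0) < d ->
  d * norm (taylor_rem z w) <= Cmod (Cminus w z) ^ 2.

Hypothesis phi_decay : forall e, 0 < e -> exists R0, forall z, R0 <= Cmod z -> norm (phi z) <= e.

Lemma Cmod_minus_diag (z : C) : Cmod (Cminus z z) = 0.
Proof. replace (Cminus z z) with (RtoC 0) by ring. apply Cmod_0. Qed.

Lemma phi_cont_on : cont_on (fun _ => True) phi.
Proof.
  intros z _ e He. destruct (quad_local z) as (d & Hd & H).
  destruct (cs_bound J) as (k & Hk & Hcs).
  assert (HN := norm_ge_0 (psi z)).
  set (M := / d + k * norm (psi z)).
  assert (HM : 0 < M).
  { unfold M. assert (0 < / d) by now apply Rinv_0_lt_compat.
    assert (0 <= k * norm (psi z)) by (apply Rmult_le_pos; lra). lra. }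
  exists (Rmin 1 (Rmin d (e / M))). split.
  { repeat apply Rmin_case; try lra. now apply Rdiv_lt_0_compat. }
  intros w _ Hw.
  assert (L1 := Rmin_l 1 (Rmin d (e / M))). assert (L2 := Rmin_r 1 (Rmin d (e / M))).
  assert (L3 := Rmin_l d (e / M)). assert (L4 := Rmin_r d (e / M)).
  specialize (H z w). rewrite Cmod_minus_diag in H. specialize (H Hd ltac:(lra)).
  replace (minus (phi w) (phi z)) with (plus (taylor_rem z w) (cs J (Cminus w z) (psi z)))
    by (unfold taylor_rem; module_C).
  assert (HC := Cmod_ge_0 (Cminus w z)).
  apply Rle_lt_trans with (1 := norm_plus_le _ _).
  apply Rle_lt_trans with (M * Cmod (Cminus w z)).
  - unfold M. rewrite Rmult_plus_distr_r. apply Rplus_le_compat.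
    + apply Rmult_le_reg_l with d; [exact Hd|]. rewrite <- Rmult_assoc, Rinv_r, Rmult_1_l by lra.
      nra.
    + apply Rle_trans with (1 := Hcs _ _). lra.
  - replace e with (M * (e / M)) by (field; lra). apply Rmult_lt_compat_l; lra.
Qed.

(** Exchanging the two points and adding cancels [phi]: taylor_rem z w + taylor_rem w z = (w -
    z)(psi w - psi z). The left side is quadratic in |w - z|, so psi w - psi z is at most linear. *)
Lemma psi_cont_on : cont_on (fun _ => True) psi.
Proof.
  intros z _ e He. destruct (quad_local z) as (d & Hd & H).
  destruct (cs_bound J) as (k & Hk & Hcs).
  exists (Rmin d (e * d / (2 * k))). split.
  { apply Rmin_case; try lra. apply Rdiv_lt_0_compat; nra. }
  intros w _ Hw.
  assert (L1 := Rmin_l d (e * d / (2 * k))). assert (L2 := Rmin_r d (e * d / (2 * k))).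
  assert (Hz : Cmod (Cminus z z) < d) by (rewrite Cmod_minus_diag; exact Hd).
  assert (H1 := H z w Hz ltac:(lra)). assert (H2 := H w z ltac:(lra) Hz).
  destruct (Req_dec (Cmod (Cminus w z)) 0) as [E|E].
  { apply Cmod_eq_0 in E. replace w with z.
    - replace (minus (psi z) (psi z)) with (zero : Y).
      + rewrite norm_zero_eq. exact He.
      + symmetry. apply (plus_opp_r (psi z)).
    - replace w with (Cplus z (Cminus w z)) by ring. rewrite E. ring. }
  assert (Hwz : Cminus w z <> RtoC 0) by (intros E'; apply E; rewrite E'; apply Cmod_0).
  assert (HC := Cmod_ge_0 (Cminus w z)).
  replace (minus (psi w) (psi z)) with
    (cs J (Cinv (Cminus w z)) (plus (taylor_rem z w) (taylor_rem w z))).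
  2: { unfold taylor_rem. module_C_coefs; field; exact Hwz. }
  apply Rle_lt_trans with (1 := Hcs _ _). rewrite Cmod_inv by exact Hwz.
  assert (H3 := norm_plus_le (taylor_rem z w) (taylor_rem w z)).
  replace (Cmod (Cminus z w)) with (Cmod (Cminus w z)) in H2.
  2: { rewrite <- Cmod_opp. f_equal. ring. }
  assert (H4 : d * norm (plus (taylor_rem z w) (taylor_rem w z)) <= 2 * Cmod (Cminus w z) ^ 2) by nra.
  set (n := norm (plus (taylor_rem z w) (taylor_rem w z))) in *.
  apply Rmult_lt_reg_l with d; [exact Hd|].
  apply Rle_lt_trans with (k * (/ Cmod (Cminus w z) * (2 * Cmod (Cminus w z) ^ 2))).
  - replace (d * (k * (/ Cmod (Cminus w z) * n))) with (k * (/ Cmod (Cminus w z) * (d * n))) by ring.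
    apply Rmult_le_compat_l; [lra|]. apply Rmult_le_compat_l; [|exact H4].
    apply Rlt_le, Rinv_0_lt_compat. lra.
  - replace (k * (/ Cmod (Cminus w z) * (2 * Cmod (Cminus w z) ^ 2))) with
      (2 * k * Cmod (Cminus w z)) by (field; exact E).
    replace (d * e) with (2 * k * (e * d / (2 * k))) by (field; lra).
    apply Rmult_lt_compat_l; lra.
Qed.

Lemma is_derive_phi_path (p : R -> C) t d :
  path_derive p t d -> is_derive (fun s => phi (p s)) t (cs J d (psi (p t))).
Proof.
  intros [H1 H2]. destruct (quad_local (p t)) as (dl & Hdl & HQ).
  destruct (cs_bound J) as (k & Hk & Hcs).
  assert (HN := norm_ge_0 (psi (p t))). assert (Hd := Cmod_ge_0 d).
  set (N := norm (psi (p t))) in *. set (D := Cmod d + 2).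
  apply is_derive_of_bound. intros e He.
  (* Two errors share e: [eta] bounds the first-order remainder [q] of the path, which is multiplied
     by psi, and [rho] below keeps the quadratic Taylor remainder under e/2 |s - t|. As eta <= 1,
     the path moves by at most D |s - t| with D = |d| + 2. *)
  set (eta := Rmin 1 (e / (4 * k * (N + 1)))).
  assert (Heta : 0 < eta).
  { apply Rmin_case; [lra|]. apply Rdiv_lt_0_compat; [lra|]. apply Rmult_lt_0_compat; lra. }
  assert (Heta1 : eta <= 1) by apply Rmin_l.
  assert (Heta2 : eta <= e / (4 * k * (N + 1))) by apply Rmin_r.
  set (rho := Rmin (dl / D) (e * dl / (2 * (D * D)))).
  assert (HD : 0 < D) by (unfold D; lra).
  assert (Hrho : 0 < rho).
  { apply Rmin_case; apply Rdiv_lt_0_compat; nra. }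
  assert (Hr1 : rho <= dl / D) by apply Rmin_l.
  assert (Hr2 : rho <= e * dl / (2 * (D * D))) by apply Rmin_r.
  assert (L3 : locally t (fun s => Rabs (s - t) < rho)) by (exists (mkposreal _ Hrho); intros s Hs; exact Hs).
  generalize (filter_and _ _ L3 (filter_and _ _ (is_derive_R_bound _ _ _ _ H1 Heta) (is_derive_R_bound _ _ _ _ H2 Heta))).
  apply filter_imp. intros s (Hs & Hx & Hy).
  assert (Habs := Rabs_pos (s - t)).
  set (q := Cminus (Cminus (p s) (p t)) (Cmult (RtoC (s - t)) d)).
  assert (Hq : Cmod q <= 2 * eta * Rabs (s - t)).
  { apply Rle_trans with (1 := Cmod_le_abs q).
    replace (fst q) with (fst (p s) - fst (p t) - (s - t) * fst d) by (unfold q; simpl; ring).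
    replace (snd q) with (snd (p s) - snd (p t) - (s - t) * snd d) by (unfold q; simpl; ring).
    lra. }
  assert (Hw : Cmod (Cminus (p s) (p t)) <= D * Rabs (s - t)).
  { replace (Cminus (p s) (p t)) with (Cplus (Cmult (RtoC (s - t)) d) q) by (unfold q; ring).
    apply Rle_trans with (1 := Cmod_triangle _ _). rewrite Cmod_mult, Cmod_R. unfold D. nra. }
  assert (Hw2 : Cmod (Cminus (p s) (p t)) < dl).
  { apply Rle_lt_trans with (1 := Hw). replace dl with (D * (dl / D)) by (field; lra).
    apply Rmult_lt_compat_l; lra. }
  assert (HQ' := HQ (p t) (p s)). rewrite Cmod_minus_diag in HQ'. specialize (HQ' Hdl Hw2).
  replace (minus (minus (phi (p s)) (phi (p t))) (scal (s - t) (cs J d (psi (p t))))) with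
    (plus (taylor_rem (p t) (p s)) (cs J q (psi (p t)))).
  2: { transitivity (minus (minus (phi (p s)) (phi (p t))) (cs J (RtoC (s - t)) (cs J d (psi (p t))))).
       - unfold taylor_rem, q. module_C.
       - f_equal. symmetry. apply scal_cs. }
  apply Rle_trans with (1 := norm_plus_le _ _).
  assert (B1 : norm (taylor_rem (p t) (p s)) <= e / 2 * Rabs (s - t)).
  { apply Rmult_le_reg_l with dl; [exact Hdl|]. apply Rle_trans with (1 := HQ').
    apply Rle_trans with ((D * Rabs (s - t)) ^ 2).
    - apply pow_incr. split; [apply Cmod_ge_0|exact Hw].
    - replace ((D * Rabs (s - t)) ^ 2) with (D * D * Rabs (s - t) * Rabs (s - t)) by ring.
      rewrite <- Rmult_assoc. apply Rmult_le_compat_r; [lra|].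
      replace (dl * (e / 2)) with (D * D * (e * dl / (2 * (D * D)))) by (field; lra).
      apply Rmult_le_compat_l; nra. }
  assert (B2 : norm (cs J q (psi (p t))) <= e / 2 * Rabs (s - t)).
  { apply Rle_trans with (1 := Hcs _ _). fold N.
    apply Rle_trans with (k * (2 * eta * Rabs (s - t) * (N + 1))).
    - apply Rmult_le_compat_l; [lra|]. apply Rmult_le_compat; try lra. apply Cmod_ge_0.
    - replace (e / 2 * Rabs (s - t)) with (k * (2 * (e / (4 * k * (N + 1))) * Rabs (s - t) * (N + 1)))
        by (field; lra).
      apply Rmult_le_compat_l; [lra|]. apply Rmult_le_compat_r; [lra|].
      apply Rmult_le_compat_r; lra. }
  lra.
Qed.

Lemma quad_uniform R0 : 0 < R0 -> exists d, 0 < d /\ forall z w,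
  Cmod z <= R0 -> Cmod (Cminus w z) < d -> d * norm (taylor_rem z w) <= Cmod (Cminus w z) ^ 2.
Proof.
  intros HR.
  (* The factor 4 leaves room for the covering: both coordinates of z are within delta of the
     centre, hence z is within 2 delta, and w, less than delta away from z, within 3 delta. *)
  assert (Hch : forall z0, exists d : posreal, forall z w,
    Cmod (Cminus z z0) < 4 * d -> Cmod (Cminus w z0) < 4 * d ->
    d * norm (taylor_rem z w) <= Cmod (Cminus w z) ^ 2).
  { intros z0. destruct (quad_local z0) as (d & Hd & H).
    assert (Hd4 : 0 < d / 4) by lra. exists (mkposreal _ Hd4). simpl.
    intros z w Hz Hw. assert (K := H z w ltac:(lra) ltac:(lra)).
    assert (N := norm_ge_0 (taylor_rem z w)). nra. }
  set (delta := fun u v => proj1_sig (constructive_indefinite_description _ (Hch (u, v)))).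
  assert (Hdelta : forall u v z w,
    Cmod (Cminus z (u, v)) < 4 * delta u v -> Cmod (Cminus w (u, v)) < 4 * delta u v ->
    delta u v * norm (taylor_rem z w) <= Cmod (Cminus w z) ^ 2).
  { intros u v. unfold delta. now destruct constructive_indefinite_description. }
  destruct (compactness_value_2d (- R0) R0 (- R0) R0 delta) as [d Hd].
  exists d. split; [apply cond_pos|]. intros z w Hz Hw.
  assert (Hm := Rmax_Cmod z).
  assert (M1 := Rmax_l (Rabs (fst z)) (Rabs (snd z))).
  assert (M2 := Rmax_r (Rabs (fst z)) (Rabs (snd z))).
  (* The compactness statement yields its centre only under a double negation, which is removed
     classically. *)
  specialize (Hd (fst z) (snd z)). apply Classical_Prop.NNPP. intros Hn. apply Hd.
  - apply Rabs_le_between. lra.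
  - apply Rabs_le_between. lra.
  - intros (u & v & _ & _ & Hu & Hv & Hdd). apply Hn.
    assert (Hzu : Cmod (Cminus z (u, v)) < 2 * delta u v).
    { apply Rle_lt_trans with (1 := Cmod_le_abs _).
      change (Rabs (fst z - u) + Rabs (snd z - v) < 2 * delta u v). lra. }
    assert (Hwu : Cmod (Cminus w (u, v)) < 3 * delta u v).
    { replace (Cminus w (u, v)) with (Cplus (Cminus w z) (Cminus z (u, v))) by ring.
      apply Rle_lt_trans with (1 := Cmod_triangle _ _). lra. }
    assert (P := cond_pos (delta u v)).
    apply Rle_trans with (delta u v * norm (taylor_rem z w)).
    + apply Rmult_le_compat_r; [apply norm_ge_0|exact Hdd].
    + apply Hdelta; lra.
Qed.

(** * Means over circles centred at the origin *)

Definition circ (r th : R) : C := (r * cos th, r * sin th).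

Lemma circ_path_derive r th : path_derive (circ r) th (Cmult Ci (circ r th)).
Proof.
  split; simpl; auto_derive; auto; ring.
Qed.

Lemma Cmod_circ r th : Cmod (circ r th) = Rabs r.
Proof.
  unfold Cmod, circ; simpl fst; simpl snd.
  replace ((r * cos th) ^ 2 + (r * sin th) ^ 2) with (Rsqr r * ((sin th)² + (cos th)²)) by
    (unfold Rsqr; ring).
  rewrite sin2_cos2, Rmult_1_r. apply sqrt_Rsqr_abs.
Qed.

Definition circ_int (r : R) : Y := RInt (fun th => phi (circ r th)) 0 (2 * PI).

Lemma continuous_circ F r th : cont_on (Y := Y) (fun _ => True) F -> continuous (fun t => F (circ r t)) th.
Proof.
  intros HF. apply (cont_on_comp Y (fun _ => True)); auto.
  - apply (ex_derive_continuous (V := R_NormedModule) (fun s => fst (circ r s))).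
    eexists. exact (proj1 (circ_path_derive r th)).
  - apply (ex_derive_continuous (V := R_NormedModule) (fun s => snd (circ r s))).
    eexists. exact (proj2 (circ_path_derive r th)).
Qed.

Lemma circ_int_correct r : is_RInt (fun th => phi (circ r th)) 0 (2 * PI) (circ_int r).
Proof.
  apply RInt_correct. apply (ex_RInt_continuous (V := Y)). intros th _.
  apply continuous_circ, phi_cont_on.
Qed.

(** The integrand is the derivative in the angle of phi along the circle, a periodic function. *)
Lemma circ_psi_int r :
  is_RInt (fun th => cs J (Cmult Ci (circ r th)) (psi (circ r th))) 0 (2 * PI) zero.
Proof.
  assert (E : minus (phi (circ r (2 * PI))) (phi (circ r 0)) = zero).
  { unfold circ. rewrite cos_2PI, sin_2PI, cos_0, sin_0.
    apply (plus_opp_r (phi (r * 1, r * 0))). }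
  assert (H : is_RInt (fun th => cs J (Cmult Ci (circ r th)) (psi (circ r th))) 0 (2 * PI)
    (minus (phi (circ r (2 * PI))) (phi (circ r 0)))).
  { apply (is_RInt_derive (V := Y) (fun th => phi (circ r th))).
    - intros th _. exact (is_derive_phi_path (circ r) th _ (circ_path_derive r th)).
    - intros th _. apply continuous_cs.
      + simpl. apply (ex_derive_continuous (V := R_NormedModule)). auto_derive; auto.
      + simpl. apply (ex_derive_continuous (V := R_NormedModule)). auto_derive; auto.
      + apply continuous_circ, psi_cont_on. }
  rewrite E in H. exact H.
Qed.

(** The radial displacement at each angle is the same complex multiple of the tangent vector, so the
    linear Taylor term integrates to zero by [circ_psi_int] and only the quadratic remainder is
    left. The mean over the circle therefore has zero derivative in the radius. *)
Lemma circ_int_step R0 d r r' :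
  (forall z w, Cmod z <= R0 -> Cmod (Cminus w z) < d ->
     d * norm (taylor_rem z w) <= Cmod (Cminus w z) ^ 2) ->
  0 < d -> 0 < r <= R0 -> Rabs (r' - r) < d ->
  d * norm (minus (circ_int r') (circ_int r)) <= 2 * PI * (r' - r) ^ 2.
Proof.
  intros Hu Hd Hr Hr'. assert (HPI := PI_RGT_0).
  (* Chosen so that c times i r e^(i th), the tangent, equals (r' - r) e^(i th), the radial
     displacement. *)
  set (c := Cmult (RtoC ((r' - r) / r)) (Copp Ci)).
  assert (Hint : is_RInt (fun th => taylor_rem (circ r th) (circ r' th)) 0 (2 * PI)
    (minus (minus (circ_int r') (circ_int r)) (cs J c zero))).
  { apply is_RInt_ext with (fun th => minus (minus (phi (circ r' th)) (phi (circ r th)))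
      (cs J c (cs J (Cmult Ci (circ r th)) (psi (circ r th))))).
    - intros th _. unfold taylor_rem. f_equal. rewrite <- cs_mult. f_equal.
      unfold c, circ. unfold Cmult, Cminus, Cplus, Copp, Ci, RtoC. simpl. f_equal; field; lra.
    - apply (is_RInt_minus (V := Y)).
      + apply (is_RInt_minus (V := Y)); apply circ_int_correct.
      + apply (is_RInt_linear Y Y (cs J c)); [apply cs_linear|]. apply circ_psi_int. }
  replace (minus (minus (circ_int r') (circ_int r)) (cs J c zero)) with
    (minus (circ_int r') (circ_int r)) in Hint by module_C.
  apply Rmult_le_reg_l with (/ d); [now apply Rinv_0_lt_compat|].
  rewrite <- Rmult_assoc, Rinv_l, Rmult_1_l by lra.
  apply Rle_trans with ((2 * PI - 0) * (/ d * (r' - r) ^ 2)); [|lra].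
  apply (norm_RInt_le_const (V := Y) (fun th => taylor_rem (circ r th) (circ r' th)));
    [lra| |exact Hint].
  intros th _.
  assert (E : Cmod (Cminus (circ r' th) (circ r th)) = Rabs (r' - r)).
  { rewrite <- (Cmod_circ (r' - r) th). f_equal. unfold circ, Cminus, Cplus, Copp; simpl.
    f_equal; ring. }
  assert (H := Hu (circ r th) (circ r' th)). rewrite E, Cmod_circ, pow2_abs in H.
  apply Rmult_le_reg_l with d; [exact Hd|]. rewrite <- Rmult_assoc, Rinv_r, Rmult_1_l by lra.
  apply H; [rewrite Rabs_pos_eq; lra|exact Hr'].
Qed.

Lemma circ_int_const a b : 0 < a -> a < b -> circ_int a = circ_int b.
Proof.
  intros Ha Hab. assert (HPI := PI_RGT_0).
  apply (eq_is_derive (V := Y) circ_int); [|exact Hab].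
  intros t Ht. destruct (quad_uniform b ltac:(lra)) as (d & Hd & Hu).
  apply is_derive_of_bound. intros e He.
  assert (Hr : 0 < Rmin d (e * d / (2 * PI))).
  { apply Rmin_case; [exact Hd|]. apply Rdiv_lt_0_compat; nra. }
  exists (mkposreal _ Hr). intros s Hs. change (Rabs (s - t) < Rmin d (e * d / (2 * PI))) in Hs.
  assert (L1 := Rmin_l d (e * d / (2 * PI))). assert (L2 := Rmin_r d (e * d / (2 * PI))).
  assert (H := circ_int_step b d t s Hu Hd ltac:(lra) ltac:(lra)).
  assert (E : minus (minus (circ_int s) (circ_int t)) (scal (s - t) zero) =
    minus (circ_int s) (circ_int t)) by module_R.
  apply Rle_trans with (1 := Req_le _ _ (f_equal norm E)).
  apply Rmult_le_reg_l with d; [exact Hd|]. apply Rle_trans with (1 := H).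
  rewrite <- pow2_abs. assert (Hp := Rabs_pos (s - t)).
  replace (2 * PI * Rabs (s - t) ^ 2) with (2 * PI * Rabs (s - t) * Rabs (s - t)) by ring.
  replace (d * (e * Rabs (s - t))) with (2 * PI * (e * d / (2 * PI)) * Rabs (s - t)) by (field; lra).
  apply Rmult_le_compat_r; [exact Hp|]. apply Rmult_le_compat_l; lra.
Qed.

(** The mean over a circle does not depend on the radius: for a small circle it is close to phi(0)
    by continuity, for a large one it is close to zero by decay. *)
Theorem entire_decay_zero : phi (RtoC 0) = zero.
Proof.
  assert (HPI := PI_RGT_0). apply (norm_eq_zero (V := Y)).
  apply Rle_antisym; [|apply norm_ge_0].
  apply le_epsilon. intros e He. rewrite Rplus_0_l.
  destruct (phi_decay (e / 3) ltac:(lra)) as [R0 HR0].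
  destruct (phi_cont_on (RtoC 0) I (e / 3) ltac:(lra)) as (d & Hd & Hc).
  (* [a] is inside the continuity radius at 0, [b] is beyond the decay radius; the added 1 gives a <
     b. *)
  set (a := d / 2). set (b := Rmax R0 a + 1).
  assert (Hb1 := Rmax_l R0 a). assert (Hb2 := Rmax_r R0 a).
  assert (Ha : 0 < a) by (unfold a; lra).
  assert (Hab : circ_int a = circ_int b) by (apply circ_int_const; unfold b; lra).
  assert (Nb : norm (circ_int b) <= (2 * PI - 0) * (e / 3)).
  { apply (norm_RInt_le_const (V := Y) (fun th => phi (circ b th))); [lra| |apply circ_int_correct].
    intros th _. apply HR0. rewrite Cmod_circ, Rabs_pos_eq; unfold b; lra. }
  assert (Na : norm (minus (circ_int a) (scal (2 * PI - 0) (phi (RtoC 0)))) <= (2 * PI - 0) * (e / 3)).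
  { apply (norm_RInt_le_const (V := Y) (fun th => minus (phi (circ a th)) (phi (RtoC 0)))); [lra| |].
    - intros th _. apply Rlt_le, Hc; [exact I|].
      replace (Cminus (circ a th) (RtoC 0)) with (circ a th) by ring.
      rewrite Cmod_circ, Rabs_pos_eq; unfold a; lra.
    - apply (is_RInt_minus (V := Y)); [apply circ_int_correct|].
      apply (is_RInt_const (V := Y)). }
  rewrite Rminus_0_r in *.
  assert (E : phi (RtoC 0) = scal (/ (2 * PI)) (minus (circ_int a)
    (minus (circ_int a) (scal (2 * PI) (phi (RtoC 0)))))).
  { module_coefs; cbn; field; lra. }
  rewrite E at 1.
  assert (H1 := norm_scal_le (/ (2 * PI)) (minus (circ_int a)
    (minus (circ_int a) (scal (2 * PI) (phi (RtoC 0)))))).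
  assert (H2 := norm_minus_le (circ_int a) (minus (circ_int a) (scal (2 * PI) (phi (RtoC 0))))).
  rewrite <- Hab in Nb. apply Rle_trans with (1 := H1).
  rewrite Rabs_pos_eq by (apply Rlt_le, Rinv_0_lt_compat; lra).
  apply Rmult_le_reg_l with (2 * PI); [lra|].
  rewrite <- Rmult_assoc, Rinv_r, Rmult_1_l by lra.
  apply Rle_trans with (1 := H2). 
  apply Rle_trans with (1 := Rplus_le_compat _ _ _ _ Nb Na). nra.
Qed.

End Liouville.

(** * The Cauchy integral of a resolvent *)

Section ResolventIntegral.

Variable Y : CompleteNormedModule R_AbsRing.
Variable J : cplx Y.
Variable A : Y -> Y.
Hypothesis A_clinear : clinear J J A.
Variable U : C -> Prop.
Hypothesis U_open : forall z, U z -> exists e, 0 < e /\ forall w, Cmod (Cminus w z) < e -> U w.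
Variable G : list (R -> R * R).
Hypothesis G_closed : forall g, In g G -> piecewise_C1 g /\ g 0 = g 1.
Hypothesis G_off : forall z, on_curves G z -> ~ U z.
Hypothesis G_winding : forall a, U a -> total_winding G a = 1.

Definition resolves (Rz : Y -> Y) (z : C) :=
  is_linear Rz /\ (forall y, Rz (minus (cs J z y) (A y)) = y) /\
  (forall y, minus (cs J z (Rz y)) (A (Rz y)) = y).

Variable Rs : C -> Y -> Y.
Hypothesis Rs_resolves : forall z, ~ U z -> resolves (Rs z) z.

Lemma A_minus x y : A (minus x y) = minus (A x) (A y).
Proof. apply (linear_minus A). apply A_clinear. Qed.

(* With [Rz] the resolvent at [z0], a point [x] with [(w - A) x = b] satisfies
   [x = Rz (b + (z0 - w) x)], and the last term is absorbed when [w] is close to [z0]. *)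
Lemma resolvent_absorb z0 : ~ U z0 -> exists d B, 0 < d /\ 0 < B /\ forall w (x b : Y),
  Cmod (Cminus w z0) < d -> minus (cs J w x) (A x) = b -> norm x <= B * norm b.
Proof.
  intros Hz. destruct (Rs_resolves z0 Hz) as (Rl & R1 & R2).
  destruct (linear_norm _ Rl) as (M & HM & HR). destruct (cs_bound J) as (k & Hk & Hcs).
  assert (HMk : 0 < M * k) by (apply Rmult_lt_0_compat; assumption).
  exists (/ (2 * (M * k))), (2 * M). split; [apply Rinv_0_lt_compat; lra|]. split; [lra|].
  intros w x b Hw Hb.
  assert (E : x = Rs z0 (plus b (cs J (Cminus z0 w) x))).
  { rewrite <- (R1 x) at 1. f_equal. rewrite <- Hb. module_C. }
  assert (H1 := HR (plus b (cs J (Cminus z0 w) x))).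
  assert (H2 := norm_plus_le b (cs J (Cminus z0 w) x)).
  assert (H3 := Hcs (Cminus z0 w) x). rewrite <- E in H1.
  assert (Hx := norm_ge_0 x).
  replace (Cmod (Cminus z0 w)) with (Cmod (Cminus w z0)) in H3.
  2: { rewrite <- Cmod_opp. f_equal. ring. }
  assert (H4 : M * k * (Cmod (Cminus w z0) * norm x) <= / 2 * norm x).
  { replace (/ 2 * norm x) with (M * k * (/ (2 * (M * k)) * norm x)) by (field; lra).
    apply Rmult_le_compat_l; [lra|]. apply Rmult_le_compat_r; lra. }
  assert (H5 : M * norm (plus b (cs J (Cminus z0 w) x)) <=
    M * (norm b + k * (Cmod (Cminus w z0) * norm x))).
  { apply Rmult_le_compat_l; [lra|]. apply Rle_trans with (1 := H2). lra. }
  apply Rle_trans with (1 := H1) in H5. lra.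
Qed.

(** By the resolvent identity, R(w)y - R(z)y solves (w - A)x = (z - w)R(z)y, to which
    [resolvent_absorb] applies with a constant that does not depend on w. *)
Lemma resolvent_cont_on y : cont_on (fun z => ~ U z) (fun z => Rs z y).
Proof.
  intros z Hz e He. destruct (resolvent_absorb z Hz) as (d & B & Hd & HB & H).
  destruct (cs_bound J) as (k & Hk & Hcs).
  set (N := norm (Rs z y)). assert (HN : 0 <= N) by apply norm_ge_0.
  assert (HP : 0 < B * k * (N + 1)) by (repeat apply Rmult_lt_0_compat; lra).
  exists (Rmin d (e / (B * k * (N + 1)))). split.
  { apply Rmin_case; [exact Hd|]. now apply Rdiv_lt_0_compat. }
  intros w Hw Hwz.
  assert (L1 := Rmin_l d (e / (B * k * (N + 1)))). assert (L2 := Rmin_r d (e / (B * k * (N + 1)))).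
  destruct (Rs_resolves z Hz) as (_ & _ & Rz). destruct (Rs_resolves w Hw) as (_ & _ & Rw).
  assert (H1 : norm (minus (Rs w y) (Rs z y)) <= B * norm (cs J (Cminus z w) (Rs z y))).
  { apply (H w); [lra|]. rewrite A_minus.
    transitivity (plus (minus (minus (cs J w (Rs w y)) (A (Rs w y)))
      (minus (cs J z (Rs z y)) (A (Rs z y)))) (cs J (Cminus z w) (Rs z y))).
    - module_C.
    - rewrite Rw, Rz. module_C. }
  assert (H2 := Hcs (Cminus z w) (Rs z y)). fold N in H2.
  replace (Cmod (Cminus z w)) with (Cmod (Cminus w z)) in H2.
  2: { rewrite <- Cmod_opp. f_equal. ring. }
  apply Rle_lt_trans with (1 := H1).
  apply Rle_lt_trans with (B * (k * (Cmod (Cminus w z) * (N + 1)))).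
  - apply Rmult_le_compat_l; [lra|]. apply Rle_trans with (1 := H2).
    apply Rmult_le_compat_l; [lra|]. apply Rmult_le_compat_l; [apply Cmod_ge_0|lra].
  - replace (B * (k * (Cmod (Cminus w z) * (N + 1)))) with
      (B * k * (N + 1) * Cmod (Cminus w z)) by ring.
    replace e with (B * k * (N + 1) * (e / (B * k * (N + 1)))) by (field; lra).
    apply Rmult_lt_compat_l; lra.
Qed.

Definition Cinv2 (z : C) := Cmult (Cinv z) (Cinv z).

Lemma curves_far z e : (forall w, Cmod (Cminus w z) < e -> U w) ->
  forall s, on_curves G s -> e <= Cmod (Cminus s z).
Proof.
  intros H s Hs. destruct (Rle_or_lt e (Cmod (Cminus s z))) as [Hle|Hlt]; [exact Hle|].
  exfalso. exact (G_off s Hs (H s Hlt)).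
Qed.

Lemma curves_neq z s : U z -> on_curves G s -> Cminus s z <> RtoC 0.
Proof.
  intros Hz Hs. apply Cminus_neq0. intros ->. exact (G_off z Hs Hz).
Qed.

(** * Dixon's function and its derivative *)

Variables y v : Y.
Hypothesis v_int : is_cycle_int J G (fun s => Rs s y) v.

Let k0 : Y := minus (cs J (0, 2 * PI) y) v.

(** The candidates for phi(z) and its derivative; the second equation is the derivative of (z - A)
    phi = k. On U the Cauchy integrals determine the pair, elsewhere the two equations do, through
    the resolvent. Both equations hold for every z, which is what joins the two regimes. *)
Definition cauchy_pair (z : C) (p : Y * Y) :=
  minus (cs J z (fst p)) (A (fst p)) = k0 /\
  minus (cs J z (snd p)) (A (snd p)) = opp (fst p) /\
  (U z -> is_cycle_int J G (fun s => cs J (Cinv (Cminus s z)) (Rs s y)) (fst p) /\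
          is_cycle_int J G (fun s => cs J (Cinv2 (Cminus s z)) (Rs s y)) (snd p)).

Lemma curves_pw g : In g G -> piecewise_C1 g.
Proof. intros H. apply G_closed, H. Qed.

Lemma cont_on_sub (K K' : C -> Prop) (F : C -> Y) : (forall z, K' z -> K z) -> cont_on K F -> cont_on K' F.
Proof.
  intros H HF z Hz e He. destruct (HF z (H z Hz) e He) as (d & Hd & Hd').
  exists d. split; [exact Hd|]. intros w Hw. apply Hd'. now apply H.
Qed.

Lemma curve_cont_on : cont_on (on_curves G) (fun s => Rs s y).
Proof. apply (cont_on_sub (fun z => ~ U z)); [exact G_off|apply resolvent_cont_on]. Qed.

Lemma clinear_shift z : clinear J J (fun x => minus (cs J z x) (A x)).
Proof.
  destruct A_clinear as [Al AJ]. split.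
  - apply is_linear_ext with (fun x => plus (fst (cs J z x, opp (A x))) (snd (cs J z x, opp (A x)))).
    { reflexivity. }
    apply (is_linear_comp (fun x => (cs J z x, opp (A x))) (fun p => plus (fst p) (snd p))).
    + apply is_linear_prod; [apply cs_linear|]. apply (is_linear_comp A opp); [exact Al|].
      apply is_linear_opp.
    + apply is_linear_plus.
  - intros x. rewrite AJ, !(cJ_cs J). module_C.
Qed.

Lemma cauchy_pair_ex z : exists p, cauchy_pair z p.
Proof.
  destruct (Classical_Prop.classic (U z)) as [Hz|Hz].
  - destruct (U_open z Hz) as (e & He & Hball). assert (Hfar := curves_far z e Hball).
    assert (Hc1 : cont_on (on_curves G) (fun s => cs J (Cinv (Cminus s z)) (Rs s y))).
    { apply cont_on_cs; [now apply scont_on_inv with e|apply curve_cont_on]. }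
    assert (Hc2 : cont_on (on_curves G) (fun s => cs J (Cinv2 (Cminus s z)) (Rs s y))).
    { assert (H2 : cont_on (on_curves G)
        (fun s => cs J (Cinv (Cminus s z)) (cs J (Cinv (Cminus s z)) (Rs s y)))).
      { apply cont_on_cs; [now apply scont_on_inv with e|exact Hc1]. }
      intros a Ha r Hr. destruct (H2 a Ha r Hr) as (d & Hd & H3). exists d. split; [exact Hd|].
      intros w Hw Hwa. unfold Cinv2. rewrite !cs_mult. now apply H3. }
    destruct (ex_cycle_int Y J _ _ G Hc1 curves_pw (fun z H => H)) as [p1 Hp1].
    destruct (ex_cycle_int Y J _ _ G Hc2 curves_pw (fun z H => H)) as [p2 Hp2].
    exists (p1, p2). unfold cauchy_pair; simpl. split; [|split; [|auto]].
    (* The integral of (z - A)R(s)y/(s - z) is computed twice: by pulling z - A out, and by writing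
       z - A = (s - A) - (s - z), which turns the integrand into y/(s - z) - R(s)y. *)
    + apply (is_cycle_int_unique Y J G (fun s => minus (cs J z (cs J (Cinv (Cminus s z)) (Rs s y)))
        (A (cs J (Cinv (Cminus s z)) (Rs s y))))).
      * apply (is_cycle_int_map J J (fun x => minus (cs J z x) (A x)) G _ _ (clinear_shift z) Hp1).
      * apply is_cycle_int_ext with (fun s => plus (cs J (Cinv (Cminus s z)) y) (cs J (RtoC (-1)) (Rs s y))).
        { intros s Hs. rewrite (clinear_cs J J A A_clinear).
          destruct (Rs_resolves s (G_off s Hs)) as (_ & _ & Rr).
          assert (Hn := curves_neq z s Hz Hs).
          rewrite <- (Rr y) at 1. module_C_coefs; field; exact Hn. }
        replace k0 with (plus (cs J (0, 2 * PI) y) (cs J (RtoC (-1)) v)) by (unfold k0; module_C).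
        apply is_cycle_int_plus.
        (* Winding number one around z enters here. *)
        { replace (0, 2 * PI) with (0, 2 * PI * total_winding G z) by
            (rewrite (G_winding z Hz), Rmult_1_r; reflexivity).
          apply is_cycle_int_winding; [exact G_closed|]. intros Hon. exact (G_off z Hon Hz). }
        exact (is_cycle_int_map J J _ G _ _ (clinear_cscal J (RtoC (-1))) v_int).
    + apply (is_cycle_int_unique Y J G (fun s => minus (cs J z (cs J (Cinv2 (Cminus s z)) (Rs s y)))
        (A (cs J (Cinv2 (Cminus s z)) (Rs s y))))).
      * apply (is_cycle_int_map J J (fun x => minus (cs J z x) (A x)) G _ _ (clinear_shift z) Hp2).
      * apply is_cycle_int_ext with (fun s => plus (cs J (Cinv2 (Cminus s z)) y)
          (cs J (RtoC (-1)) (cs J (Cinv (Cminus s z)) (Rs s y)))).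
        { intros s Hs. rewrite (clinear_cs J J A A_clinear).
          destruct (Rs_resolves s (G_off s Hs)) as (_ & _ & Rr).
          assert (Hn := curves_neq z s Hz Hs). unfold Cinv2.
          rewrite <- (Rr y) at 1. module_C_coefs; field; exact Hn. }
        (* The same splitting with a squared kernel: y/(s - z)^2 has the primitive -y/(s - z) and
           contributes zero, leaving minus the first integral. *)
        replace (opp p1) with (plus zero (cs J (RtoC (-1)) p1)) by module_C.
        apply is_cycle_int_plus.
        { apply is_cycle_int_scalar_zero. intros g Hg. destruct (G_closed g Hg) as [Hg1 Hg2].
          apply scalar_int_inv_sqr; [exact Hg1|exact Hg2|]. intros t Ht E. apply (G_off z); [|exact Hz].
          exists g. split; [exact Hg|]. now exists t. }
        exact (is_cycle_int_map J J _ G _ _ (clinear_cscal J (RtoC (-1))) Hp1).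
  - destruct (Rs_resolves z Hz) as (_ & _ & Rr).
    exists (Rs z k0, Rs z (opp (Rs z k0))). unfold cauchy_pair; simpl.
    split; [apply Rr|]. split; [apply Rr|]. intros Hz'. now elim Hz.
Qed.

Definition cpair (z : C) : Y * Y :=
  proj1_sig (constructive_indefinite_description _ (cauchy_pair_ex z)).

Lemma cpair_spec z : cauchy_pair z (cpair z).
Proof. unfold cpair. now destruct constructive_indefinite_description. Qed.

Let phi z := fst (cpair z).
Let psi z := snd (cpair z).

Lemma phi_eq z : minus (cs J z (phi z)) (A (phi z)) = k0.
Proof. apply cpair_spec. Qed.

Lemma psi_eq z : minus (cs J z (psi z)) (A (psi z)) = opp (phi z).
Proof. apply cpair_spec. Qed.

(** With q = w - z, the kernels satisfy 1/(s - w) - 1/(s - z) - q/(s - z)^2 = q^2/((s - z)^2 (s -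
    w)), so the remainder is an explicit integral carrying the factor q^2. *)
Lemma quad_in_U z0 : U z0 -> exists d, 0 < d /\ forall z w,
  Cmod (Cminus z z0) < d -> Cmod (Cminus w z0) < d ->
  d * norm (taylor_rem Y J phi psi z w) <= Cmod (Cminus w z) ^ 2.
Proof.
  intros Hz0. destruct (U_open z0 Hz0) as (e & He & Hball).
  assert (Hfar := curves_far z0 e Hball).
  destruct (cycle_int_bound Y J _ _ G curve_cont_on curves_pw (fun z H => H)) as (M & HM & Hbd).
  (* Within e/2 of z0 every point keeps distance at least e/2 from the curves, so the three inverse
     factors are bounded by 1/(e/2)^3; M + 1 avoids dividing by zero. *)
  assert (He3 : 0 < (e / 2) * (e / 2) * (e / 2)) by (repeat apply Rmult_lt_0_compat; lra).
  assert (Hd : 0 < Rmin (e / 2) ((e / 2) * (e / 2) * (e / 2) / (M + 1))).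
  { apply Rmin_case; [lra|]. apply Rdiv_lt_0_compat; lra. }
  exists (Rmin (e / 2) ((e / 2) * (e / 2) * (e / 2) / (M + 1))). split; [exact Hd|].
  set (d := Rmin (e / 2) ((e / 2) * (e / 2) * (e / 2) / (M + 1))) in *.
  assert (L1 : d <= e / 2) by apply Rmin_l.
  assert (L2 : d <= (e / 2) * (e / 2) * (e / 2) / (M + 1)) by apply Rmin_r.
  intros z w Hz Hw.
  assert (Uz : U z) by (apply Hball; lra). assert (Uw : U w) by (apply Hball; lra).
  assert (Hnear : forall u, Cmod (Cminus u z0) < d -> forall s, on_curves G s ->
    e / 2 <= Cmod (Cminus s u)).
  { intros u Hu s Hs. assert (H1 := Hfar s Hs).
    replace (Cminus s z0) with (Cplus (Cminus s u) (Cminus u z0)) in H1 by ring.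
    assert (H2 := Cmod_triangle (Cminus s u) (Cminus u z0)). lra. }
  destruct (proj2 (proj2 (cpair_spec z)) Uz) as [Hz1 Hz2].
  destruct (proj2 (proj2 (cpair_spec w)) Uw) as [Hw1 _].
  set (q := Cminus w z).
  set (c := fun s => Cmult (Cmult q q) (Cmult (Cinv2 (Cminus s z)) (Cinv (Cminus s w)))).
  assert (Hint : is_cycle_int J G (fun s => cs J (c s) (Rs s y)) (taylor_rem Y J phi psi z w)).
  { apply is_cycle_int_ext with (fun s => plus (cs J (Cinv (Cminus s w)) (Rs s y))
      (plus (cs J (RtoC (-1)) (cs J (Cinv (Cminus s z)) (Rs s y)))
            (cs J (Copp q) (cs J (Cinv2 (Cminus s z)) (Rs s y))))).
    { intros s Hs. assert (N1 := curves_neq z s Uz Hs). assert (N2 := curves_neq w s Uw Hs).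
      unfold c, q, Cinv2. module_C_coefs; field; auto. }
    replace (taylor_rem Y J phi psi z w) with
      (plus (phi w) (plus (cs J (RtoC (-1)) (phi z)) (cs J (Copp q) (psi z)))).
    2: { unfold taylor_rem. fold q. module_C. }
    apply is_cycle_int_plus; [exact Hw1|]. apply is_cycle_int_plus.
    - exact (is_cycle_int_map J J _ G _ _ (clinear_cscal J (RtoC (-1))) Hz1).
    - exact (is_cycle_int_map J J _ G _ _ (clinear_cscal J (Copp q)) Hz2). }
  assert (Hq := Cmod_ge_0 q).
  assert (HN : norm (taylor_rem Y J phi psi z w) <=
    M * (Cmod q ^ 2 / ((e / 2) * (e / 2) * (e / 2)))).
  { apply (Hbd c); [| |exact Hint].
    - intros s Hs. assert (N1 := curves_neq z s Uz Hs). assert (N2 := curves_neq w s Uw Hs).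
      assert (F1 := Hnear z Hz s Hs). assert (F2 := Hnear w Hw s Hs).
      unfold c, Cinv2. rewrite !Cmod_mult, !Cmod_inv by assumption.
      assert (I1 : / Cmod (Cminus s z) <= / (e / 2)) by (apply Rinv_le_contravar; lra).
      assert (I2 : / Cmod (Cminus s w) <= / (e / 2)) by (apply Rinv_le_contravar; lra).
      assert (P1 : 0 < / Cmod (Cminus s z)) by (apply Rinv_0_lt_compat; lra).
      assert (P2 : 0 < / Cmod (Cminus s w)) by (apply Rinv_0_lt_compat; lra).
      replace (Cmod q ^ 2 / (e / 2 * (e / 2) * (e / 2))) with
        (Cmod q * Cmod q * (/ (e / 2) * / (e / 2) * / (e / 2))) by (field; lra).
      apply Rmult_le_compat_l; [now apply Rmult_le_pos|].
      apply Rmult_le_compat; try lra; [apply Rmult_le_pos; lra|]. apply Rmult_le_compat; lra.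
    - apply Rmult_le_pos; [apply pow_le, Hq|]. now apply Rlt_le, Rinv_0_lt_compat. }
  assert (HNn := norm_ge_0 (taylor_rem Y J phi psi z w)).
  set (E3 := (e / 2) * (e / 2) * (e / 2)) in *.
  apply Rle_trans with (E3 / (M + 1) * (M * (Cmod q ^ 2 / E3))).
  { apply Rmult_le_compat; lra. }
  replace (E3 / (M + 1) * (M * (Cmod q ^ 2 / E3))) with (Cmod q ^ 2 * (M / (M + 1))) by (field; lra).
  rewrite <- (Rmult_1_r (Cmod q ^ 2)) at 2. apply Rmult_le_compat_l; [apply pow_le, Hq|].
  apply Rmult_le_reg_r with (M + 1); [lra|]. unfold Rdiv. rewrite Rmult_assoc, Rinv_l; lra.
Qed.

(** Applying w - A to the remainder leaves -(w - z)^2 psi(z), by the two equations alone. Hence z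
    and w may lie on either side of the boundary, and [resolvent_absorb] at z0 bounds both psi(z)
    and the remainder. *)
Lemma quad_off_U z0 : ~ U z0 -> exists d, 0 < d /\ forall z w,
  Cmod (Cminus z z0) < d -> Cmod (Cminus w z0) < d ->
  d * norm (taylor_rem Y J phi psi z w) <= Cmod (Cminus w z) ^ 2.
Proof.
  intros Hz0. destruct (resolvent_absorb z0 Hz0) as (d0 & B & Hd0 & HB & H).
  destruct (cs_bound J) as (k & Hk & Hcs).
  set (M := B * (k * (B * (B * norm k0)))).
  assert (HM : 0 <= M) by (assert (K := norm_ge_0 k0); repeat apply Rmult_le_pos; lra).
  exists (Rmin d0 (/ (M + 1))). split.
  { apply Rmin_case; [exact Hd0|]. apply Rinv_0_lt_compat; lra. }
  assert (L1 := Rmin_l d0 (/ (M + 1))). assert (L2 := Rmin_r d0 (/ (M + 1))).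
  intros z w Hz Hw.
  assert (Hphi : norm (phi z) <= B * norm k0) by (apply (H z); [lra|apply phi_eq]).
  assert (Hpsi : norm (psi z) <= B * (B * norm k0)).
  { apply Rle_trans with (B * norm (opp (phi z))); [apply (H z); [lra|apply psi_eq]|].
    apply Rmult_le_compat_l; [lra|]. rewrite (norm_opp (V := Y)). exact Hphi. }
  assert (Hrem : minus (cs J w (taylor_rem Y J phi psi z w)) (A (taylor_rem Y J phi psi z w)) =
    cs J (Copp (Cmult (Cminus w z) (Cminus w z))) (psi z)).
  { unfold taylor_rem. rewrite !A_minus, (clinear_cs J J A A_clinear).
    transitivity (minus (minus (minus (cs J w (phi w)) (A (phi w)))
        (plus (minus (cs J z (phi z)) (A (phi z))) (cs J (Cminus w z) (phi z))))
      (cs J (Cminus w z) (plus (minus (cs J z (psi z)) (A (psi z))) (cs J (Cminus w z) (psi z))))).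
    - module_C.
    - rewrite !phi_eq, psi_eq. module_C. }
  assert (HN : norm (taylor_rem Y J phi psi z w) <= M * Cmod (Cminus w z) ^ 2).
  { apply Rle_trans with (1 := H w _ _ ltac:(lra) Hrem).
    assert (H1 := Hcs (Copp (Cmult (Cminus w z) (Cminus w z))) (psi z)).
    rewrite Cmod_opp, Cmod_mult in H1.
    apply Rle_trans with
      (B * (k * (Cmod (Cminus w z) * Cmod (Cminus w z) * (B * (B * norm k0))))).
    - apply Rmult_le_compat_l; [lra|]. apply Rle_trans with (1 := H1).
      apply Rmult_le_compat_l; [lra|]. apply Rmult_le_compat_l; [|exact Hpsi].
      apply Rmult_le_pos; apply Cmod_ge_0.
    - apply Req_le. unfold M. ring. }
  assert (HNn := norm_ge_0 (taylor_rem Y J phi psi z w)).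
  assert (Hi : 0 < / (M + 1)) by (apply Rinv_0_lt_compat; lra).
  assert (Hp : 0 <= Cmod (Cminus w z) ^ 2) by (apply pow_le, Cmod_ge_0).
  apply Rle_trans with (/ (M + 1) * ((M + 1) * Cmod (Cminus w z) ^ 2)).
  - apply Rle_trans with (/ (M + 1) * norm (taylor_rem Y J phi psi z w)).
    + apply Rmult_le_compat_r; lra.
    + apply Rmult_le_compat_l; lra.
  - rewrite <- Rmult_assoc, Rinv_l by lra. lra.
Qed.

Lemma phi_at_infinity e : 0 < e -> exists R0, forall z, R0 <= Cmod z -> norm (phi z) <= e.
Proof.
  intros He. destruct (linear_norm A (proj1 A_clinear)) as (M & HM & HA).
  destruct (cs_bound J) as (k & Hk & Hcs).
  assert (HkM : 0 < k * M) by (apply Rmult_lt_0_compat; assumption).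
  assert (Hn := norm_ge_0 k0).
  (* From phi = z^-1 (k0 + A phi): the first summand lets |z| absorb the term with A, the second
     forces what remains below e. *)
  exists (2 * (k * M) + 2 * k * norm k0 / e). intros z Hz.
  assert (Hq : 0 <= 2 * k * norm k0 / e).
  { apply Rmult_le_pos; [apply Rmult_le_pos; lra|]. now apply Rlt_le, Rinv_0_lt_compat. }
  assert (Hz0 : 0 < Cmod z) by lra.
  assert (Nz : z <> RtoC 0) by now apply Cmod_gt_0.
  assert (E : phi z = cs J (Cinv z) (plus k0 (A (phi z)))).
  { rewrite <- (phi_eq z). module_C_coefs; field; exact Nz. }
  assert (H1 := Hcs (Cinv z) (plus k0 (A (phi z)))). rewrite <- E, Cmod_inv in H1 by exact Nz.
  assert (H2 := norm_plus_le k0 (A (phi z))). assert (H3 := HA (phi z)).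
  assert (H4 : Cmod z * norm (phi z) <= k * (norm k0 + M * norm (phi z))).
  { apply Rle_trans with (Cmod z * (k * (/ Cmod z * norm (plus k0 (A (phi z)))))).
    - apply Rmult_le_compat_l; lra.
    - replace (Cmod z * (k * (/ Cmod z * norm (plus k0 (A (phi z)))))) with
        (k * norm (plus k0 (A (phi z)))) by (field; lra).
      apply Rmult_le_compat_l; lra. }
  assert (Hp := norm_ge_0 (phi z)).
  assert (H5 : (2 * (k * M) + 2 * k * norm k0 / e) * norm (phi z) <= Cmod z * norm (phi z))
    by (apply Rmult_le_compat_r; lra).
  assert (H6 : (k * M + 2 * k * norm k0 / e) * norm (phi z) <= k * norm k0) by lra.
  destruct (Rle_or_lt (norm (phi z)) e) as [Hle|Hgt]; [exact Hle|].
  exfalso.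
  assert (H7 : 0 < k * M * norm (phi z)) by (apply Rmult_lt_0_compat; lra).
  assert (H8 : 2 * k * norm k0 / e * e <= 2 * k * norm k0 / e * norm (phi z))
    by (apply Rmult_le_compat_l; lra).
  replace (2 * k * norm k0 / e * e) with (2 * (k * norm k0)) in H8 by (field; lra).
  assert (0 <= k * norm k0) by (apply Rmult_le_pos; lra). lra.
Qed.

Lemma resolvent_defect_zero : k0 = zero.
Proof.
  assert (H0 : phi (RtoC 0) = zero).
  { apply (entire_decay_zero Y J phi psi).
    - intros z0. destruct (Classical_Prop.classic (U z0)) as [Hz|Hz];
        [now apply quad_in_U|now apply quad_off_U].
    - intros e He. now apply phi_at_infinity. }
  rewrite <- (phi_eq (RtoC 0)), H0.
  assert (E : A zero = zero) by (apply (linear_zero A); apply A_clinear).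
  rewrite E. module_C.
Qed.

End ResolventIntegral.

Arguments resolves {Y}.

Theorem resolvent_integral (Y : CompleteNormedModule R_AbsRing) (J : cplx Y) (A : Y -> Y)
  (U : C -> Prop) (G : list (R -> R * R)) (Rs : C -> Y -> Y) :
  clinear J J A ->
  (forall z, U z -> exists e, 0 < e /\ forall w, Cmod (Cminus w z) < e -> U w) ->
  (forall g, In g G -> piecewise_C1 g /\ g 0 = g 1) ->
  (forall z, on_curves G z -> ~ U z) ->
  (forall a, U a -> total_winding G a = 1) ->
  (forall z, ~ U z -> resolves J A (Rs z) z) ->
  forall y, is_cycle_int J G (fun s => Rs s y) (cs J (0, 2 * PI) y).
Proof.
  intros HA HU HG Hoff Hw HR y.
  assert (Hc : cont_on (on_curves G) (fun s => Rs s y)).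
  { apply (curve_cont_on Y J A HA U G Hoff Rs HR y). }
  destruct (ex_cycle_int Y J _ _ G Hc (fun g H => proj1 (HG g H)) (fun z H => H)) as [v Hv].
  assert (E := resolvent_defect_zero Y J A HA U HU G HG Hoff Hw Rs HR y v Hv).
  replace (cs J (0, 2 * PI) y) with v; [exact Hv|].
  replace v with (minus (cs J (0, 2 * PI) y) (minus (cs J (0, 2 * PI) y) v)) by module_C.
  rewrite E. module_C.
Qed.

(** * Quadratic pencils *)

Lemma clinear_comp {X Y Z} (JX : cplx X) (JY : cplx Y) (JZ : cplx Z) (f : X -> Y) (g : Y -> Z) :
  clinear JX JY f -> clinear JY JZ g -> clinear JX JZ (fun x => g (f x)).
Proof.
  intros [Hf Hf'] [Hg Hg']. split; [exact (is_linear_comp f g Hf Hg)|].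
  intros x. now rewrite Hf', Hg'.
Qed.

Lemma is_linear_add {X Y : CompleteNormedModule R_AbsRing} (f g : X -> Y) :
  is_linear f -> is_linear g -> is_linear (fun x => plus (f x) (g x)).
Proof.
  intros Hf Hg.
  exact (is_linear_comp (fun x => (f x, g x)) (fun p => plus (fst p) (snd p))
    (is_linear_prod f g Hf Hg) is_linear_plus).
Qed.

Lemma is_linear_sub {X Y : CompleteNormedModule R_AbsRing} (f g : X -> Y) :
  is_linear f -> is_linear g -> is_linear (fun x => minus (f x) (g x)).
Proof.
  intros Hf Hg. apply (is_linear_add f (fun x => opp (g x)) Hf).
  exact (is_linear_comp g opp Hg is_linear_opp).
Qed.

Lemma clinear_add {X Y} (JX : cplx X) (JY : cplx Y) (f g : X -> Y) :
  clinear JX JY f -> clinear JX JY g -> clinear JX JY (fun x => plus (f x) (g x)).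
Proof.
  intros [Hf Hf'] [Hg Hg']. split; [now apply is_linear_add|].
  intros x. rewrite Hf', Hg', !(cJ_cs JY). module_C.
Qed.

Lemma clinear_sub {X Y} (JX : cplx X) (JY : cplx Y) (f g : X -> Y) :
  clinear JX JY f -> clinear JX JY g -> clinear JX JY (fun x => minus (f x) (g x)).
Proof.
  intros [Hf Hf'] [Hg Hg']. split; [now apply is_linear_sub|].
  intros x. rewrite Hf', Hg', !(cJ_cs JY). module_C.
Qed.

Section ProdCplx.

Variables X Y : CompleteNormedModule R_AbsRing.
Variables (JX : cplx X) (JY : cplx Y).

Notation XY := (prod_CompleteNormedModule X Y).

Definition prod_J (p : XY) : XY := (JX (fst p), JY (snd p)).

Lemma prod_J_lin : is_linear prod_J.
Proof.
  apply (is_linear_prod (fun p : XY => JX (fst p)) (fun p => JY (snd p))).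
  - exact (is_linear_comp (fun p : XY => fst p) JX is_linear_fst (cJ_lin JX)).
  - exact (is_linear_comp (fun p : XY => snd p) JY is_linear_snd (cJ_lin JY)).
Qed.

Lemma prod_J_sq (p : XY) : prod_J (prod_J p) = opp p.
Proof. destruct p as [x y]. unfold prod_J; simpl. now rewrite !cJ_sq. Qed.

Definition cplx_prod : cplx XY := Cplx XY prod_J prod_J_lin prod_J_sq.

Lemma clinear_fst : clinear cplx_prod JX (fun p : XY => fst p).
Proof. split; [apply is_linear_fst|reflexivity]. Qed.

Lemma clinear_snd : clinear cplx_prod JY (fun p : XY => snd p).
Proof. split; [apply is_linear_snd|reflexivity]. Qed.

Lemma clinear_pair {Z} (JZ : cplx Z) (f : Z -> X) (g : Z -> Y) :
  clinear JZ JX f -> clinear JZ JY g -> clinear JZ cplx_prod (fun z => (f z, g z) : XY).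
Proof.
  intros [Hf Hf'] [Hg Hg']. split; [exact (is_linear_prod f g Hf Hg)|].
  intros z. now rewrite Hf', Hg'.
Qed.

End ProdCplx.
Arguments cplx_prod {X Y}.

(** The inverse of the triangular block matrix with z - A on the diagonal and -B above it has R on
    the diagonal and R B R in the corner. *)
Lemma resolves_block (Y : CompleteNormedModule R_AbsRing) (J : cplx Y) (A B Rz : Y -> Y) z :
  clinear J J A -> clinear J J B -> resolves J A Rz z ->
  resolves (cplx_prod J J)
    (fun p => (plus (A (fst p)) (B (snd p)), A (snd p)) : prod_CompleteNormedModule Y Y)
    (fun p => (Rz (plus (fst p) (B (Rz (snd p)))), Rz (snd p)) : prod_CompleteNormedModule Y Y) z.
Proof.
  intros HA HB (Rl & R1 & R2). split; [|split].
  - apply (is_linear_prod (fun p : prod_CompleteNormedModule Y Y =>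
      Rz (plus (fst p) (B (Rz (snd p))))) (fun p => Rz (snd p))).
    + apply (is_linear_comp (fun p : prod_CompleteNormedModule Y Y =>
        plus (fst p) (B (Rz (snd p)))) Rz); [|exact Rl].
      apply (is_linear_add (X := prod_CompleteNormedModule Y Y)); [apply is_linear_fst|].
      apply (is_linear_comp (fun p : prod_CompleteNormedModule Y Y => Rz (snd p)) B); [|apply HB].
      exact (is_linear_comp (fun p : prod_CompleteNormedModule Y Y => snd p) Rz is_linear_snd Rl).
    + exact (is_linear_comp (fun p : prod_CompleteNormedModule Y Y => snd p) Rz is_linear_snd Rl).
  - intros [a b].
    change ((Rz (plus (minus (cs J z a) (plus (A a) (B b))) (B (Rz (minus (cs J z b) (A b))))),
      Rz (minus (cs J z b) (A b))) = (a, b)).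
    rewrite R1. f_equal.
    replace (plus (minus (cs J z a) (plus (A a) (B b))) (B b)) with (minus (cs J z a) (A a))
      by module_C.
    apply R1.
  - intros [a b].
    change ((minus (cs J z (Rz (plus a (B (Rz b))))) (plus (A (Rz (plus a (B (Rz b))))) (B (Rz b))),
      minus (cs J z (Rz b)) (A (Rz b))) = (a, b)).
    rewrite R2. f_equal.
    assert (E := R2 (plus a (B (Rz b)))).
    transitivity (minus (minus (cs J z (Rz (plus a (B (Rz b))))) (A (Rz (plus a (B (Rz b))))))
      (B (Rz b))); [module_C|].
    rewrite E. transitivity (cs J (RtoC 1) a); [module_C|apply cs_one].
Qed.

Section Pencil.

Variable W : CompleteNormedModule R_AbsRing.
Variable J : cplx W.
Variables S N : W -> W.
Hypothesis S_clinear : clinear J J S.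
Hypothesis N_clinear : clinear J J N.
Hypothesis SN_comm : forall x, S (N x) = N (S x).

Definition pencil (z : C) (x : W) : W :=
  plus (minus (cs J (Cmult z z) x) (cs J z (S x))) (N x).

Definition inverts (Qz : W -> W) (z : C) :=
  is_linear Qz /\ (forall x, pencil z (Qz x) = x) /\ (forall x, Qz (pencil z x) = x).

Lemma inverts_comm Qz z (l : W -> W) :
  inverts Qz z -> (forall x, l (pencil z x) = pencil z (l x)) -> forall x, Qz (l x) = l (Qz x).
Proof.
  intros (_ & H1 & H2) Hl x. rewrite <- (H1 x) at 1. now rewrite Hl, H2.
Qed.

Lemma S_lin : is_linear S. Proof. apply S_clinear. Qed.
Lemma N_lin : is_linear N. Proof. apply N_clinear. Qed.

Lemma inverts_cs Qz z c x : inverts Qz z -> Qz (cs J c x) = cs J c (Qz x).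
Proof.
  intros H. apply (inverts_comm Qz z (cs J c) H). intros u. unfold pencil.
  rewrite (clinear_cs J J S S_clinear), (clinear_cs J J N N_clinear). module_C.
Qed.

Lemma inverts_S Qz z x : inverts Qz z -> Qz (S x) = S (Qz x).
Proof.
  intros H. apply (inverts_comm Qz z S H). intros u. unfold pencil.
  rewrite (linear_plus S S_lin), (linear_minus S _ _ S_lin), !(clinear_cs J J S S_clinear), SN_comm.
  reflexivity.
Qed.

Lemma inverts_N Qz z x : inverts Qz z -> Qz (N x) = N (Qz x).
Proof.
  intros H. apply (inverts_comm Qz z N H). intros u. unfold pencil.
  rewrite (linear_plus N N_lin), (linear_minus N _ _ N_lin), !(clinear_cs J J N N_clinear), SN_comm.
  reflexivity.
Qed.

Notation WW := (prod_CompleteNormedModule W W).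

Definition companion (p : WW) : WW := (snd p, minus (S (snd p)) (N (fst p))).

(** Solving (z - companion)(a, b) = (f, g) by b = z a - f gives Q a = z f - S f + g, whence Q b = z
    g - N f. *)
Definition companion_res (Qz : W -> W) (z : C) (p : WW) : WW :=
  (Qz (plus (minus (cs J z (fst p)) (S (fst p))) (snd p)),
   Qz (minus (cs J z (snd p)) (N (fst p)))).

Lemma companion_clinear : clinear (cplx_prod J J) (cplx_prod J J) companion.
Proof.
  apply clinear_pair; [apply clinear_snd|]. apply clinear_sub.
  - exact (clinear_comp _ _ _ _ _ (clinear_snd W W J J) S_clinear).
  - exact (clinear_comp _ _ _ _ _ (clinear_fst W W J J) N_clinear).
Qed.

Lemma companion_resolves Qz z :
  inverts Qz z -> resolves (cplx_prod J J) companion (companion_res Qz z) z.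
Proof.
  intros HQ. assert (HQ' := HQ). destruct HQ' as (Ql & Q1 & Q2).
  assert (cs_fst : is_linear (fun p : WW => cs J z (fst p))).
  { exact (is_linear_comp (fun p : WW => fst p) (cs J z) is_linear_fst (cs_linear J z)). }
  assert (cs_snd : is_linear (fun p : WW => cs J z (snd p))).
  { exact (is_linear_comp (fun p : WW => snd p) (cs J z) is_linear_snd (cs_linear J z)). }
  split; [|split].
  - apply (is_linear_prod (fun p : WW => Qz (plus (minus (cs J z (fst p)) (S (fst p))) (snd p)))
      (fun p => Qz (minus (cs J z (snd p)) (N (fst p))))).
    + apply (is_linear_comp (fun p : WW => plus (minus (cs J z (fst p)) (S (fst p))) (snd p)) Qz);
        [|exact Ql].
      apply (is_linear_add (X := WW)); [|apply is_linear_snd].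
      apply (is_linear_sub (X := WW)); [exact cs_fst|].
      exact (is_linear_comp (fun p : WW => fst p) S is_linear_fst S_lin).
    + apply (is_linear_comp (fun p : WW => minus (cs J z (snd p)) (N (fst p))) Qz); [|exact Ql].
      apply (is_linear_sub (X := WW)); [exact cs_snd|].
      exact (is_linear_comp (fun p : WW => fst p) N is_linear_fst N_lin).
  - intros [a b].
    change ((Qz (plus (minus (cs J z (minus (cs J z a) b)) (S (minus (cs J z a) b)))
               (minus (cs J z b) (minus (S b) (N a)))),
      Qz (minus (cs J z (minus (cs J z b) (minus (S b) (N a)))) (N (minus (cs J z a) b)))) = (a, b)).
    rewrite (linear_minus S _ _ S_lin), (linear_minus N _ _ N_lin),
      (clinear_cs J J S S_clinear), (clinear_cs J J N N_clinear).
    f_equal.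
    + transitivity (Qz (pencil z a)); [|apply Q2]. f_equal. unfold pencil. module_C.
    + transitivity (Qz (pencil z b)); [|apply Q2]. f_equal. unfold pencil. module_C.
  - intros [a b].
    set (u := plus (minus (cs J z a) (S a)) b). set (w := minus (cs J z b) (N a)).
    change ((minus (cs J z (Qz u)) (Qz w),
      minus (cs J z (Qz w)) (minus (S (Qz w)) (N (Qz u)))) = (a, b)).
    rewrite <- !(inverts_cs Qz z z _ HQ), <- (inverts_S Qz z _ HQ), <- (inverts_N Qz z _ HQ).
    rewrite <- !(linear_minus Qz _ _ Ql).
    f_equal.
    + transitivity (Qz (pencil z a)); [|apply Q2]. f_equal. unfold u, w, pencil. module_C.
    + transitivity (Qz (pencil z b)); [|apply Q2]. f_equal. unfold u, w, pencil.
      rewrite (linear_minus S _ _ S_lin), (linear_plus N N_lin), (linear_minus N _ _ N_lin),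
        (clinear_cs J J S S_clinear), (clinear_cs J J N N_clinear), SN_comm. module_C.
Qed.

(** * Contour moments of the inverse pencil and of its square *)

Variable U : C -> Prop.
Hypothesis U_open : forall z, U z -> exists e, 0 < e /\ forall w, Cmod (Cminus w z) < e -> U w.
Variable G : list (R -> R * R).
Hypothesis G_closed : forall g, In g G -> piecewise_C1 g /\ g 0 = g 1.
Hypothesis G_off : forall z, on_curves G z -> ~ U z.
Hypothesis G_winding : forall a, U a -> total_winding G a = 1.
Variable Qi : C -> W -> W.
Hypothesis Qi_inverts : forall z, ~ U z -> inverts (Qi z) z.

Lemma pencil_moments_base x :
  is_cycle_int J G (fun s => Qi s x) zero /\
  is_cycle_int J G (fun s => cs J s (Qi s x)) (cs J (0, 2 * PI) x) /\
  is_cycle_int J G (fun s => Qi s (Qi s x)) zero /\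
  is_cycle_int J G (fun s => cs J s (Qi s (Qi s x))) zero.
Proof.
  (* The companion resolvent R sends (0, x) to (Q^-1 x, s Q^-1 x). Since [B] moves the first
     coordinate to the second place, R B R sends (0, x) to (Q^-2 x, s Q^-2 x). *)
  set (JJ := cplx_prod J J). set (B := fun p : WW => (zero, fst p) : WW).
  assert (B_clinear : clinear JJ JJ B).
  { apply (clinear_pair W W J J JJ (fun _ => zero) (fun p : WW => fst p)); [|apply clinear_fst].
    split; [exact (is_linear_zero (U := WW) (V := W))|].
    intros p. symmetry. exact (linear_zero J (cJ_lin J)). }
  assert (H := resolvent_integral _ (cplx_prod JJ JJ)
    (fun p => (plus (companion (fst p)) (B (snd p)), companion (snd p)))
    U G (fun z p => (companion_res (Qi z) z (plus (fst p) (B (companion_res (Qi z) z (snd p)))),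
                     companion_res (Qi z) z (snd p)))).
  assert (A_clinear : clinear (cplx_prod JJ JJ) (cplx_prod JJ JJ)
    (fun p => (plus (companion (fst p)) (B (snd p)), companion (snd p)))).
  { apply clinear_pair.
    - apply clinear_add.
      + exact (clinear_comp _ _ _ _ _ (clinear_fst WW WW JJ JJ) companion_clinear).
      + exact (clinear_comp _ _ _ _ _ (clinear_snd WW WW JJ JJ) B_clinear).
    - exact (clinear_comp _ _ _ _ _ (clinear_snd WW WW JJ JJ) companion_clinear). }
  specialize (H A_clinear U_open G_closed G_off G_winding).
  assert (HR : forall z, ~ U z -> resolves (cplx_prod JJ JJ)
    (fun p => (plus (companion (fst p)) (B (snd p)), companion (snd p)))
    (fun p => (companion_res (Qi z) z (plus (fst p) (B (companion_res (Qi z) z (snd p)))),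
                     companion_res (Qi z) z (snd p))) z).
  { intros z Hz. apply resolves_block; [exact companion_clinear|exact B_clinear|].
    apply companion_resolves. now apply Qi_inverts. }
  (* This single vector gives all four moments: integration multiplies it by 2 pi i, and its only
     nonzero entry sits where s Q^-1 x appears. *)
  specialize (H HR ((zero, zero), (zero, x))).
  assert (C0 : forall c, cs J c zero = zero) by (intros c; module_C).
  assert (S0 : S zero = zero) by (apply (linear_zero S), S_lin).
  assert (N0 : N zero = zero) by (apply (linear_zero N), N_lin).
  assert (P0 : forall a : W, plus zero a = a) by (intros a; apply plus_zero_l).
  assert (M0 : forall a : W, minus a zero = a).
  { intros a. transitivity (minus a (cs J (RtoC 0) a)); [f_equal; module_C|].
    transitivity (cs J (RtoC 1) a); [module_C|apply cs_one]. }
  assert (E : forall s, companion_res (Qi s) s (zero, x) = (Qi s x, Qi s (cs J s x))).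
  { intros s. unfold companion_res; simpl. now rewrite C0, S0, N0, !M0, P0. }
  assert (E2 : forall s, companion_res (Qi s) s (plus (zero, zero)
     (B (companion_res (Qi s) s (zero, x)))) = (Qi s (Qi s x), Qi s (cs J s (Qi s x)))).
  { intros s. rewrite E. unfold companion_res, B; simpl.
    change (fst (plus (zero, zero) (zero, Qi s x))) with (plus (zero : W) zero).
    change (snd (plus (zero, zero) (zero, Qi s x))) with (plus zero (Qi s x)).
    now rewrite !P0, C0, S0, N0, !M0, P0. }
  assert (P1 := clinear_fst WW WW JJ JJ). assert (P2 := clinear_snd WW WW JJ JJ).
  assert (P3 := clinear_fst W W J J). assert (P4 := clinear_snd W W J J).
  assert (K2 := is_cycle_int_map _ _ _ G _ _ P2 H). assert (K1 := is_cycle_int_map _ _ _ G _ _ P1 H).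
  split; [|split; [|split]].
  - assert (K : is_cycle_int J G (fun s => fst (companion_res (Qi s) s (zero, x))) (cs J (0, 2 * PI) zero))
      by exact (is_cycle_int_map _ _ _ G _ _ P3 K2).
    rewrite C0 in K. apply is_cycle_int_ext with (2 := K). intros s _. now rewrite E.
  - assert (K : is_cycle_int J G (fun s => snd (companion_res (Qi s) s (zero, x))) (cs J (0, 2 * PI) x))
      by exact (is_cycle_int_map _ _ _ G _ _ P4 K2).
    apply is_cycle_int_ext with (2 := K). intros s Hs. rewrite E. simpl.
    apply (inverts_cs _ s). now apply Qi_inverts, G_off.
  - assert (K : is_cycle_int J G (fun s => fst (companion_res (Qi s) s (plus (zero, zero)
      (B (companion_res (Qi s) s (zero, x)))))) (cs J (0, 2 * PI) zero))
      by exact (is_cycle_int_map _ _ _ G _ _ P3 K1).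
    rewrite C0 in K. apply is_cycle_int_ext with (2 := K). intros s _. now rewrite E2.
  - assert (K : is_cycle_int J G (fun s => snd (companion_res (Qi s) s (plus (zero, zero)
      (B (companion_res (Qi s) s (zero, x)))))) (cs J (0, 2 * PI) zero))
      by exact (is_cycle_int_map _ _ _ G _ _ P4 K1).
    rewrite C0 in K. apply is_cycle_int_ext with (2 := K). intros s Hs. rewrite E2. simpl.
    apply (inverts_cs _ s). now apply Qi_inverts, G_off.
Qed.

(** Multiplying pencil s (F s) = F' s by s^k expresses s^(k+2) F through the two lower moments; [S]
    and [N] come out of the integral because they are complex-linear. *)
Lemma pencil_step_int k F F' v0 v1 w :
  (forall s, on_curves G s -> pencil s (F s) = F' s) ->
  is_cycle_int J G (fun s => cs J (Cpow s k) (F s)) v0 ->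
  is_cycle_int J G (fun s => cs J (Cpow s (k + 1)) (F s)) v1 ->
  is_cycle_int J G (fun s => cs J (Cpow s k) (F' s)) w ->
  is_cycle_int J G (fun s => cs J (Cpow s (k + 2)) (F s)) (plus (minus (S v1) (N v0)) w).
Proof.
  intros HF H0 H1 Hw.
  apply is_cycle_int_ext with (fun s => plus (plus (S (cs J (Cpow s (k + 1)) (F s)))
    (cs J (RtoC (-1)) (N (cs J (Cpow s k) (F s))))) (cs J (Cpow s k) (F' s))).
  - intros s Hs. rewrite <- (HF s Hs), (clinear_cs J J S S_clinear), (clinear_cs J J N N_clinear).
    unfold pencil. rewrite !Cpow_add_r. simpl Cpow. module_C.
  - replace (plus (minus (S v1) (N v0)) w) with
      (plus (plus (S v1) (cs J (RtoC (-1)) (N v0))) w) by module_C.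
    apply is_cycle_int_plus; [|exact Hw]. apply is_cycle_int_plus.
    + exact (is_cycle_int_map J J S G _ _ S_clinear H1).
    + exact (is_cycle_int_map J J _ G _ _ (clinear_cscal J _) (is_cycle_int_map J J N G _ _ N_clinear H0)).
Qed.

(** [p] belongs to Q^-1 x and [q] to Q^-2 x. In the first case the pencil returns the constant x,
    and s^k x integrates to zero, so the recurrence is homogeneous; in the second it returns Q^-1 x,
    so [q] is driven by [p]. Two consecutive moments are carried through each induction. *)
Lemma pencil_moments x (p q : nat -> W) :
  p 0%nat = zero -> p 1%nat = x ->
  (forall k, p (k + 2)%nat = minus (S (p (k + 1)%nat)) (N (p k))) ->
  q 0%nat = zero -> q 1%nat = zero ->
  (forall k, q (k + 2)%nat = plus (minus (S (q (k + 1)%nat)) (N (q k))) (p k)) ->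
  forall k, is_cycle_int J G (fun s => cs J (Cpow s k) (Qi s (Qi s x))) (cs J (0, 2 * PI) (q k)).
Proof.
  intros Hp0 Hp1 Hp Hq0 Hq1 Hq. destruct (pencil_moments_base x) as (B1 & B2 & B3 & B4).
  assert (C0 : forall c, cs J c zero = zero) by (intros c; module_C).
  assert (Hpow0 : forall F : C -> W, forall v, is_cycle_int J G F v ->
    is_cycle_int J G (fun s => cs J (Cpow s 0) (F s)) v).
  { intros F v. apply is_cycle_int_ext. intros s _. symmetry. apply cs_one. }
  assert (Hpow1 : forall F : C -> W, forall v, is_cycle_int J G (fun s => cs J s (F s)) v ->
    is_cycle_int J G (fun s => cs J (Cpow s 1) (F s)) v).
  { intros F v. apply is_cycle_int_ext. intros s _. f_equal. simpl. ring. }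
  assert (HP : forall k, is_cycle_int J G (fun s => cs J (Cpow s k) (Qi s x)) (cs J (0, 2 * PI) (p k)) /\
    is_cycle_int J G (fun s => cs J (Cpow s (k + 1)) (Qi s x)) (cs J (0, 2 * PI) (p (k + 1)%nat))).
  { induction k as [|k [IH0 IH1]].
    - rewrite Hp0. simpl Nat.add. rewrite Hp1, C0. auto.
    - replace (Datatypes.S k) with (k + 1)%nat by lia. split; [exact IH1|].
      replace (k + 1 + 1)%nat with (k + 2)%nat by lia. rewrite Hp.
      replace (cs J (0, 2 * PI) (minus (S (p (k + 1)%nat)) (N (p k)))) with
        (plus (minus (S (cs J (0, 2 * PI) (p (k + 1)%nat))) (N (cs J (0, 2 * PI) (p k)))) zero).
      2: { rewrite (clinear_cs J J S S_clinear), (clinear_cs J J N N_clinear). module_C. }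
      apply (pencil_step_int k _ (fun _ => x)); [|exact IH0|exact IH1|].
      + intros s Hs. apply Qi_inverts. now apply G_off.
      + apply is_cycle_int_scalar_zero. intros g Hg. destruct (G_closed g Hg). now apply scalar_int_pow. }
  assert (HQ : forall k,
    is_cycle_int J G (fun s => cs J (Cpow s k) (Qi s (Qi s x))) (cs J (0, 2 * PI) (q k)) /\
    is_cycle_int J G (fun s => cs J (Cpow s (k + 1)) (Qi s (Qi s x))) (cs J (0, 2 * PI) (q (k + 1)%nat))).
  { induction k as [|k [IH0 IH1]].
    - rewrite Hq0. simpl Nat.add. rewrite Hq1, C0. auto.
    - replace (Datatypes.S k) with (k + 1)%nat by lia. split; [exact IH1|].
      replace (k + 1 + 1)%nat with (k + 2)%nat by lia. rewrite Hq.
      replace (cs J (0, 2 * PI) (plus (minus (S (q (k + 1)%nat)) (N (q k))) (p k))) with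
        (plus (minus (S (cs J (0, 2 * PI) (q (k + 1)%nat))) (N (cs J (0, 2 * PI) (q k))))
          (cs J (0, 2 * PI) (p k))).
      2: { rewrite (clinear_cs J J S S_clinear), (clinear_cs J J N N_clinear). module_C. }
      apply (pencil_step_int k _ (fun s => Qi s x)); [|exact IH0|exact IH1|apply HP].
      intros s Hs. apply Qi_inverts. now apply G_off. }
  intros k. apply HQ.
Qed.

End Pencil.

(** * The quaternionic module as a product *)

Ltac module_R_in V :=
  lin_coefs R_Ring (CompleteNormedModule.AbelianGroup R_AbsRing V)
    (@scal R_Ring (CompleteNormedModule.ModuleSpace R_AbsRing V))
    (scal_plus_l R_Ring (CompleteNormedModule.ModuleSpace R_AbsRing V))
    (@scal_distr_l R_Ring (CompleteNormedModule.ModuleSpace R_AbsRing V))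
    (scal_mult_l R_Ring (CompleteNormedModule.ModuleSpace R_AbsRing V))
    (@scal_one R_Ring (CompleteNormedModule.ModuleSpace R_AbsRing V)); cbn.

Lemma norm_pair_le (X Y : CompleteNormedModule R_AbsRing) (p : prod_CompleteNormedModule X Y) :
  norm p <= norm (fst p) + norm (snd p).
Proof.
  change (norm p) with (sqrt (norm (fst p) ^ 2 + norm (snd p) ^ 2)).
  assert (H1 := norm_ge_0 (fst p)). assert (H2 := norm_ge_0 (snd p)).
  apply Rle_trans with (sqrt ((norm (fst p) + norm (snd p)) ^ 2)).
  - apply sqrt_le_1_alt. nra.
  - rewrite sqrt_pow2; lra.
Qed.

Section HXProd.

Variable V : CompleteNormedModule R_AbsRing.

(** [HX] is a bare record; this product carries the topology, and [toW] and [ofW] move statements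
    between the two. *)
Definition WV : CompleteNormedModule R_AbsRing :=
  prod_CompleteNormedModule (prod_CompleteNormedModule V V) (prod_CompleteNormedModule V V).

Definition toW (x : HX V) : WV := ((x0 V x, x1 V x), (x2 V x, x3 V x)).
Definition ofW (w : WV) : HX V :=
  mkHX V (fst (fst w)) (snd (fst w)) (fst (snd w)) (snd (snd w)).

Lemma toW_ofW w : toW (ofW w) = w.
Proof. now destruct w as [[a b] [c d]]. Qed.

Lemma ofW_toW x : ofW (toW x) = x.
Proof. now destruct x. Qed.

Lemma toW_inj x y : toW x = toW y -> x = y.
Proof. intros H. now rewrite <- (ofW_toW x), H, ofW_toW. Qed.

Lemma toW_plus x y : toW (hxplus V x y) = plus (toW x) (toW y).
Proof. reflexivity. Qed.

Lemma toW_scal r x : toW (hxscal r x) = scal r (toW x).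
Proof. reflexivity. Qed.

Lemma toW_minus x y : toW (hxminus V x y) = minus (toW x) (toW y).
Proof.
  unfold hxminus. rewrite toW_plus, toW_scal. generalize (toW x) (toW y). intros a b. module_R.
Qed.

Lemma is_linear_coord (f : WV -> V) (A : V -> V) :
  is_linear A -> is_linear f -> is_linear (fun w => A (f w)).
Proof. intros HA Hf. exact (is_linear_comp f A Hf HA). Qed.

Lemma is_linear_x0 : is_linear (fun w : WV => fst (fst w)).
Proof. exact (is_linear_comp (fun w : WV => fst w) (fun p => fst p) is_linear_fst is_linear_fst). Qed.
Lemma is_linear_x1 : is_linear (fun w : WV => snd (fst w)).
Proof. exact (is_linear_comp (fun w : WV => fst w) (fun p => snd p) is_linear_fst is_linear_snd). Qed.
Lemma is_linear_x2 : is_linear (fun w : WV => fst (snd w)).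
Proof. exact (is_linear_comp (fun w : WV => snd w) (fun p => fst p) is_linear_snd is_linear_fst). Qed.
Lemma is_linear_x3 : is_linear (fun w : WV => snd (snd w)).
Proof. exact (is_linear_comp (fun w : WV => snd w) (fun p => snd p) is_linear_snd is_linear_snd). Qed.

Lemma is_linear_quad (f0 f1 f2 f3 : WV -> V) :
  is_linear f0 -> is_linear f1 -> is_linear f2 -> is_linear f3 ->
  is_linear (fun w : WV => ((f0 w, f1 w), (f2 w, f3 w)) : WV).
Proof.
  intros H0 H1 H2 H3.
  exact (is_linear_prod (fun w : WV => (f0 w, f1 w)) (fun w => (f2 w, f3 w))
    (is_linear_prod f0 f1 H0 H1) (is_linear_prod f2 f3 H2 H3)).
Qed.

Lemma opact_linear A0 A1 A2 A3 :
  is_linear A0 -> is_linear A1 -> is_linear A2 -> is_linear A3 ->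
  is_linear (fun w => toW (opact V A0 A1 A2 A3 (ofW w))).
Proof.
  intros H0 H1 H2 H3. unfold opact, toW, ofW; simpl.
  apply is_linear_quad;
  repeat first [apply (is_linear_sub (X := WV) (Y := V)) | apply (is_linear_add (X := WV) (Y := V))];
  (apply is_linear_coord; [assumption|]);
  first [exact is_linear_x0|exact is_linear_x1|exact is_linear_x2|exact is_linear_x3].
Qed.

Lemma quad_eq (a b c d a' b' c' d' : V) :
  a = a' -> b = b' -> c = c' -> d = d' -> ((a, b), (c, d)) = ((a', b'), (c', d')).
Proof. now intros -> -> -> ->. Qed.

Lemma plus_quad (a b c d a' b' c' d' : V) :
  plus (((a, b), (c, d)) : WV) (((a', b'), (c', d')) : WV) =
  ((plus a a', plus b b'), (plus c c', plus d d')).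
Proof. reflexivity. Qed.

Definition map4 (f : V -> V) (w : WV) : WV :=
  ((f (fst (fst w)), f (snd (fst w))), (f (fst (snd w)), f (snd (snd w)))).

Lemma map4_linear f : is_linear f -> is_linear (map4 f).
Proof.
  intros H. unfold map4. apply is_linear_quad; (apply is_linear_coord; [assumption|]);
  first [exact is_linear_x0|exact is_linear_x1|exact is_linear_x2|exact is_linear_x3].
Qed.

(** * The components of T *)

Variable T : BCop V.

Definition wT (w : WV) : WV := toW (Top T (ofW w)).
Definition wTb (w : WV) : WV := toW (Tbar T (ofW w)).

Lemma wT_linear : is_linear wT.
Proof. apply opact_linear; [apply Tc0_lin|apply Tc1_lin|apply Tc2_lin|apply Tc3_lin]. Qed.

Lemma opp_linear (A : V -> V) : is_linear A -> is_linear (fun v => opp (A v)).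
Proof. intros H. exact (is_linear_comp A opp H is_linear_opp). Qed.

Lemma wTb_linear : is_linear wTb.
Proof.
  apply opact_linear; [apply Tc0_lin| | |]; apply opp_linear;
    [apply Tc1_lin|apply Tc2_lin|apply Tc3_lin].
Qed.

Notation T0 := (Tc0 V T).
Notation T1 := (Tc1 V T).
Notation T2 := (Tc2 V T).
Notation T3 := (Tc3 V T).

Definition normT (v : V) : V := plus (plus (plus (T0 (T0 v)) (T1 (T1 v))) (T2 (T2 v))) (T3 (T3 v)).

(** These six rules put every product of two components in increasing order of index, so that equal
    products become equal atoms. *)
Lemma Tc_swap10 v : T1 (T0 v) = T0 (T1 v). Proof. apply (Tc_comm V T); simpl; auto. Qed.
Lemma Tc_swap20 v : T2 (T0 v) = T0 (T2 v). Proof. apply (Tc_comm V T); simpl; auto. Qed.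
Lemma Tc_swap30 v : T3 (T0 v) = T0 (T3 v). Proof. apply (Tc_comm V T); simpl; auto. Qed.
Lemma Tc_swap21 v : T2 (T1 v) = T1 (T2 v). Proof. apply (Tc_comm V T); simpl; auto. Qed.
Lemma Tc_swap31 v : T3 (T1 v) = T1 (T3 v). Proof. apply (Tc_comm V T); simpl; auto 6. Qed.
Lemma Tc_swap32 v : T3 (T2 v) = T2 (T3 v). Proof. apply (Tc_comm V T); simpl; auto 6. Qed.

Ltac push_T :=
  rewrite ?(linear_minus T0 _ _ (Tc0_lin V T)), ?(linear_minus T1 _ _ (Tc1_lin V T)),
    ?(linear_minus T2 _ _ (Tc2_lin V T)), ?(linear_minus T3 _ _ (Tc3_lin V T)),
    ?(linear_plus T0 (Tc0_lin V T)), ?(linear_plus T1 (Tc1_lin V T)),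
    ?(linear_plus T2 (Tc2_lin V T)), ?(linear_plus T3 (Tc3_lin V T)),
    ?(linear_opp T0 _ (Tc0_lin V T)), ?(linear_opp T1 _ (Tc1_lin V T)),
    ?(linear_opp T2 _ (Tc2_lin V T)), ?(linear_opp T3 _ (Tc3_lin V T)).

(** The components commute and the units anticommute, so the mixed terms cancel and only the sum of
    the squares survives. *)
Lemma wT_wTb w : wT (wTb w) = map4 normT w.
Proof.
  destruct w as [[a b] [c d]]. unfold wT, wTb, Top, Tbar, opact, map4, normT, toW, ofW; simpl.
  apply quad_eq; repeat (progress push_T);
  rewrite ?Tc_swap10, ?Tc_swap20, ?Tc_swap30, ?Tc_swap21, ?Tc_swap31, ?Tc_swap32;
  module_R_in V; ring.
Qed.

Lemma wTb_wT w : wTb (wT w) = map4 normT w.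
Proof.
  destruct w as [[a b] [c d]]. unfold wT, wTb, Top, Tbar, opact, map4, normT, toW, ofW; simpl.
  apply quad_eq; repeat (progress push_T);
  rewrite ?Tc_swap10, ?Tc_swap20, ?Tc_swap30, ?Tc_swap21, ?Tc_swap31, ?Tc_swap32;
  module_R_in V; ring.
Qed.

Lemma wT_comm w : wT (wTb w) = wTb (wT w).
Proof. now rewrite wT_wTb, wTb_wT. Qed.

Lemma wT_plus_wTb w : plus (wT w) (wTb w) = map4 (fun v => plus (T0 v) (T0 v)) w.
Proof.
  destruct w as [[a b] [c d]]. unfold wT, wTb, Top, Tbar, opact, map4, toW, ofW; simpl.
  etransitivity; [exact (plus_quad _ _ _ _ _ _ _ _)|].
  apply quad_eq; module_R_in V; ring.
Qed.

Lemma normT_linear : is_linear normT.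
Proof.
  assert (H : forall A, is_linear A -> is_linear (fun v : V => A (A v))).
  { intros A HA. exact (is_linear_comp A A HA HA). }
  repeat apply (is_linear_add (X := V) (Y := V)); apply H;
    [apply Tc0_lin|apply Tc1_lin|apply Tc2_lin|apply Tc3_lin].
Qed.


Definition SW (w : WV) : WV := plus (wT w) (wTb w).
Definition NW (w : WV) : WV := wT (wTb w).

Lemma SW_NW_comm w : SW (NW w) = NW (SW w).
Proof.
  unfold SW, NW. rewrite (linear_plus wTb wTb_linear), (linear_plus wT wT_linear).
  now rewrite <- !wT_comm.
Qed.

(** * Left multiplication by the slice C_J *)

Variable Jq : quat.
Hypothesis Jq_sphere : in_sphere Jq.

Definition jW (w : WV) : WV := toW (qscal V Jq (ofW w)).

Lemma scal_linear r : is_linear (fun v : V => scal r v).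
Proof. apply (is_linear_scal_r (V := V)). intros a b. apply Rmult_comm. Qed.

Lemma jW_linear : is_linear jW.
Proof. apply opact_linear; apply scal_linear. Qed.

Lemma jW_sq w : jW (jW w) = opp w.
Proof.
  destruct Jq_sphere as [H0 H1].
  destruct w as [[a b] [c d]]. unfold jW, qscal, opact, toW, ofW; simpl.
  transitivity (((opp a, opp b), (opp c, opp d)) : WV); [|reflexivity].
  apply quad_eq; module_coefs; cbn; rewrite ?H0; simpl in H1; nra.
Qed.

Definition JW : cplx WV := Cplx WV jW jW_linear jW_sq.

Lemma cs_qscal z w : cs JW z w = toW (qscal V (cJ Jq z) (ofW w)).
Proof.
  destruct Jq_sphere as [H0 H1].
  destruct w as [[a b] [c d]], z as [u v].
  transitivity (plus (scal u (((a, b), (c, d)) : WV)) (scal v (jW (((a, b), (c, d)) : WV)))).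
  { reflexivity. }
  unfold jW, qscal, opact, toW, ofW; simpl.
  etransitivity; [exact (plus_quad _ _ _ _ _ _ _ _)|].
  apply quad_eq; simpl; module_coefs; cbn; rewrite ?H0; ring.
Qed.

Lemma cJ_mult z w : cJ Jq (Cmult z w) = qmul (cJ Jq z) (cJ Jq w).
Proof.
  destruct Jq_sphere as [H0 H1]. destruct z as [u v], w as [u' v'].
  unfold cJ, qadd, qmul, qreal, Cmult; simpl. rewrite H0. simpl in H1.
  f_equal; try ring.
  transitivity (u * u' - (q1 Jq * (q1 Jq * 1) + q2 Jq * (q2 Jq * 1) + q3 Jq * (q3 Jq * 1)) * (v * v')).
  - rewrite H1. ring.
  - ring.
Qed.

Lemma cJ_pow z n : qpow (cJ Jq z) n = cJ Jq (Cpow z n).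
Proof.
  induction n as [|n IH]; simpl.
  - unfold cJ, qadd, qmul, qreal; simpl. f_equal; ring.
  - now rewrite IH, cJ_mult.
Qed.

(** Here (0, -1) is -i, the image of the factor -J in [dsJ]. *)
Lemma dsJ_cJ g t : dsJ Jq g t = cJ Jq (Cmult (dcurve g t) (0, -1)).
Proof.
  unfold dsJ. rewrite cJ_mult. f_equal. destruct Jq_sphere as [H0 _].
  unfold cJ, qadd, qmul, qreal, qopp; simpl. rewrite H0. f_equal; ring.
Qed.

(** Left multiplication by [Jq] combines the coordinates with real coefficients, and a real-linear
    map acting alike on all four passes through such combinations. *)
Lemma map4_clinear f : is_linear f -> clinear JW JW (map4 f).
Proof.
  intros Hf. split; [now apply map4_linear|]. intros [[a b] [c d]].
  simpl. unfold jW, qscal, opact, toW, ofW, map4; simpl.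
  apply quad_eq; rewrite ?(linear_minus f _ _ Hf), ?(linear_plus f Hf), ?(linear_minus f _ _ Hf),
    ?(linear_plus f Hf), ?(linear_minus f _ _ Hf), ?(linear_plus f Hf), ?(linear_scal f Hf); reflexivity.
Qed.

Lemma clinear_ext {X Y} (JX : cplx X) (JY : cplx Y) (f g : X -> Y) :
  (forall x, f x = g x) -> clinear JX JY f -> clinear JX JY g.
Proof.
  intros H [H1 H2]. split; [now apply is_linear_ext with f|]. intros x. rewrite <- !H. apply H2.
Qed.

(** In the sum the imaginary parts cancel and 2 T0 remains, which acts coordinatewise. *)
Lemma SW_clinear : clinear JW JW SW.
Proof.
  apply clinear_ext with (map4 (fun v => plus (T0 v) (T0 v))).
  - intros w. exact (eq_sym (wT_plus_wTb w)).
  - apply map4_clinear. apply (is_linear_add (X := V) (Y := V)); apply Tc0_lin.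
Qed.

Lemma NW_clinear : clinear JW JW NW.
Proof.
  apply clinear_ext with (map4 normT).
  - intros w. exact (eq_sym (wT_wTb w)).
  - apply map4_clinear, normT_linear.
Qed.

Lemma Qcs_pencil z w : toW (Qcs V T (cJ Jq z) (ofW w)) = pencil WV JW SW NW z w.
Proof.
  unfold Qcs, pencil, SW, NW. rewrite toW_plus, toW_minus, !cs_qscal, <- cJ_mult.
  unfold wT, wTb. rewrite ofW_toW. reflexivity.
Qed.

Definition Qi (z : C) (w : WV) : WV := toW (Qinv V T (cJ Jq z) (ofW w)).

Lemma toW_norm x : norm (toW x) <= hxnorm V x.
Proof.
  apply Rle_trans with (1 := norm_pair_le _ _ (toW x)).
  assert (H1 := norm_pair_le V V (fst (toW x))). assert (H2 := norm_pair_le V V (snd (toW x))).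
  apply Rle_trans with (1 := Rplus_le_compat _ _ _ _ H1 H2). unfold hxnorm; simpl. lra.
Qed.

Lemma ofW_norm w : hxnorm V (ofW w) <= 4 * norm w.
Proof.
  assert (H1 := norm_le_prod_norm_1 (w : prod_CompleteNormedModule V V * prod_CompleteNormedModule V V)).
  assert (H2 := norm_le_prod_norm_2 (w : prod_CompleteNormedModule V V * prod_CompleteNormedModule V V)).
  assert (H3 := norm_le_prod_norm_1 (fst w : V * V)). assert (H4 := norm_le_prod_norm_2 (fst w : V * V)).
  assert (H5 := norm_le_prod_norm_1 (snd w : V * V)). assert (H6 := norm_le_prod_norm_2 (snd w : V * V)).
  assert (K1 := Rle_trans _ _ _ H3 H1). assert (K2 := Rle_trans _ _ _ H4 H1).
  assert (K3 := Rle_trans _ _ _ H5 H2). assert (K4 := Rle_trans _ _ _ H6 H2).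
  unfold hxnorm; simpl.
  apply Rle_trans with (1 := Rplus_le_compat _ _ _ _ (Rplus_le_compat _ _ _ _
    (Rplus_le_compat _ _ _ _ K1 K2) K3) K4).
  apply Req_le. change (norm w + norm w + norm w + norm w = 4 * norm w). ring.
Qed.

Lemma hx_bounded_linear_W B : hx_bounded_linear V B -> is_linear (fun w => toW (B (ofW w))).
Proof.
  intros (H1 & H2 & M & HM). split.
  - intros w w'. exact (f_equal toW (H1 (ofW w) (ofW w'))).
  - intros r w. exact (f_equal toW (H2 r (ofW w))).
  - exists (4 * (Rabs M + 1)). assert (HA := Rabs_pos M). split; [lra|].
    intros w. apply Rle_trans with (1 := toW_norm _). apply Rle_trans with (1 := HM _).
    assert (N1 := ofW_norm w). assert (N0 : 0 <= hxnorm V (ofW w)).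
    { unfold hxnorm. assert (K0 := norm_ge_0 (x0 V (ofW w))). assert (K1 := norm_ge_0 (x1 V (ofW w))).
      assert (K2 := norm_ge_0 (x2 V (ofW w))). assert (K3 := norm_ge_0 (x3 V (ofW w))). lra. }
    assert (HMA := Rle_abs M).
    apply Rle_trans with ((Rabs M + 1) * hxnorm V (ofW w)).
    + apply Rmult_le_compat_r; lra.
    + replace (4 * (Rabs M + 1) * norm w) with ((Rabs M + 1) * (4 * norm w)) by ring.
      apply Rmult_le_compat_l; [lra|exact N1].
Qed.

Lemma Qi_inverts z : ~ S_spectrum T (cJ Jq z) -> inverts WV JW SW NW (Qi z) z.
Proof.
  (* The spectrum is defined by the absence of an inverse, so being outside it is a double negation;
     once removed, the choice operator in [Qinv] meets its specification. *)
  intros H. apply Classical_Prop.NNPP in H.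
  assert (HB := epsilon_spec (inhabits (fun x => x)) (fun B => has_bounded_inverse V (Qcs V T (cJ Jq z)) B) H).
  fold (Qinv V T (cJ Jq z)) in HB. destruct HB as (H1 & H2 & H3).
  split; [now apply hx_bounded_linear_W|]. split.
  - intros w. rewrite <- Qcs_pencil. unfold Qi. now rewrite ofW_toW, H2, toW_ofW.
  - intros w. rewrite <- Qcs_pencil. unfold Qi. now rewrite ofW_toW, H3, toW_ofW.
Qed.

End HXProd.

(** * The moment sequences *)

Arguments toW {V}. Arguments ofW {V}. Arguments wT {V}. Arguments wTb {V}.
Arguments SW {V}. Arguments NW {V}. Arguments JW {V}. Arguments Qi {V}.

Section Moments.

Variable W : CompleteNormedModule R_AbsRing.
Variables t tb : W -> W.
Hypothesis t_lin : is_linear t.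
Hypothesis tb_lin : is_linear tb.
Hypothesis t_comm : forall w, t (tb w) = tb (t w).

(* [pseq], [dseq] and [qseq] list the coefficients of [s^(-k-1)] in the expansions at infinity of
   [1/((s-t)(s-tb))], [1/((s-t)^2 (s-tb))] and [1/((s-t)^2 (s-tb)^2)] applied to [x]. *)
Fixpoint pseq (x : W) (k : nat) : W :=
  match k with O => zero | S k => plus (t (pseq x k)) (Nat.iter k tb x) end.

Fixpoint dseq (x : W) (k : nat) : W :=
  match k with O => zero | S k => plus (t (dseq x k)) (pseq x k) end.

Fixpoint qseq (x : W) (k : nat) : W :=
  match k with O => zero | S k => plus (tb (qseq x k)) (dseq x k) end.

Fixpoint wsum (n : nat) (f : nat -> W) : W :=
  match n with O => zero | S k => plus (wsum k f) (f k) end.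

Lemma t_zero : t zero = zero. Proof. now apply (linear_zero t). Qed.
Lemma tb_zero : tb zero = zero. Proof. now apply (linear_zero tb). Qed.

Lemma pseq_1 x : pseq x 1 = x.
Proof. simpl. rewrite t_zero. apply plus_zero_l. Qed.

Lemma qseq_1 x : qseq x 1 = zero.
Proof. simpl. rewrite tb_zero. apply plus_zero_l. Qed.

(** The defining recurrences are of first order in [t] or [tb]; eliminating the lower sequences
    gives the second-order ones of the pencil, with t + tb and t tb as coefficients. *)
Lemma pseq_rec x k :
  pseq x (k + 2) = minus (plus (t (pseq x (k + 1))) (tb (pseq x (k + 1)))) (t (tb (pseq x k))).
Proof.
  replace (k + 2)%nat with (S (S k)) by lia. rewrite Nat.add_1_r.
  change (pseq x (S (S k))) with (plus (t (pseq x (S k))) (tb (Nat.iter k tb x))).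
  change (tb (pseq x (S k))) with (tb (plus (t (pseq x k)) (Nat.iter k tb x))).
  rewrite (linear_plus tb tb_lin), (t_comm (pseq x k)). module_R_in W; ring.
Qed.

Lemma qseq_rec x k :
  qseq x (k + 2) =
  plus (minus (plus (t (qseq x (k + 1))) (tb (qseq x (k + 1)))) (t (tb (qseq x k)))) (pseq x k).
Proof.
  replace (k + 2)%nat with (S (S k)) by lia. rewrite Nat.add_1_r. cbn [qseq dseq].
  rewrite (linear_plus tb tb_lin), (linear_plus t t_lin). module_R_in W; ring.
Qed.

Lemma iter_comm x n : Nat.iter n tb (tb x) = tb (Nat.iter n tb x).
Proof. induction n as [|n IH]; simpl; congruence. Qed.

Lemma pseq_comm x k : pseq (tb x) k = tb (pseq x k).
Proof.
  induction k as [|k IH]; simpl; [now rewrite tb_zero|].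
  now rewrite IH, iter_comm, (linear_plus tb tb_lin), t_comm.
Qed.

Lemma dseq_comm x k : dseq (tb x) k = tb (dseq x k).
Proof.
  induction k as [|k IH]; simpl; [now rewrite tb_zero|].
  now rewrite IH, pseq_comm, (linear_plus tb tb_lin), t_comm.
Qed.

(** Serves the right-hand formula, where [Tbar] acts on x before the inverses: it need not commute
    with Q^-1 at a given s, but it commutes with the moments. *)
Lemma qseq_comm x k : qseq (tb x) k = tb (qseq x k).
Proof.
  induction k as [|k IH]; simpl; [now rewrite tb_zero|].
  now rewrite IH, dseq_comm, (linear_plus tb tb_lin).
Qed.

Lemma wsum_ext n f g : (forall j, (j < n)%nat -> f j = g j) -> wsum n f = wsum n g.
Proof.
  induction n as [|n IH]; intros H; simpl; [reflexivity|].
  rewrite H by lia. f_equal. apply IH. intros; apply H; lia.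
Qed.

Lemma wsum_linear l n f : is_linear l -> l (wsum n f) = wsum n (fun j => l (f j)).
Proof.
  intros Hl. induction n as [|n IH]; simpl; [now apply (linear_zero l)|].
  now rewrite (linear_plus l Hl), IH.
Qed.

Lemma wsum_plus n f g : plus (wsum n f) (wsum n g) = wsum n (fun j => plus (f j) (g j)).
Proof.
  induction n as [|n IH]; simpl; [apply plus_zero_r|]. rewrite <- IH.
  exact (plus_swap4 (CompleteNormedModule.AbelianGroup _ W) _ _ _ _).
Qed.

Lemma pseq_sum x k : pseq x k = wsum k (fun j => Nat.iter (k - 1 - j) t (Nat.iter j tb x)).
Proof.
  induction k as [|k IH]; [reflexivity|].
  cbn [pseq wsum]. rewrite IH, (wsum_linear t _ _ t_lin). f_equal.
  - apply wsum_ext. intros j Hj. replace (S k - 1 - j)%nat with (S (k - 1 - j)) by lia. reflexivity.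
  - replace (S k - 1 - k)%nat with 0%nat by lia. reflexivity.
Qed.

Lemma dseq_sum x k :
  dseq x (S k) = wsum k (fun j => scal (INR (k - j)) (Nat.iter (k - 1 - j) t (Nat.iter j tb x))).
Proof.
  induction k as [|k IH].
  - simpl. rewrite t_zero. apply plus_zero_r.
  - change (dseq x (S (S k))) with (plus (t (dseq x (S k))) (pseq x (S k))).
    rewrite IH, pseq_sum, (wsum_linear t _ _ t_lin).
    (* The sum is extended to j = k, whose coefficient INR 0 vanishes, to match the length of the
       sum for [pseq], which then raises every coefficient by one. *)
    replace (wsum k (fun j => t (scal (INR (k - j)) (Nat.iter (k - 1 - j) t (Nat.iter j tb x))))) with
      (wsum (S k) (fun j => scal (INR (k - j)) (Nat.iter (S k - 1 - j) t (Nat.iter j tb x)))).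
    + rewrite wsum_plus. apply wsum_ext. intros j Hj.
      replace (S k - j)%nat with (S (k - j)) by lia. rewrite S_INR. module_R.
    + cbn [wsum]. rewrite Nat.sub_diag. simpl INR.
      match goal with |- plus ?a ?b = _ => transitivity a; [module_R|] end.
      apply wsum_ext. intros j Hj. rewrite (linear_scal t t_lin).
      replace (S k - 1 - j)%nat with (S (k - 1 - j)) by lia. reflexivity.
Qed.

End Moments.

(** * Transport of sums, powers and integrals to the product space *)

Lemma toW_iter (V : CompleteNormedModule R_AbsRing) (B : HX V -> HX V) n x :
  toW (Nat.iter n B x) = Nat.iter n (fun w => toW (B (ofW w))) (toW x).
Proof.
  induction n as [|n IH]; [reflexivity|].
  change (toW (B (Nat.iter n B x)) =
    toW (B (ofW (Nat.iter n (fun w => toW (B (ofW w))) (toW x))))).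
  now rewrite <- IH, ofW_toW.
Qed.

Lemma toW_hxsum (V : CompleteNormedModule R_AbsRing) n f :
  toW (hxsum V n f) = wsum (WV V) n (fun j => toW (f j)).
Proof. induction n as [|n IH]; simpl; [reflexivity|]. now rewrite <- IH. Qed.

Lemma toW_Qm (V : CompleteNormedModule R_AbsRing) (T : BCop V) m x :
  toW (Qm T m x) = scal (2 / (INR (m + 1) * INR (m + 2))) (dseq (WV V) (wT T) (wTb T) (toW x) (m + 2)).
Proof.
  unfold Qm. rewrite toW_hxsum. replace (m + 2)%nat with (S (S m)) at 2 by lia.
  rewrite dseq_sum by apply wT_linear.
  rewrite (wsum_linear (WV V) (fun w => scal (2 / (INR (m + 1) * INR (m + 2))) w)).
  2: { apply (is_linear_scal_r (V := WV V)). intros a b. apply Rmult_comm. }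
  apply wsum_ext. intros j Hj. rewrite toW_scal, !toW_iter.
  replace (S m - 1 - j)%nat with (m - j)%nat by lia.
  replace (m - j + 1)%nat with (S m - j)%nat by lia.
  change (fun w => toW (Top T (ofW w))) with (wT T). change (fun w => toW (Tbar T (ofW w))) with (wTb T).
  module_coefs; cbn. unfold Rdiv. ring.
Qed.

Lemma hxint_toW (V : CompleteNormedModule R_AbsRing) (f : R -> HX V) (w : WV V) :
  is_RInt (fun t => toW (f t)) 0 1 w -> toW (hxint V f 0 1) = w.
Proof.
  intros H.
  assert (H1 := is_RInt_fct_extend_fst (U := prod_CompleteNormedModule V V)
    (V := prod_CompleteNormedModule V V) _ _ _ _ H).
  assert (H2 := is_RInt_fct_extend_snd (U := prod_CompleteNormedModule V V)
    (V := prod_CompleteNormedModule V V) _ _ _ _ H).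
  assert (K0 := is_RInt_fct_extend_fst (U := V) (V := V) _ _ _ _ H1).
  assert (K1 := is_RInt_fct_extend_snd (U := V) (V := V) _ _ _ _ H1).
  assert (K2 := is_RInt_fct_extend_fst (U := V) (V := V) _ _ _ _ H2).
  assert (K3 := is_RInt_fct_extend_snd (U := V) (V := V) _ _ _ _ H2).
  apply (is_RInt_unique (V := V)) in K0. apply (is_RInt_unique (V := V)) in K1.
  apply (is_RInt_unique (V := V)) in K2. apply (is_RInt_unique (V := V)) in K3.
  destruct w as [[a b] [c d]]. unfold hxint, toW. simpl in *.
  now rewrite K0, K1, K2, K3.
Qed.

(** [L1] and [L2] are only real-linear, which is what allows [Tbar] to be pulled out of the
    integral. *)
Lemma fold_hxint (V : CompleteNormedModule R_AbsRing) (J : cplx (WV V)) G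
  (L1 L2 : WV V -> WV V) F1 F2 v1 v2 (f : (R -> R * R) -> R -> HX V) :
  is_linear L1 -> is_linear L2 ->
  (forall g, In g G -> forall t, 0 < t < 1 ->
     toW (f g t) = plus (L1 (cs J (dcurve g t) (F1 (g t)))) (L2 (cs J (dcurve g t) (F2 (g t))))) ->
  is_cycle_int J G F1 v1 -> is_cycle_int J G F2 v2 ->
  toW (fold_right (fun g acc => hxplus V (hxint V (f g) 0 1) acc) (hxzero V) G) =
  plus (L1 v1) (L2 v2).
Proof.
  intros HL1 HL2. revert v1 v2; induction G as [|g G IH]; simpl; intros v1 v2 Hf.
  - intros -> ->.
    assert (E1 : L1 zero = zero) by exact (linear_zero L1 HL1).
    assert (E2 : L2 zero = zero) by exact (linear_zero L2 HL2).
    rewrite E1, E2. symmetry. exact (plus_zero_l (zero : WV V)).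
  - intros (a & b & Ha & Hb & ->) (a' & b' & Ha' & Hb' & ->).
    rewrite toW_plus, (IH b b'); auto.
    rewrite (hxint_toW V (f g) (plus (L1 a) (L2 a'))).
    + rewrite (linear_plus L1 HL1), (linear_plus L2 HL2).
      exact (plus_swap4 (CompleteNormedModule.AbelianGroup _ (WV V)) _ _ _ _).
    + apply is_RInt_ext with (fun t => plus (L1 (cs J (dcurve g t) (F1 (g t))))
        (L2 (cs J (dcurve g t) (F2 (g t))))).
      { intros t. rewrite Rmin_left, Rmax_right by lra. intros Ht. symmetry. apply Hf; auto. }
      apply (is_RInt_plus (V := WV V)).
      * exact (is_RInt_linear _ _ L1 _ _ _ _ HL1 Ha).
      * exact (is_RInt_linear _ _ L2 _ _ _ _ HL2 Ha').
Qed.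

(** * The slice as an open set of the plane *)

Lemma cJ_dist J z w : in_sphere J ->
  qnorm2 (qadd (cJ J w) (qopp (cJ J z))) = Cmod (Cminus w z) ^ 2.
Proof.
  intros [H0 H1]. rewrite Cmod2_alt. destruct z as [a b], w as [c d].
  unfold qnorm2, cJ, qadd, qmul, qreal, qopp; simpl. rewrite H0. simpl in H1.
  transitivity ((c - a) * (c - a) + (q1 J * (q1 J * 1) + q2 J * (q2 J * 1) + q3 J * (q3 J * 1)) *
    ((d - b) * (d - b))).
  - ring.
  - rewrite H1. ring.
Qed.

Lemma slice_open U J : in_sphere J -> qopen U -> forall z, slice U J z ->
  exists e, 0 < e /\ forall w, Cmod (Cminus w z) < e -> slice U J w.
Proof.
  intros HJ HU z Hz. destruct (HU _ Hz) as (e & He & H). exists e. split; [exact He|].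
  intros w Hw. apply H. rewrite cJ_dist by exact HJ.
  assert (K := Cmod_ge_0 (Cminus w z)). simpl. rewrite Rmult_1_r.
  apply Rmult_le_0_lt_compat; assumption.
Qed.

(** Every disc around a boundary point meets the complement of the slice, while a point of the open
    slice has a disc inside it. *)
Lemma boundary_off U J G : in_sphere J -> qopen U -> boundary_param U J G ->
  forall z, on_curves G z -> ~ slice U J z.
Proof.
  intros HJ HU (_ & _ & HB) z Hz Hs.
  destruct (slice_open U J HJ HU z Hs) as (e & He & Hball).
  apply HB in Hz. destruct (proj2 (Hz e He)) as (a & Ha & Hd). apply Ha, Hball.
  apply Rsqr_incrst_0; [|apply Cmod_ge_0|lra]. unfold Rsqr.
  replace (Cmod (Cminus a z) * Cmod (Cminus a z)) with (dist2 z a); [exact Hd|].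
  replace (Cmod (Cminus a z) * Cmod (Cminus a z)) with (Cmod (Cminus a z) ^ 2) by ring.
  rewrite Cmod2_alt. destruct a, z; unfold dist2; simpl. ring.
Qed.

Theorem theorem9p1 (V : CompleteNormedModule R_AbsRing) (T : BCop V) (m : nat)
  (U : quat -> Prop) :
  qbounded U -> slice_cauchy_domain U ->
  (forall s, S_spectrum T s -> U s) ->
  forall J, in_sphere J ->
  forall G : list (R -> R * R), pos_oriented_boundary U J G ->
  forall x : HX V,
    Qm T m x = hxscal (- / (4 * PI * INR (m + 1) * INR (m + 2))) (int_L T m J G x) /\
    Qm T m x = hxscal (- / (4 * PI * INR (m + 1) * INR (m + 2))) (int_R T m J G x).
Proof.
  intros _ (HU & _ & _) HT J HJ G (HB & Hw & _) x.
  assert (Hopen := slice_open U J HJ HU). assert (Hoff := boundary_off U J G HJ HU HB).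
  assert (HG : forall g, In g G -> piecewise_C1 g /\ g 0 = g 1).
  { intros g Hg. destruct (proj1 HB g Hg) as (H1 & H2 & _). auto. }
  assert (HQ : forall z, ~ slice U J z ->
    inverts (WV V) (JW J HJ) (SW T) (NW T) (Qi T J z) z).
  { intros z Hz. apply Qi_inverts. intros Hs. apply Hz. now apply HT. }
  set (JJ := JW J HJ) in *. set (q := qseq (WV V) (wT T) (wTb T)).
  assert (Hlin := wT_linear V T). assert (Hblin := wTb_linear V T).
  assert (Hcomm := wT_comm V T).
  assert (Hmom : forall w k, is_cycle_int JJ G
    (fun s => cs JJ (Cpow s k) (Qi T J s (Qi T J s w))) (cs JJ (0, 2 * PI) (q w k))).
  { intros w k.
    apply (pencil_moments (WV V) JJ (SW T) (NW T) (SW_clinear V T J HJ) (NW_clinear V T J HJ)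
      (SW_NW_comm V T) (slice U J) Hopen G HG Hoff Hw (Qi T J) HQ w
      (pseq (WV V) (wT T) (wTb T) w) (q w)).
    - reflexivity.
    - now apply pseq_1.
    - intros j. now apply pseq_rec.
    - reflexivity.
    - now apply qseq_1.
    - intros j. now apply qseq_rec. }
  (* The factor -i of [dsJ] turns 2 pi i into the real number 2 pi. *)
  assert (Hmom' : forall w k, is_cycle_int JJ G
    (fun s => cs JJ (0, -1) (cs JJ (Cpow s k) (Qi T J s (Qi T J s w)))) (scal (2 * PI) (q w k))).
  { intros w k. replace (scal (2 * PI) (q w k)) with (cs JJ (0, -1) (cs JJ (0, 2 * PI) (q w k))).
    - exact (is_cycle_int_map JJ JJ _ G _ _ (clinear_cscal JJ (0, -1)) (Hmom w k)).
    - rewrite <- cs_mult. transitivity (cs JJ (RtoC (2 * PI)) (q w k)).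
      + f_equal. unfold Cmult, RtoC; simpl. f_equal; ring.
      + symmetry. apply scal_cs. }
  (* Both integrals take the value -8 pi (q_{m+3} - Tbar q_{m+2}). By the definition of [qseq] the
     difference is [dseq] at m + 2, and -8 pi times the prefactor is the constant of [toW_Qm]. *)
  assert (Hcoef : forall I : HX V,
    toW I = plus (scal (-4) (scal (2 * PI) (q (toW x) (m + 3)%nat)))
      (scal 4 (wTb T (scal (2 * PI) (q (toW x) (m + 2)%nat)))) ->
    Qm T m x = hxscal (- / (4 * PI * INR (m + 1) * INR (m + 2))) I).
  { intros I HI. apply toW_inj. rewrite toW_Qm, toW_scal, HI.
    replace (m + 3)%nat with (S (m + 2)) by lia. unfold q at 1. cbn [qseq]. fold q.
    change (qseq (WV V) (wT T) (wTb T) (toW x) (m + 2)) with (q (toW x) (m + 2)%nat).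
    rewrite (linear_scal (wTb T) Hblin).
    assert (HPI := PI_RGT_0).
    assert (INR (m + 1) <> 0) by (apply not_0_INR; lia).
    assert (INR (m + 2) <> 0) by (apply not_0_INR; lia).
    generalize (wTb T (q (toW x) (m + 2)%nat)) (dseq (WV V) (wT T) (wTb T) (toW x) (m + 2)).
    intros a b. module_coefs; cbn; field; repeat split; try assumption; lra. }
  assert (Hscal : forall r, is_linear (fun w : WV V => scal r w)).
  { intros r. apply (is_linear_scal_r (V := WV V)). intros a b. apply Rmult_comm. }
  assert (Hon : forall g t, In g G -> 0 < t < 1 -> on_curves G (g t)).
  { intros g t Hg Ht. exists g. split; [exact Hg|]. exists t. split; [lra|reflexivity]. }
  split; apply Hcoef.
  - unfold int_L.
    apply (fold_hxint V JJ G (fun w => scal (-4) w) (fun w => scal 4 (wTb T w)) 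
      (fun s => cs JJ (0, -1) (cs JJ (Cpow s (m + 3)) (Qi T J s (Qi T J s (toW x)))))
      (fun s => cs JJ (0, -1) (cs JJ (Cpow s (m + 2)) (Qi T J s (Qi T J s (toW x)))))).
    + apply Hscal.
    + exact (is_linear_comp (wTb T) (fun w => scal 4 w) Hblin (Hscal 4)).
    + intros g Hg t Ht. set (s := g t). assert (Hs := HQ s (Hoff s (Hon g t Hg Ht))).
      unfold FL. rewrite toW_scal, toW_minus.
      rewrite dsJ_cJ, cJ_pow, <- cJ_mult by exact HJ.
      set (c := Cmult (Cmult (dcurve g t) (0, -1)) (Cpow s (m + 2))).
      set (Q2 := Qinv V T (cJ J s) (Qinv V T (cJ J s) (qscal V (cJ J c) x))).
      (* The scalar c = ds_J s^(m+2) acts before the inverses; both it and s lie in the slice, so it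
         moves past them to the front. *)
      assert (E : toW Q2 = cs JJ c (Qi T J s (Qi T J s (toW x)))).
      { rewrite <- !(inverts_cs (WV V) JJ (SW T) (NW T) (SW_clinear V T J HJ) (NW_clinear V T J HJ) _ s _ _ Hs).
        unfold Qi at 1 2. rewrite !ofW_toW. unfold JJ. rewrite cs_qscal, !ofW_toW. reflexivity. }
      assert (E1 : toW (qscal V (cJ J s) Q2) = cs JJ s (toW Q2)).
      { unfold JJ. now rewrite cs_qscal, ofW_toW. }
      assert (E2 : toW (Tbar T Q2) = wTb T (toW Q2)) by (unfold wTb; now rewrite ofW_toW).
      rewrite E1, E2, E. set (w := Qi T J s (Qi T J s (toW x))).
      replace (cs JJ (dcurve g t) (cs JJ (0, -1) (cs JJ (Cpow s (m + 3)) w))) with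
        (cs JJ s (cs JJ c w)).
      2: { unfold c. replace (m + 3)%nat with (S (m + 2)) by lia. simpl Cpow. module_C. }
      replace (cs JJ (dcurve g t) (cs JJ (0, -1) (cs JJ (Cpow s (m + 2)) w))) with
        (cs JJ c w) by (unfold c; module_C).
      module_R.
    + apply Hmom'.
    + apply Hmom'.
  - unfold int_R.
    (* Now [Tbar] acts on x inside the inverses, below the scalars of the slice; it stays in the
       argument, and the second integrand is a moment of Q^-2 at Tbar x. *)
    apply (fold_hxint V JJ G (fun w => scal (-4) w) (fun w => scal 4 w)
      (fun s => cs JJ (0, -1) (cs JJ (Cpow s (m + 3)) (Qi T J s (Qi T J s (toW x)))))
      (fun s => cs JJ (0, -1) (cs JJ (Cpow s (m + 2)) (Qi T J s (Qi T J s (wTb T (toW x))))))).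
    + apply Hscal.
    + apply Hscal.
    + intros g Hg t Ht. set (s := g t). assert (Hs := HQ s (Hoff s (Hon g t Hg Ht))).
      assert (Hs' := Hs). destruct Hs' as (Ql & _ & _).
      rewrite dsJ_cJ, cJ_pow, <- cJ_mult by exact HJ.
      set (c := Cmult (Cpow s (m + 2)) (Cmult (dcurve g t) (0, -1))).
      assert (E : toW (qscal V (cJ J c) (FR V T (cJ J s) x)) = cs JJ c (toW (FR V T (cJ J s) x))).
      { unfold JJ. now rewrite cs_qscal, ofW_toW. }
      assert (E1 : toW (qscal V (cJ J s) x) = cs JJ s (toW x)).
      { unfold JJ. now rewrite cs_qscal, ofW_toW. }
      assert (E2 : toW (Tbar T x) = wTb T (toW x)) by (unfold wTb; now rewrite ofW_toW).
      assert (EQ : forall y, toW (Qinv V T (cJ J s) (Qinv V T (cJ J s) y)) =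
        Qi T J s (Qi T J s (toW y))).
      { intros y. unfold Qi. now rewrite !ofW_toW. }
      rewrite E. unfold FR. rewrite toW_scal, EQ, toW_minus, E1, E2.
      rewrite !(linear_minus (Qi T J s) _ _ Ql).
      rewrite !(inverts_cs (WV V) JJ (SW T) (NW T) (SW_clinear V T J HJ) (NW_clinear V T J HJ) _ s _ _ Hs).
      set (w := Qi T J s (Qi T J s (toW x))). set (w' := Qi T J s (Qi T J s (wTb T (toW x)))).
      rewrite (linear_scal (cs JJ c) (cs_linear JJ c)), (linear_minus (cs JJ c) _ _ (cs_linear JJ c)).
      replace (cs JJ (dcurve g t) (cs JJ (0, -1) (cs JJ (Cpow s (m + 3)) w))) with
        (cs JJ c (cs JJ s w)).
      2: { unfold c. replace (m + 3)%nat with (S (m + 2)) by lia. simpl Cpow. module_C. }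
      replace (cs JJ (dcurve g t) (cs JJ (0, -1) (cs JJ (Cpow s (m + 2)) w'))) with
        (cs JJ c w') by (unfold c; module_C).
      module_R.
    + apply Hmom'.
    (* Only after integration is [Tbar] brought out, so that the right integral takes the same value
       as the left one. *)
    + rewrite (linear_scal (wTb T) Hblin). unfold q.
      rewrite <- (qseq_comm (WV V) (wT T) (wTb T) Hblin Hcomm). apply Hmom'.
Qed.
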